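(* Let $\Phi$ be a primitive, aperiodic substitution in $\mathbb{R}^n$ with finite local complexity, and suppose that $\Phi$ is of Pisot family type. Let $Q$ be a finite patch (of tiles that are translates of prototiles of $\Phi$; $Q$ is not required to be allowed for $\Phi$) and let $\{v_1,\ldots,v_n\}$ be a basis of $\mathbb{R}^n$ such that $\bar Q:=\bigcup_{k_1,\ldots,k_n\in\mathbb{Z}}\left(Q+\sum_{i=1}^n k_iv_i\right)$ is a tiling of $\mathbb{R}^n$. Suppose that $v\in\mathbb{R}^n$ is completely rationally independent of $\{v_1,\ldots,v_n\}$ and that the tilings $\bar Q$ and $\bar Q-v$ are densely eventually coincident. Then the $\mathbb{R}^n$-action on $\Omega_\Phi$ has pure discrete spectrum.
   Context: Tilings and substitutions. Prototiles are pairs $\rho_i=(C_i,i)$, $i=1,\ldots,l$, with $C_i\subset\mathbb{R}^n$ compact and equal to the closure of its interior. A tile is a translate $\rho_i+v:=(C_i+v,i)$, $v\in\mathbb{R}^n$; its support is $spt(\rho_i+v)=C_i+v$. A patch is a collection of tiles whose supports have pairwise disjoint interiors; $spt(P)$ is the union of the supports of the tiles of $P$. A tiling is a patch with support $\mathbb{R}^n$. A substitution $\Phi$ with linear expansion $\Lambda:\mathbb{R}^n\to\mathbb{R}^n$ assigns to each $\rho_i$ a finite patch $\Phi(\rho_i)$ with support $\Lambda C_i$; it is extended to tiles by $\Phi(\rho_i+v)=\Phi(\rho_i)+\Lambda v$ and to patches by $\Phi(P)=\bigcup_{\tau\in P}\Phi(\tau)$. $\Phi$ is primitive if for some $k$ every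 $\Phi^k(\rho_i)$ contains a translate of every $\rho_j$. A finite patch is allowed for $\Phi$ if it is contained in a translate of some $\Phi^k(\rho_i)$. The tiling space $\Omega_\Phi$ is the set of tilings all of whose finite subpatches are allowed. For a patch $P$ put $B_0[P]=\{\tau\in P:0\in spt(\tau)\}$ and $B_r[P]=\{\tau\in P: spt(\tau)\cap B_r(0)\neq\emptyset\}$ for $r>0$. $\Omega_\Phi$ has the topology with neighborhood base at $T$ given by $U_\epsilon=\{T'\in\Omega_\Phi: B_{1/\epsilon}[T']=B_{1/\epsilon}[T]-v\text{ for some }v\in B_\epsilon(0)\}$, $\epsilon>0$. $\Phi$ has finite local complexity (FLC) if for every $T\in\Omega_\Phi$ and $r\ge0$ there are, up to translation, only finitely many patches $B_r[T-v]$, $v\in\mathbb{R}^n$. $\Phi$ is aperiodic if $T\in\Omega_\Phi$ and $T-v=T$ imply $v=0$. For primitive, aperiodic, FLC $\Phi$, $\Omega_\Phi$ is compact, connected and metrizable, $\Phi:\Omega_\Phi\to\Omega_\Phi$ is a homeomorphism, and the $\mathbb{R}^n$-action $(T,v)\mapsto T-v$ is minimal and uniquely ergodic, with unique invariant probability measure $\mu$. Pure discrete spectrum. $f\in L^2(\Omega_\Phi,\mu)$ is an eigenfunction with eigenvalue $b\in\mathbb{R}^n$ if $f(T-v)=e^{2\pi i\langle b,v\rangle}f(T)$ for all $v$ and almost all $T$. The action has pure discrete spectrum if the linear span of the eigenfunctions is dense in $L^2(\Omega_\Phi,\mu)$. Pisot family type. $\Phi$ is of $(m,d)$-Pisot family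 type if $\Lambda$ is diagonalizable over $\mathbb{C}$, all eigenvalues of $\Lambda$ are algebraic conjugates of one another, of degree $d$, all with the same multiplicity $m$, and the eigenvalues form a Pisot family: they are algebraic integers and whenever $\lambda$ is an eigenvalue and $\lambda'$ is an algebraic conjugate of $\lambda$ with $|\lambda'|\ge1$, then $\lambda'$ is also an eigenvalue of $\Lambda$, of the same multiplicity. $\Phi$ is of Pisot family type if this holds for some $m,d$. Coincidence. For patches $P,P'$ and $x$ in the interior of $spt(P)\cap spt(P')$, $P$ and $P'$ are eventually coincident at $x$ if there is $k\in\mathbb{N}$ with $B_0[\Phi^k(P-x)]=B_0[\Phi^k(P'-x)]$. Two tilings are densely eventually coincident if they are eventually coincident at a dense set of $x\in\mathbb{R}^n$. Rational independence. A vector $v=\sum_{i=1}^n a_iv_i$ is completely rationally independent of the basis $\{v_1,\ldots,v_n\}$ if $x+L\mapsto x+v+L$ is a minimal homeomorphism of the torus $\mathbb{R}^n/L$, where $L=\mathbb{Z}v_1+\cdots+\mathbb{Z}v_n$; equivalently, $1,a_1,\ldots,a_n$ are linearly independent over $\mathbb{Q}$. *)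

(* Defs.v *)
From HB Require Import structures.
From mathcomp Require Import all_boot all_order all_algebra generic_quotient.
From mathcomp Require Import complex.
From mathcomp Require Import all_classical all_reals all_analysis.
Import numFieldNormedType.Exports.

Set Implicit Arguments.
Unset Strict Implicit.
Unset Printing Implicit Defensive.

Import Order.TTheory GRing.Theory Num.Theory.
Local Open Scope classical_set_scope.
Local Open Scope ring_scope.

(* R^n is 'rV[R]_n; its library topology is the usual one, but its library norm
   is the sup norm, so the Euclidean norm and inner product are spelled out. *)
Definition dotv (R : realType) (n : nat) (x y : 'rV[R]_n) : R :=
  \sum_(i < n) x ord0 i * y ord0 i.

Definition enorm (R : realType) (n : nat) (x : 'rV[R]_n) : R :=
  Num.sqrt (dotv x x).

(* The pair (i, v) encodes the tile rho_i + v = (C_i + v, i). The encoding is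
   injective because a nonempty compact C_i satisfies C_i + v = C_i + w only for
   v = w; the same fact makes Phi (rho_i + v) well defined. *)
Definition tile (R : realType) (n l : nat) : Type := ('I_l * 'rV[R]_n)%type.

Section Patches.
Variables (R : realType) (n l : nat).
Implicit Types (C : 'I_l -> set 'rV[R]_n) (t : tile R n l).
Implicit Types (P : set (tile R n l)) (v : 'rV[R]_n).

Definition tile_supp C t : set 'rV[R]_n := [set x + t.2 | x in C t.1].

Definition patch_supp C P : set 'rV[R]_n := \bigcup_(t in P) tile_supp C t.

Definition is_patch C P : Prop :=
  forall t t', P t -> P t' -> t <> t' ->
    (tile_supp C t)° `&` (tile_supp C t')° = set0.

Definition is_tiling C P : Prop := is_patch C P /\ patch_supp C P = setT.

Definition translate v P : set (tile R n l) := [set (t.1, t.2 + v) | t in P].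

(* B_r[P]; B_r(0) is the open Euclidean ball. *)
Definition ball_patch C (r : R) P : set (tile R n l) :=
  [set t | P t /\
    if r == 0 then tile_supp C t 0
    else tile_supp C t `&` [set x | enorm x < r] !=set0].

End Patches.

(* Vectors are rows, so Lambda acts by x |-> x *m Lambda. "Expansion" means that
   all complex eigenvalues of Lambda have modulus > 1. *)
Record substitution (R : realType) (n l : nat) := Substitution {
  proto : 'I_l -> set 'rV[R]_n;
  expansion : 'M[R]_n;
  rule : 'I_l -> set (tile R n l);
  proto_nonempty : forall i, proto i !=set0;
  proto_compact : forall i, compact (proto i);
  proto_regular : forall i, proto i = closure (proto i)°;
  expansion_gt1 : forall z : R[i],
    eigenvalue (map_mx (real_complex R) expansion) z -> 1 < `|z|;
  rule_finite : forall i, finite_set (rule i);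
  rule_patch : forall i, is_patch proto (rule i);
  rule_supp : forall i,
    patch_supp proto (rule i) = [set x *m expansion | x in proto i]
}.

Section Substitutions.
Variables (R : realType) (n l : nat) (Phi : substitution R n l).
Implicit Types (P T : set (tile R n l)) (v x : 'rV[R]_n).

Definition subst P : set (tile R n l) :=
  \bigcup_(t in P) translate (t.2 *m expansion Phi) (rule Phi t.1).

Definition supertile (k : nat) (i : 'I_l) : set (tile R n l) :=
  iter k subst [set (i, 0)].

Definition primitive : Prop :=
  exists k : nat, forall i j : 'I_l, exists v, supertile k i (j, v).

Definition allowed P : Prop :=
  finite_set P /\ exists (k : nat) (i : 'I_l) v, P `<=` translate v (supertile k i).

Definition tiling_space : set (set (tile R n l)) :=
  [set T | is_tiling (proto Phi) T /\
    forall P, P `<=` T -> finite_set P -> allowed P].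

Definition FLC : Prop :=
  forall T (r : R), tiling_space T -> 0 <= r ->
    exists2 F : set (set (tile R n l)), finite_set F &
      forall v, exists2 P, F P &
        exists w, ball_patch (proto Phi) r (translate (- v) T) = translate w P.

Definition aperiodic : Prop :=
  forall T v, tiling_space T -> translate (- v) T = T -> v = 0.

Definition eventually_coincident P P' x : Prop :=
  (patch_supp (proto Phi) P `&` patch_supp (proto Phi) P')° x /\
  exists k : nat,
    ball_patch (proto Phi) 0 (iter k subst (translate (- x) P)) =
    ball_patch (proto Phi) 0 (iter k subst (translate (- x) P')).

Definition densely_eventually_coincident T T' : Prop :=
  dense [set x : 'rV[R]_n | eventually_coincident T T' x].

End Substitutions.

Section PisotFamily.
Variable R : realType.

Definition is_min_poly (p : {poly rat}) (z : R[i]) : Prop :=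
  [/\ p \is monic, irreducible_poly p & root (map_poly ratr p) z].

Definition alg_conjugate (z w : R[i]) : Prop :=
  exists2 p : {poly rat}, is_min_poly p z & root (map_poly ratr p) w.

Definition has_alg_degree (z : R[i]) (d : nat) : Prop :=
  exists2 p : {poly rat}, is_min_poly p z & size p = d.+1.

Definition eigen_mult (n : nat) (A : 'M[R[i]]_n) (z : R[i]) : nat :=
  mup z (char_poly A).

Definition pisot_family (n : nat) (A : 'M[R[i]]_n) : Prop :=
  forall z, eigenvalue A z ->
    integralOver (intr : int -> R[i]) z /\
    forall w, alg_conjugate z w -> 1 <= `|w| ->
      eigenvalue A w /\ eigen_mult A w = eigen_mult A z.

Definition pisot_family_type (n : nat) (L : 'M[R]_n) (m d : nat) : Prop :=
  let A := map_mx (real_complex R) L in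
  [/\ diagonalizable A,
      forall z w, eigenvalue A z -> eigenvalue A w -> alg_conjugate z w,
      forall z, eigenvalue A z -> has_alg_degree z d,
      forall z, eigenvalue A z -> eigen_mult A z = m
    & pisot_family A].

End PisotFamily.

Section Torus.
Local Open Scope quotient_scope.
Variables (R : realType) (n : nat) (b : n.-tuple 'rV[R]_n).
Implicit Types x y v : 'rV[R]_n.

Definition lattice_pt (k : 'I_n -> int) : 'rV[R]_n :=
  \sum_(i < n) tnth b i *~ k i.

Definition lattice_rel x y : bool := `[< exists k, x - y = lattice_pt k >].

Lemma lattice_rel_refl : reflexive lattice_rel.
Proof.
move=> x; apply/asboolP; exists (fun=> 0).
by rewrite subrr /lattice_pt big1// => i _; rewrite mulr0z.
Qed.

Lemma lattice_rel_sym : symmetric lattice_rel.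
Proof.
suff H x y : lattice_rel x y -> lattice_rel y x.
  by move=> x y; apply/idP/idP; exact: H.
move=> /asboolP[k e]; apply/asboolP; exists (fun i => - k i).
rewrite -opprB e /lattice_pt -sumrN.
by apply: eq_bigr => i _; rewrite mulrNz.
Qed.

Lemma lattice_rel_trans : transitive lattice_rel.
Proof.
move=> y x z /asboolP[k e] /asboolP[k' e']; apply/asboolP.
exists (fun i => k i + k' i).
rewrite -[x](subrK y) -addrA e e' /lattice_pt -big_split/=.
by apply: eq_bigr => i _; rewrite mulrzDr.
Qed.

Canonical lattice_equiv :=
  EquivRel lattice_rel lattice_rel_refl lattice_rel_sym lattice_rel_trans.

Definition torus : topologicalType := quotient_topology {eq_quot lattice_equiv}.

Definition torus_pi (x : 'rV[R]_n) : torus := (\pi_{eq_quot lattice_equiv} x)%qT.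

Definition torus_rotation v (q : torus) : torus :=
  torus_pi (repr (q : {eq_quot lattice_equiv}) + v).

Lemma torus_rotationE v x : torus_rotation v (torus_pi x) = torus_pi (x + v).
Proof.
rewrite /torus_rotation /torus_pi; apply/eqmodP => /=.
have /eqmodP/= /asboolP[k e] :
  repr (\pi_{eq_quot lattice_equiv} x)%qT = x %[mod {eq_quot lattice_equiv}]%qT.
  by rewrite reprK.
by apply/asboolP; exists k; rewrite -e opprD addrACA subrr addr0.
Qed.

End Torus.

Definition minimal_map (X : topologicalType) (f : X -> X) : Prop :=
  forall F : set X, closed F -> F !=set0 -> f @` F = F -> F = setT.

Definition completely_rationally_independent (R : realType) (n : nat)
    (b : n.-tuple 'rV[R]_n) (v : 'rV[R]_n) : Prop :=
  minimal_map (torus_rotation (b := b) v).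

Definition periodic_extension (R : realType) (n l : nat)
    (b : n.-tuple 'rV[R]_n) (Q : set (tile R n l)) : set (tile R n l) :=
  \bigcup_(k in [set: 'I_n -> int]) translate (lattice_pt b k) Q.

Section TilingSpace.
Variables (R : realType) (n l : nat) (Phi : substitution R n l).
Implicit Types (P : set (tile R n l)) (v x : 'rV[R]_n).

Definition tilings : Type := set_type (tiling_space Phi).

HB.instance Definition _ := Choice.copy tilings {T | T \in tiling_space Phi}.

Lemma translateD v w P : translate v (translate w P) = translate (w + v) P.
Proof.
apply/seteqP; split => [_ [_ [t Pt <-] <-]|_ [t Pt <-]].
  by exists t => //=; rewrite addrA.
by exists (t.1, t.2 + w) => /=; [exists t|rewrite addrA].
Qed.

Lemma translate0 P : translate 0 P = P.
Proof.
apply/seteqP; split => [_ [[i w] Pt <-]|[i w] Pt]; first by rewrite addr0.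
by exists (i, w); rewrite //= addr0.
Qed.

Lemma nbhs_translate (A : set 'rV[R]_n) x v :
  nbhs x A -> nbhs (x - v) [set y | A (y + v)].
Proof.
move=> /nbhs_ballP[e e0 xA]; apply/nbhs_ballP; exists e => // y /= xy.
apply: xA; split => //= i j; have := xy.2 i j.
by rewrite /ball/= !mxE opprD addrA addrAC.
Qed.

Lemma tile_supp_translate C (t : tile R n l) v x :
  tile_supp C (t.1, t.2 + v) x <-> tile_supp C t (x - v).
Proof.
split => [[y Cy/= <-]|[y Cy e]].
  by exists y => //; rewrite addrA addrK.
by exists y => //=; rewrite addrA e subrK.
Qed.

Lemma tiling_space_translate v T :
  tiling_space Phi T -> tiling_space Phi (translate v T).
Proof.
move=> [[pT sT] aT]; split; first split.
- move=> _ _ [t Tt <-] [t' Tt' <-] tt'.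
  apply/seteqP; split => // x [tx t'x].
  have tt'0 : t <> t' by move=> E; apply: tt'; rewrite E.
  rewrite -(pT _ _ Tt Tt' tt'0).
  suff : ((tile_supp (proto Phi) t)° `&` (tile_supp (proto Phi) t')°) (x - v).
    by rewrite (pT _ _ Tt Tt' tt'0).
  split.
    apply: filterS (nbhs_translate v tx) => y /=.
    by move/tile_supp_translate; rewrite addrK.
  apply: filterS (nbhs_translate v t'x) => y /=.
  by move/tile_supp_translate; rewrite addrK.
- apply/seteqP; split => // x _.
  have [t Tt tx] : patch_supp (proto Phi) T (x - v) by rewrite sT.
  exists (t.1, t.2 + v); first by exists t.
  exact/tile_supp_translate.
- move=> P PT fP; split => //.
  have [||_ [k [i [w Pw]]]] := aT (translate (- v) P).
  + move=> _ [t Pt <-]; have [[j u] Tu /= <-] := PT _ Pt.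
    by rewrite /= addrK.
  + exact: finite_image.
  exists k, i, (w + v); rewrite -translateD => t Pt.
  exists (t.1, t.2 - v); last by rewrite /= subrK; case: t Pt.
  by apply: Pw; exists t.
Qed.

Definition shift (v : 'rV[R]_n) (T : tilings) : tilings :=
  exist _ (translate (- v) (\val T))
    (mem_set (tiling_space_translate (- v) (set_mem (valP T)))).

(* "B_{1/eps}[T'] = B_{1/eps}[T] - v" is read as B_{1/eps}[T'] = B_{1/eps}[T - v].
   If v were instead applied to the patch B_{1/eps}[T], then whenever a tile of T
   touches the sphere of radius 1/eps without meeting the open ball, arbitrarily
   small translates of T would fail to lie in U_eps(T), and the R^n-action on the
   tiling space would not be continuous. *)
Definition tiling_nbhd (T : tilings) (e : R) : set tilings :=
  [set T' | exists2 v, enorm v < e &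
    ball_patch (proto Phi) e^-1 (\val T') =
    ball_patch (proto Phi) e^-1 (translate (- v) (\val T))].

Definition tilings_open : set (set tilings) :=
  [set U | forall T, U T -> exists2 e : R, 0 < e & tiling_nbhd T e `<=` U].

Lemma ball_patch_sub C (r s : R) P P' : 0 < r -> r <= s ->
  ball_patch C s P = ball_patch C s P' -> ball_patch C r P = ball_patch C r P'.
Proof.
suff H A B : 0 < r -> r <= s ->
    ball_patch C s A = ball_patch C s B -> ball_patch C r A `<=` ball_patch C r B.
  by move=> r0 rs e; apply/seteqP; split; apply: H.
move=> r0 rs e t [At]; rewrite /ball_patch/= gt_eqF// => -[x [tx xr]].
suff [Bt _] : ball_patch C s B t by split => //; exists x.
rewrite -e /ball_patch/=; split => //.
rewrite gt_eqF ?(lt_le_trans r0)//.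
by exists x; split => //=; exact: lt_le_trans xr rs.
Qed.

Lemma tiling_nbhd_sub T (e e' : R) : 0 < e -> e <= e' ->
  tiling_nbhd T e `<=` tiling_nbhd T e'.
Proof.
move=> e0 ee' T' [v ve h]; exists v; first exact: lt_le_trans ve ee'.
have e'0 := lt_le_trans e0 ee'.
by apply: ball_patch_sub h; rewrite ?invr_gt0 ?lef_pV2.
Qed.

Lemma tilings_openT : tilings_open setT.
Proof. by move=> T _; exists 1. Qed.

Lemma tilings_openI : setI_closed tilings_open.
Proof.
move=> U V oU oV T [/oU[e e0 eU] /oV[d d0 dV]].
have m0 : 0 < Num.min e d by rewrite lt_min e0.
exists (Num.min e d) => // T' h; split.
  by apply/eU/(tiling_nbhd_sub m0 _ h); rewrite ge_min lexx.
by apply/dV/(tiling_nbhd_sub m0 _ h); rewrite ge_min lexx orbT.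
Qed.

Lemma tilings_open_bigU (I : Type) (f : I -> set tilings) :
  (forall i, tilings_open (f i)) -> tilings_open (\bigcup_i f i).
Proof.
move=> of_ T [i _ /(of_ i)[e e0 ef]].
by exists e => // T' /ef; exists i.
Qed.

HB.instance Definition _ := isOpenTopological.Build tilings
  tilings_openT tilings_openI tilings_open_bigU.

(* Measurable types of the library are pointed, hence the base tiling T0; only
   the distinguished point depends on it. *)
Definition pointed_tilings (T0 : tilings) : Type := tilings.

HB.instance Definition _ (T0 : tilings) := Topological.on (pointed_tilings T0).
HB.instance Definition _ (T0 : tilings) :=
  isPointed.Build (pointed_tilings T0) T0.

Definition borel_tilings (T0 : tilings) :=
  g_sigma_algebraType (@open (pointed_tilings T0)).

End TilingSpace.

Section Spectrum.
Variables (R : realType) (n l : nat) (Phi : substitution R n l).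
Variable T0 : tilings Phi.
Variable mu : probability (borel_tilings T0) R.
Implicit Types f : borel_tilings T0 -> R[i].

Definition translation_invariant : Prop :=
  forall (v : 'rV[R]_n) (A : set (borel_tilings T0)), measurable A ->
    mu ((shift v : borel_tilings T0 -> borel_tilings T0) @^-1` A) = mu A.

Definition L2norm f : \bar R :=
  Lnorm mu 2%:E (fun T => (ComplexField.Normc.normc (f T))%:E).

Definition inL2 f : Prop :=
  [/\ measurable_fun setT (fun T => complex.Re (f T)),
      measurable_fun setT (fun T => complex.Im (f T))
    & (L2norm f < +oo)%E].

(* e^{2 pi i s} *)
Definition expi2pi (s : R) : R[i] :=
  (cos (2 * pi * s) +i* sin (2 * pi * s))%C.

Definition eigenfunction f (b : 'rV[R]_n) : Prop :=
  inL2 f /\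
  forall v : 'rV[R]_n,
    {ae mu, forall T, f (shift v T) = expi2pi (dotv b v) * f T}.

Definition pure_discrete_spectrum : Prop :=
  forall f, inL2 f -> forall e : R, 0 < e ->
    exists (N : nat) (c : 'I_N -> R[i]) (g : 'I_N -> borel_tilings T0 -> R[i])
      (b : 'I_N -> 'rV[R]_n),
      (forall j, eigenfunction (g j) (b j)) /\
      (L2norm (fun T => f T - \sum_(j < N) c j * g j T)%R < e%:E)%E.

End Spectrum.

(* Main.v *)
(* Since v is rationally independent of the periods of Q-bar, the group generated by v and the periods is dense.
   Hence the coincidences of Q-bar with Q-bar - v propagate to any two overlapping tiles whose relative position
   differs by u from one occurring in a tiling of Omega_Phi, for all u in a suitable basis of R^n: such tiles
   coincide at a dense set of points. By the Pisot family hypothesis they have only finitely many overlapping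
   descendants up to translation, so they coincide after a bounded number of substitutions, and the frequency of
   the disagreements between T and T - u Lambda^N decays exponentially in N. Writing w with bounded integer digits
   in the vectors u Lambda^k, one sees that T and T - w agree up to frequency e as soon as finitely many numbers
   <c, w> are close to integers, that is, for w in a Bohr set. Every measurable set, hence every f in L^2, is
   therefore almost invariant under the translations of a Bohr set. Averaging f against a positive trigonometric
   polynomial concentrated on that Bohr set approximates f by finite combinations of its twisted means, which
   are eigenfunctions by the mean ergodic theorem. *)
Require Import Defs.
From HB Require Import structures.
From mathcomp Require Import all_boot all_order all_algebra.
From mathcomp Require Import complex.
From mathcomp Require Import all_classical all_reals all_analysis.
From mathcomp Require Import measurable_realfun.
From mathcomp Require Import lra ring zify.
Import numFieldNormedType.Exports.
Set Implicit Arguments.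
Unset Strict Implicit.
Unset Printing Implicit Defensive.
Import Order.TTheory GRing.Theory Num.Theory.
Local Open Scope classical_set_scope.
Local Open Scope ring_scope.

(** * Supports, patches and supertiles *)

(** [Q] need not be allowed, so coincidences in the periodic tiling do not by themselves concern
    tilings of the space. The link is that every legal pair of tiles of bounded displacement occurs
    inside one supertile, hence inside a high image of the periodic tiling; finite local complexity
    makes one level serve for all. Finiteness of the descendants concerns a finitely generated group
    stable under the expansion: integer coordinates of displacements are bounded one root of the
    minimal polynomial at a time, forwards for a contracting root, backwards from a common
    descendant for an expanding one. The Pisot condition and expansion exclude roots on the unit
    circle. The digits come from rounding coordinates in Euler's dual basis, on which the expansion
    acts as a companion matrix. In the last part a Bohr set might carry little mass for the averages
    that produce eigenfunctions. A kernel that is a squared modulus avoids any equidistribution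
    argument: its mean under a symmetrised average is at least the inverse of a quantity growing
    polynomially in the exponent, while off the Bohr set it decays exponentially. *)

Section LinearMaps.
Variables (R : realType) (n : nat).
Implicit Types (M : 'M[R]_n.+1) (x y : 'rV[R]_n.+1).

Lemma coord_le_norm x i : `|x ord0 i| <= `|x|.
Proof.
rewrite [leRHS]/Num.norm/= mx_normrE.
exact: (le_bigmax _ (fun ij : 'I_1 * 'I_n.+1 => `|x ij.1 ij.2|) (ord0, i)).
Qed.

Lemma norm_le_coord x (r : R) : 0 <= r -> (forall i, `|x ord0 i| <= r) -> `|x| <= r.
Proof.
move=> r0 xr; rewrite [leLHS]/Num.norm/= mx_normrE.
by apply/bigmax_leP; split => // -[i j] _ /=; rewrite ord1.
Qed.

Lemma mulmx_bound M : exists2 c : R, 0 < c & forall x, `|x *m M| <= c * `|x|.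
Proof.
exists (1 + \sum_(i < n.+1) \sum_(j < n.+1) `|M i j|).
  by rewrite ltr_pwDl// sumr_ge0// => i _; exact: sumr_ge0.
move=> x; apply: norm_le_coord => [|j].
  by rewrite mulr_ge0// addr_ge0// sumr_ge0// => i _; exact: sumr_ge0.
rewrite mxE (le_trans (ler_norm_sum _ _ _))//.
apply: (@le_trans _ _ ((\sum_(i < n.+1) \sum_(j < n.+1) `|M i j|) * `|x|)).
  rewrite mulr_suml; apply: ler_sum => i _.
  rewrite normrM mulrC ler_pM ?coord_le_norm//.
  by rewrite (bigD1 j)//= lerDl sumr_ge0.
by rewrite ler_wpM2r// lerDr.
Qed.

Lemma nbhs_mulmx M (A : set 'rV[R]_n.+1) x :
  nbhs (x *m M) A -> nbhs x [set y | A (y *m M)].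
Proof.
move=> /nbhs_ballP[e /= e0 eA]; have [c c0 cM] := mulmx_bound M.
apply/nbhs_ballP; exists (e / c) => /=; first exact: divr_gt0.
move=> y; rewrite mx_norm_ball /ball_/= => xy; apply: eA.
rewrite mx_norm_ball /ball_/= -mulmxBl (le_lt_trans (cM _))//.
by rewrite mulrC -ltr_pdivlMr.
Qed.

Lemma open_mulmx M (A : set 'rV[R]_n.+1) :
  open A -> open [set y | A (y *m M)].
Proof.
rewrite !openE => oA x /= Ax; exact/nbhs_mulmx/oA.
Qed.

Lemma open_shift v (A : set 'rV[R]_n.+1) :
  open A -> open [set y | A (y + v)].
Proof.
rewrite !openE => oA x /= Ax.
have := nbhs_translate v (oA _ Ax).
by rewrite addrK; apply: filterS.
Qed.

Lemma open_norm_lt (r : R) : open [set x : 'rV[R]_n.+1 | `|x| < r].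
Proof.
have -> : [set x : 'rV[R]_n.+1 | `|x| < r] = ball 0 r.
  by rewrite mx_norm_ball; apply/seteqP; split => x /=; rewrite /ball_/= sub0r normrN.
have [r0|r0] := ltP 0 r; first exact: ball_open.
rewrite (_ : ball _ _ = set0); first exact: open0.
apply/seteqP; split => // x; rewrite mx_norm_ball /ball_/= => xr.
by have := lt_le_trans xr r0; rewrite ltNge normr_ge0.
Qed.

Lemma openT_norm (A : set 'rV[R]_n.+1) x : open A -> A x ->
  exists2 r : R, 0 < r & forall y, `|x - y| < r -> A y.
Proof.
rewrite openE => oA /oA /nbhs_ballP[r /= r0 rA]; exists r => // y xy.
by apply: rA; rewrite mx_norm_ball.
Qed.

Lemma enorm_ge_coord x i : `|x ord0 i| <= enorm x.
Proof.
rewrite /enorm -sqrtr_sqr ler_wsqrtr// /dotv (bigD1 i)//= -expr2 lerDl.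
by apply: sumr_ge0 => j _; rewrite -expr2 sqr_ge0.
Qed.

Lemma norm_le_enorm x : `|x| <= enorm x.
Proof.
by apply: norm_le_coord => [|i]; [rewrite sqrtr_ge0|exact: enorm_ge_coord].
Qed.

Lemma enorm_le_norm x : enorm x <= n.+1%:R * `|x|.
Proof.
rewrite -[leRHS]ger0_norm ?mulr_ge0// -sqrtr_sqr ler_wsqrtr// /dotv.
rewrite exprMn.
apply: (@le_trans _ _ (n.+1%:R * `|x| ^+ 2)).
  rewrite -[X in X%:R * _](card_ord n.+1) mulr_natl -sumr_const.
  apply: ler_sum => i _; rewrite -expr2 -[leLHS]real_normK ?num_real//.
  by rewrite lerXn2r ?nnegrE ?coord_le_norm.
by rewrite ler_wpM2r ?sqr_ge0// expr2 ler_peMl// ler1n.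
Qed.

End LinearMaps.

(** * Tiles, overlaps and iterated substitution *)

Section Geometry.
Variables (R : realType) (n l : nat) (Phi : substitution R n.+1 l).
Local Notation V := 'rV[R]_n.+1.
Local Notation tile := (tile R n.+1 l).
Local Notation L := (expansion Phi).
Local Notation C := (proto Phi).
Local Notation supp := (tile_supp (proto Phi)).
Local Notation phi := (subst Phi).
Implicit Types (P : set tile) (t s : tile) (v x : V) (O : set V).

Lemma expansion_unit : L \in unitmx.
Proof.
apply/negPn/negP; rewrite unitmxE unitfE negbK => /det0P[v v0 vL].
have : eigenvalue (map_mx (real_complex R) L) 0.
  apply/eigenvalueP; exists (map_mx (real_complex R) v); last by rewrite map_mx_eq0.
  by rewrite -map_mxM vL map_mx0 scale0r.
by move=> /expansion_gt1; rewrite normr0 ltr10.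
Qed.

Lemma supp_shift t v x : supp (t.1, t.2 + v) x <-> supp t (x - v).
Proof. exact: tile_supp_translate. Qed.

Lemma interior_supp_shift t v x :
  (supp (t.1, t.2 + v))° x <-> (supp t)° (x - v).
Proof.
rewrite /interior; split => h.
  apply: filterS (nbhs_translate v h) => y /= /supp_shift.
  by rewrite addrK.
have := nbhs_translate (- v) h; rewrite opprK subrK.
by apply: filterS => y /= ?; apply/supp_shift.
Qed.

(** A prototile is the closure of its interior, so a point of a support inside an open set can be
    moved to an interior point of the tile within that set. This is how boundary points are avoided
    throughout. *)
Lemma supp_regular t O x : open O -> O x -> supp t x ->
  exists2 y, O y & (supp t)° y.
Proof.
move=> oO Ox; case: t => i v [z Cz /= zx].
have : closure (C i)° z by rewrite -proto_regular.
have /open_nbhs_nbhs/[swap]/[apply] : open_nbhs z [set y | O (y + v)].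
  by split; [exact: open_shift|rewrite /= zx].
move=> [y [Cy Oy]]; exists (y + v) => //.
have := @interior_supp_shift (i, 0) v (y + v).
rewrite /= add0r addrK => /iffRL; apply.
apply: filterS Cy => w Cw; exists w => //=; exact: addr0.
Qed.

Definition overlap t t' := (supp t)° `&` (supp t')° !=set0.

(** The form in which patches are used: a common interior point identifies two tiles. *)
Lemma is_patchP P : is_patch C P <->
  forall t t', P t -> P t' -> overlap t t' -> t = t'.
Proof.
split => [pP t t' Pt Pt' ov|h t t' Pt Pt' tt'].
  apply: contrapT => tt'; have := pP _ _ Pt Pt' tt'.
  by case: ov => x xx /seteqP[/(_ _ xx)].
by apply/seteqP; split => // x xx; apply: tt'; apply: h => //; exists x.
Qed.

Lemma patch_overlap_eq P t t' : is_patch C P -> P t -> P t' -> overlap t t' -> t = t'.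
Proof. by move=> /is_patchP; exact. Qed.

Lemma overlap_shift t t' v : overlap (t.1, t.2 + v) (t'.1, t'.2 + v) <-> overlap t t'.
Proof.
split=> [[x [/interior_supp_shift a /interior_supp_shift b]]|[x [a b]]].
  by exists (x - v).
by exists (x + v); split; apply/interior_supp_shift; rewrite addrK.
Qed.

Lemma subst1E t : phi [set t] = translate (t.2 *m L) (rule Phi t.1).
Proof.
by apply/seteqP; split => [s [_ -> //]|s ts]; exists t.
Qed.

Lemma substE P s : phi P s <-> exists2 t, P t & phi [set t] s.
Proof.
split => [[t Pt ts]|[t Pt]]; first by exists t => //; rewrite subst1E.
by rewrite subst1E => ts; exists t.
Qed.

Lemma iter_substE N P s :
  iter N phi P s <-> exists2 t, P t & iter N phi [set t] s.
Proof.
elim: N s => [|N IH] s /=.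
  by split => [Ps|[_ ? ->]//]; exists s.
split => [/substE[t /IH[u Pu ut] ts]|[u Pu /substE[t ut ts]]].
  by exists u => //; apply/substE; exists t.
by apply/substE; exists t => //; apply/IH; exists u.
Qed.

Lemma iter_subst_sub N P P' : P `<=` P' -> iter N phi P `<=` iter N phi P'.
Proof. by move=> PP' s /iter_substE[t /PP' Pt ts]; apply/iter_substE; exists t. Qed.

Lemma translateP v P s : translate v P s <-> P (s.1, s.2 - v).
Proof.
split => [[t Pt <-]/=|Ps]; first by rewrite addrK; case: t Pt.
by exists (s.1, s.2 - v) => //=; rewrite subrK; case: s Ps.
Qed.

Lemma subst_translate v P : phi (translate v P) = translate (v *m L) (phi P).
Proof.
apply/seteqP; split => s.
  move=> [_ [t Pt <-] /= ts]; apply/translateP; exists t => //.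
  move: ts => /translateP ts; apply/translateP => /=.
  by rewrite -addrA -opprD [v *m L + _]addrC -mulmxDl.
move=> /translateP[t Pt /translateP ts].
exists (t.1, t.2 + v); first by exists t.
apply/translateP => /=; move: ts => /=.
by rewrite -addrA -opprD [v *m L + _]addrC -mulmxDl.
Qed.

Lemma iter_subst_translate N v P :
  iter N phi (translate v P) = translate (v *m L ^+ N) (iter N phi P).
Proof.
elim: N => [|N IH] /=; first by rewrite expr0 mulmx1.
by rewrite IH subst_translate exprSr -mulmxA.
Qed.

Lemma translate1 v t : translate v [set t] = [set (t.1, t.2 + v)].
Proof. by apply/seteqP; split => [_ [_ -> <-]//|_ ->]; exists t. Qed.

Lemma patch_supp1 t : patch_supp C [set t] = supp t.
Proof. by rewrite /patch_supp bigcup_set1. Qed.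

Lemma patch_supp_translate v P x :
  patch_supp C (translate v P) x <-> patch_supp C P (x - v).
Proof.
split => [[_ [t Pt <-] /supp_shift tx]|[t Pt tx]]; first by exists t.
by exists (t.1, t.2 + v); [exists t|apply/supp_shift].
Qed.

Lemma subst_supp P x : patch_supp C (phi P) (x *m L) <-> patch_supp C P x.
Proof.
suff H t : patch_supp C (phi [set t]) (x *m L) <-> supp t x.
  split=> [[s /substE[t Pt ts] sx]|[t Pt /H[s ts sx]]].
    by exists t => //; apply/H; exists s.
  by exists s => //; apply/substE; exists t.
rewrite subst1E; split.
  move=> /patch_supp_translate; rewrite rule_supp -mulmxBl => -[y Cy].
  move=> /(congr1 (mulmx ^~ (invmx L))); rewrite !(mulmxK expansion_unit) => yx.
  by exists y => //; rewrite yx subrK.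
move=> [y Cy <-]; apply/patch_supp_translate.
by rewrite mulmxDl addrK rule_supp; exists y.
Qed.

Lemma iter_subst_supp N P x :
  patch_supp C (iter N phi P) (x *m L ^+ N) <-> patch_supp C P x.
Proof.
elim: N x => [|N IH] x; first by rewrite expr0 mulmx1.
by rewrite exprSr -[_ * _]/(_ *m _) mulmxA iterS subst_supp.
Qed.

Lemma expansionX_unit N : L ^+ N \in unitmx.
Proof. exact: (unitrX N expansion_unit). Qed.

Lemma mulLXK N x : x *m (L ^- N) *m L ^+ N = x.
Proof. by rewrite -[L ^- N]/(invmx _) mulmxKV// expansionX_unit. Qed.

Lemma mulLXVK N x : x *m L ^+ N *m (L ^- N) = x.
Proof. by rewrite -[L ^- N]/(invmx _) mulmxK// expansionX_unit. Qed.

Lemma open_in_patch O P x : open O -> O x -> patch_supp C P x ->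
  exists2 t, P t & exists2 y, O y & (supp t)° y.
Proof.
move=> oO Ox [t Pt tx]; exists t => //; exact: supp_regular oO Ox tx.
Qed.

Lemma iter_subst_interior N t s x :
  iter N phi [set t] s -> (supp s)° x -> (supp t)° (x *m L ^- N).
Proof.
move=> ts sx; rewrite /interior; rewrite -(mulLXK N x) in sx.
apply: filterS (nbhs_mulmx sx) => y /= sy.
by rewrite -patch_supp1; apply/(iter_subst_supp N); exists s.
Qed.

(** The inverse of the expansion carries interior points of descendants to interior points of their
    ancestors. *)
Lemma overlap_ancestor N t t' s s' :
  iter N phi [set t] s -> iter N phi [set t'] s' -> overlap s s' -> overlap t t'.
Proof.
move=> ts t's' [x [sx s'x]]; exists (x *m L ^- N).
by split; [exact: iter_subst_interior sx|exact: iter_subst_interior s'x].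
Qed.

(** Overlapping tiles of the image have overlapping parents, hence the same parent, and the tiles
    produced by one parent form a patch. *)
Lemma subst_patch P : is_patch C P -> is_patch C (phi P).
Proof.
move=> /is_patchP pP; apply/is_patchP => s s' /substE[t Pt ts] /substE[t' Pt' t's'] ov.
have tt' : t = t' by apply: pP => //; exact: (@overlap_ancestor 1) ts t's' ov.
move: t's'; rewrite -{}tt' => ts'.
move: ts ts'; rewrite subst1E => /translateP ts /translateP ts'.
have : (s.1, s.2 - t.2 *m L) = (s'.1, s'.2 - t.2 *m L).
  apply: patch_overlap_eq (@rule_patch _ _ _ Phi t.1) ts ts' _.
  case: ov => x [sx s'x]; exists (x - t.2 *m L).
  by split; apply/interior_supp_shift; rewrite opprK subrK.
by move=> {ts ts' ov}; case: s s' => [i v] [i' v'] /= [-> /addIr ->].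
Qed.

Lemma iter_subst_patch N P : is_patch C P -> is_patch C (iter N phi P).
Proof. by move=> pP; elim: N => //= N; exact: subst_patch. Qed.

Lemma patch1 t : is_patch C [set t].
Proof. by move=> ? ? -> ->. Qed.

Lemma translate_patch v P : is_patch C P -> is_patch C (translate v P).
Proof.
move=> /is_patchP pP; apply/is_patchP => _ _ [t Pt <-] [t' Pt' <-].
move=> [x [/interior_supp_shift tx /interior_supp_shift t'x]].
by rewrite (pP t t')//; exists (x - v).
Qed.

Lemma overlap_refl t : overlap t t.
Proof.
have [x Cx] := proto_nonempty Phi t.1.
have : supp t (x + t.2) by exists x.
by move=> /(supp_regular openT I)[y _ ty]; exists y.
Qed.

End Geometry.

(** * Diameters, inner balls and tile counts *)

Section Bounds.
Variables (R : realType) (n l : nat) (Phi : substitution R n.+1 l).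
Local Notation V := 'rV[R]_n.+1.
Local Notation tile := (tile R n.+1 l).
Local Notation L := (expansion Phi).
Local Notation C := (proto Phi).
Local Notation supp := (tile_supp (proto Phi)).
Local Notation phi := (subst Phi).
Local Notation overlap := (overlap Phi).
Implicit Types (P T : set tile) (t s : tile) (v x : V) (O : set V).

(** The properties are stable under enlarging the threshold, so one exceeding the sum of the
    individual thresholds serves for all indices. *)
Lemma finite_bound (I : finType) (f : I -> R -> Prop) :
  (forall i, exists2 r, 0 < r & forall r', r <= r' -> f i r') ->
  exists2 r, 0 < r & forall i r', r <= r' -> f i r'.
Proof.
move=> h.
have {}h i : exists r, 0 < r /\ forall r', r <= r' -> f i r'.
  by have [r] := h i; exists r.
have [g gP] := choice h.
exists (1 + \sum_i g i).
  by rewrite ltr_wpDr// sumr_ge0// => i _; exact/ltW/(gP i).1.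
move=> i r' r'r; apply: (gP i).2; apply: le_trans r'r.
rewrite (bigD1 i)//= addrCA lerDl addr_ge0// sumr_ge0// => j _.
exact/ltW/(gP j).1.
Qed.

Lemma diam_exists : exists2 D : R, 0 < D & forall t x, supp t x -> `|x - t.2| <= D.
Proof.
have [|D D0 Dle] := @finite_bound _ (fun i r => forall x, C i x -> `|x| <= r).
  move=> i; have [M [Mr MC]] := compact_bounded (@proto_compact _ _ _ Phi i).
  exists (`|M| + 1) => [|r' Mr' x Cx]; first by rewrite ltr_wpDl.
  apply: MC => //; apply: lt_le_trans Mr'.
  by rewrite (le_lt_trans (ler_norm M))// ltrDl.
exists D => // -[i v] x [y Cy /= <-]; rewrite addrK; exact: Dle Cy.
Qed.

Lemma inner_ball_exists : exists2 r : R, 0 < r &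
  exists c : 'I_l -> V, forall t y, `|y - (t.2 + c t.1)| < r -> (supp t)° y.
Proof.
have /choice[c cP] i : exists c : V, (C i)° c.
  have [x Cx] := proto_nonempty Phi i.
  have : supp (i, 0) x by exists x => //; rewrite addr0.
  move=> /(supp_regular openT I)[y _ sy]; exists y.
  apply: filterS sy => z [w Cw /= <-]; by rewrite addr0.
have [|r r0 rP] := @finite_bound _ (fun i r => forall y, `|y - c i| < r^-1 -> C i y).
  move=> i; have [e e0 eP] := openT_norm (open_interior (C i)) (cP i).
  exists e^-1; first by rewrite invr_gt0.
  move=> r' er' y yc; apply: interior_subset; apply: eP.
  rewrite distrC (lt_le_trans yc)// invf_ple ?posrE//.
  by apply: lt_le_trans er'; rewrite invr_gt0.
exists r^-1; first by rewrite invr_gt0.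
exists c => -[i v] y /= yc; apply/nbhs_ballP.
exists (r^-1 - `|y - (v + c i)|); first by rewrite /= subr_gt0.
move=> z; rewrite mx_norm_ball /ball_/= => yz.
exists (z - v); last exact: subrK.
apply: (rP i r); first exact: lexx.
have -> : z - v - c i = (y - (v + c i)) - (y - z).
  by apply/rowP => j; rewrite !mxE; ring.
by rewrite (le_lt_trans (ler_normB _ _))// -ltrBrDl.
Qed.

(** Each tile contains in its interior a point of the grid of mesh [h], obtained by rounding down
    the coordinates of its inner centre. Tiles of a patch have disjoint interiors, so this point
    determines the tile, and it remains to count grid points in a box of size about [B]. *)
Lemma patch_count : exists2 c : R, 0 < c & forall (B : R) P (s : seq tile),
  1 <= B -> is_patch C P -> uniq s -> (forall t, t \in s -> P t /\ `|t.2| <= B) ->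
  (size s)%:R <= c * B ^+ n.+1.
Proof.
have [r r0 [c cP]] := inner_ball_exists.
have [|D D0 DP] := @finite_bound _ (fun i r => `|c i| <= r).
  by move=> i; exists (`|c i| + 1) => [|r']; [rewrite ltr_wpDl|apply: le_trans; rewrite lerDl].
pose h := r / 2.
have h0 : 0 < h by rewrite divr_gt0.
(* Chosen so that the number of grid positions per coordinate, [(K + K).+1] below, is at most
   [b * B] once [1 <= B]. *)
pose b := 2 * ((1 + D) / h + 3) + 1.
have b0 : 0 < b by rewrite ltr_wpDl// mulr_ge0// addr_ge0// divr_ge0 ?ltW// addr_gt0.
exists (b ^+ n.+1); first exact: exprn_gt0.
move=> B P s B1 /is_patchP pP us sP.
pose z t i := Num.floor ((t.2 + c t.1) ord0 i / h).
pose p t : V := \row_i ((z t i)%:~R * h).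
have pt t : (supp t)° (p t).
  apply: cP; rewrite (@le_lt_trans _ _ h)//; last by rewrite /h ltr_pdivrMr// mulr_natr mulr2n ltrDl.
  apply: norm_le_coord; first exact: ltW.
  move=> i; rewrite [X in `|X|]mxE [X in X + _]mxE [X in _ + X]mxE.
  set y := (t.2 + c t.1) ord0 i.
  have /andP[] := floor_itv (y / h); rewrite -/(z t i).
  rewrite ler_pdivlMr// ltr_pdivrMr// intrD mulrDl mul1r => z1 z2.
  rewrite ler_norml; apply/andP; split; first by rewrite lerNl opprB lerBlDl ltW.
  by rewrite lerBlDr (le_trans z1)// lerDr ltW.
pose K := (Num.truncn ((B + D) / h)).+2.
have BD0 : 0 <= (B + D) / h by rewrite divr_ge0 ?ltW// addr_gt0// (lt_le_trans ltr01).
pose g t : {ffun 'I_n.+1 -> 'I_(K + K).+1} := [ffun i => inord (absz (z t i + K%:Z)%R)].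
have zK t i : t \in s -> (- K%:Z <= z t i <= K%:Z).
  move=> /sP[_ tB].
  have yB : `|(t.2 + c t.1) ord0 i / h| <= (B + D) / h.
    rewrite normrM [X in _ * X]ger0_norm ?invr_ge0; last exact: ltW.
    apply: ler_wpM2r; first by rewrite invr_ge0 ltW.
    apply: (le_trans (coord_le_norm _ _)).
    by rewrite (le_trans (ler_normD _ _))// lerD// (DP _ D).
  have K1 : (B + D) / h < K%:R - 1.
    by rewrite /K -natr1 addrK; exact: truncnS_gt.
  move: yB; rewrite ler_norml => /andP[y1 y2].
  have /andP[] := floor_itv ((t.2 + c t.1) ord0 i / h); rewrite -/(z t i) => z1 z2.
  apply/andP; split.
    have : (- K%:Z)%:~R < (z t i + 1)%:~R :> R.
      rewrite rmorphN/= -pmulrn (le_lt_trans _ z2)// (le_trans _ y1)//.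
      by rewrite lerN2 (le_trans (ltW K1))// lerBlDr lerDl.
    by rewrite ltr_int ltzD1.
  rewrite -(ler_int R) -[X in _ <= X]pmulrn (le_trans z1)// (le_trans y2)//.
  by rewrite (le_trans (ltW K1))// lerBlDr lerDl.
have ginj : {in s &, injective g}.
  move=> t t' ts t's gtt'.
  have ztt' i : z t i = z t' i.
    move: gtt' => /ffunP/(_ i); rewrite !ffunE => /(congr1 val)/=.
    have := zK _ i ts; have := zK _ i t's => a b'.
    have lt_absz (k : int) : - K%:Z <= k <= K%:Z -> (absz (k + K%:Z)%R < (K + K).+1)%N.
      by clear; lia.
    rewrite !inordK ?lt_absz//.
    move: a b'; clear; lia.
  apply: pP; [exact: (sP _ ts).1|exact: (sP _ t's).1|].
  exists (p t); split; first exact: pt.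
  have -> : p t = p t' by apply/rowP => i; rewrite !mxE ztt'.
  exact: pt.
have : (size s <= (K + K).+1 ^ n.+1)%N.
  rewrite -(size_map g) (leq_trans (uniq_leq_size (s2 := enum {ffun 'I_n.+1 -> 'I_(K + K).+1}) _ _))//.
  - by rewrite map_inj_in_uniq.
  - by move=> x _; rewrite mem_enum.
  - rewrite -cardE card_ffun !card_ord; exact: leqnn.
have KB : (K + K).+1%:R <= b * B.
  have K2 : K%:R = (Num.truncn ((B + D) / h))%:R + 2 :> R by rewrite /K -addn2 natrD.
  have K1 : (Num.truncn ((B + D) / h))%:R <= (B + D) / h by rewrite truncn_le.
  have K3 : (B + D) / h <= (1 + D) / h * B.
    rewrite mulrAC; apply: ler_wpM2r; first by rewrite invr_ge0 ltW.
    by rewrite mulrDl mul1r lerD2l ler_peMr// ltW.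
  rewrite -natr1 natrD K2 /b; move: K1 K3 B1; clear.
  set a := _%:R; set u := (B + D) / h; set w := (1 + D) / h; nra.
rewrite -(ler_nat R) natrX => /le_trans; apply.
rewrite -exprMn; apply: lerXn2r => //; rewrite nnegrE//.
by rewrite (le_trans _ KB).
Qed.

Lemma local_finite P (B : R) : is_patch C P ->
  finite_set [set t | P t /\ `|t.2| <= B].
Proof.
have [c c0 cP] := patch_count => pP; apply: contrapT => /infinite_set_fset.
pose B' := Num.max B 1.
pose N := (Num.truncn (c * B' ^+ n.+1)).+1.
move=> /(_ N)[A AB NA].
have : (size (finmap.enum_fset A))%:R <= c * B' ^+ n.+1.
  apply: (cP B' P _ _ pP (finmap.fset_uniq A)); first by rewrite le_max lexx orbT.
  by move=> t /AB[Pt tB]; split => //; rewrite le_max tB.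
apply/negP; rewrite -ltNge; apply: (@lt_le_trans _ _ N%:R).
  exact: truncnS_gt.
by rewrite ler_nat.
Qed.

End Bounds.

(** * Supertiles and legal pairs of tiles *)

Section Supertiles.
Variables (R : realType) (n l : nat) (Phi : substitution R n.+1 l).
Local Notation V := 'rV[R]_n.+1.
Local Notation tile := (tile R n.+1 l).
Local Notation L := (expansion Phi).
Local Notation C := (proto Phi).
Local Notation supp := (tile_supp (proto Phi)).
Local Notation phi := (subst Phi).
Local Notation overlap := (overlap Phi).
Implicit Types (P T : set tile) (t s : tile) (v x : V) (O : set V).
Implicit Types (i j : 'I_l).

Hypothesis primitive_Phi : primitive Phi.

Lemma rule_nonempty i : rule Phi i !=set0.
Proof.
have [x Cx] := proto_nonempty Phi i.
have : patch_supp C (rule Phi i) (x *m L) by rewrite rule_supp; exists x.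
by move=> [t]; exists t.
Qed.

Lemma iter_subst1_nonempty N t : iter N phi [set t] !=set0.
Proof.
elim: N t => [|N IH] t; first by exists t.
have [s ts] := IH t; have [u su] := rule_nonempty s.1.
exists (u.1, u.2 + s.2 *m L) => /=; exists s => //.
by apply/translateP; rewrite addrK; case: u su.
Qed.

Lemma iter_subst_comp N M P : iter (N + M) phi P = iter N phi (iter M phi P).
Proof. by rewrite iterD. Qed.

Lemma iter_subst1 N t : iter N phi [set t] = translate (t.2 *m L ^+ N) (supertile Phi N t.1).
Proof.
rewrite /supertile -iter_subst_translate translate1/= add0r.
by case: t.
Qed.

Lemma translate_supertile N v i :
  translate v (supertile Phi N i) = iter N phi [set (i, v *m L ^- N)].
Proof. by rewrite iter_subst1/= mulLXK. Qed.

Lemma supertile_patch N v i : is_patch C (translate v (supertile Phi N i)).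
Proof. by rewrite translate_supertile; apply: iter_subst_patch; exact: patch1. Qed.

(** After [k - k0] substitutions some tile is present, and primitivity supplies all types in the
    remaining [k0] steps. *)
Lemma supertile_all_types : exists k0, forall k i j, (k0 <= k)%N ->
  exists v, supertile Phi k i (j, v).
Proof.
have [k0 k0P] := primitive_Phi; exists k0 => k i j k0k.
have [[i1 v1] s1] := iter_subst1_nonempty (k - k0) (i, 0).
have [v jv] := k0P i1 j.
exists (v + v1 *m L ^+ k0); rewrite /supertile -(subnKC k0k) iter_subst_comp.
apply/iter_substE; exists (i1, v1) => //; rewrite iter_subst1/=.
by apply/translateP; rewrite /= addrK.
Qed.

Lemma supertile_sub : exists k0, forall k m i j, (k + k0 <= m)%N ->
  exists w, translate w (supertile Phi k j) `<=` supertile Phi m i.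
Proof.
have [k0 k0P] := supertile_all_types; exists k0 => k m i j km.
have km' : (k <= m)%N by rewrite (leq_trans _ km)// leq_addr.
have [v jv] : exists v, supertile Phi (m - k) i (j, v).
  by apply: k0P; rewrite leq_subRL.
exists (v *m L ^+ k); rewrite /supertile -(subnKC km') iter_subst_comp.
rewrite -[X in X `<=` _](iter_subst1 k (j, v)); apply: iter_subst_sub.
by move=> _ ->.
Qed.

Definition meets (r : R) t := exists2 x, supp t x & `|x| < r.

(** The tiles of [T] meeting the ball form a finite patch, which is allowed, and the supertile
    containing it can be embedded in one of any higher level. Conversely a tile of the supertile
    that meets the ball overlaps one of these tiles there and so equals it. *)
Lemma patch_cover T (r : R) (K : nat) : tiling_space Phi T ->
  exists k i w, (K <= k)%N /\ forall s, meets r s ->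
    (translate w (supertile Phi k i) s <-> T s).
Proof.
move=> [[pT sT] aT].
have [D D0 DP] := diam_exists Phi.
have [k0 k0P] := supertile_sub.
pose P : set tile := [set t | T t /\ meets r t].
have finP : finite_set P.
  apply: sub_finite_set (@local_finite _ _ _ Phi T (r + D) pT) => t [Tt [x tx xr]].
  split => //; have := DP _ _ tx => xtD.
  by rewrite -[t.2](subKr x) (le_trans (ler_normB _ _))// lerD// ltW.
have [_ [k [i [w Pk]]]] := aT P (fun t Pt => Pt.1) finP.
have [w' kK] : exists w, translate w (supertile Phi k i) `<=` supertile Phi (K + k + k0) i.
  by apply: k0P; lia.
exists (K + k + k0)%N, i, (w - w'); split; first by lia.
set S := translate _ _.
have PS : P `<=` S.
  move=> t /Pk /translateP tk; apply/translateP/kK/translateP => /=.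
  by rewrite opprB addrA addrAC addrK.
have pS : is_patch C S by exact: supertile_patch.
move=> s [x sx xr]; split => [Ss|Ts]; last by apply: PS; split => //; exists x.
have [y yr sy] := supp_regular (@open_norm_lt R n r) xr sx.
have oO : open ((supp s)° `&` [set x | `|x| < r]).
  by apply: openI; [exact: open_interior|exact: open_norm_lt].
have [t Tt [z [sz zr] tz]] : exists2 t, T t & exists2 z, ((supp s)° `&` [set x | `|x| < r]) z & (supp t)° z.
  by apply: open_in_patch oO _ _; [split; [exact: sy|exact: yr]|rewrite sT].
suff -> : s = t by [].
apply: patch_overlap_eq pS Ss _ _; last by exists z.
by apply: PS; split => //; exists z => //; exact: interior_subset.
Qed.

(** On a large ball [T] agrees with a supertile of high level, which splits into supertiles of level
    [N]; one through the origin lies in the region of agreement and contains a supertile of level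
    [K] and type [i]. *)
Lemma supertile_in_tiling T K i : tiling_space Phi T ->
  exists w, translate w (supertile Phi K i) `<=` T.
Proof.
move=> TT; have [[pT sT] _] := TT.
have [k0 k0P] := supertile_sub.
have [D D0 DP] := diam_exists Phi.
pose N := (K + k0)%N.
suff [j [w sub]] : exists j w, translate w (supertile Phi N j) `<=` T.
  have [w' ws] := k0P K N j i (leqnn _).
  exists (w' + w); rewrite -translateD => t /translateP ts.
  by apply: sub; apply/translateP/ws.
have [c c0 cP] := mulmx_bound (L ^+ N).
(* Two points of a tile are at distance at most [D + D], so a supertile of level [N] through the
   origin lies within this radius. *)
pose r := c * (D + D) + 1.
have [k [i0 [w [Nk kP]]]] := patch_cover r N TT.
have [t Tt t0] : patch_supp C T 0 by rewrite sT.
have : translate w (supertile Phi k i0) t.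
  by apply/kP => //; exists 0 => //; rewrite normr0 ltr_wpDl// mulr_ge0// ltW// addr_gt0.
rewrite translate_supertile -(subnKC Nk) iter_subst_comp => /iter_substE[s Ss st].
exists s.1, (s.2 *m L ^+ N); rewrite -iter_subst1 => u su.
apply/kP; last first.
  by rewrite translate_supertile -(subnKC Nk) iter_subst_comp; apply/iter_substE; exists s.
have [y uy] : supp u !=set0 by have [y [/interior_subset]] := overlap_refl Phi u; exists y.
have suppN z : patch_supp C (iter N phi [set s]) z -> supp s (z *m L ^- N).
  by rewrite -{1}(mulLXK Phi N z) => /iter_subst_supp; rewrite patch_supp1.
exists y => //.
have s1 : supp s (y *m L ^- N) by apply: suppN; exists u.
have s2 : supp s (0 *m L ^- N) by apply: suppN; exists t.
rewrite -[y](mulLXK Phi N) (le_lt_trans (cP _))// ltr_pwDr//.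
apply: ler_wpM2l; first exact: ltW.
rewrite mul0mx in s2.
have := ler_normB (y *m L ^- N - s.2) (0 - s.2).
rewrite sub0r opprK subrK => /le_trans; apply.
by rewrite lerD ?DP// -sub0r DP.
Qed.

Definition legal i j v := exists k i0 a, supertile Phi k i0 (i, a) /\ supertile Phi k i0 (j, a + v).

Lemma legal_supertile i j v : legal i j v ->
  exists k1, forall K i0, (k1 <= K)%N ->
    exists a, supertile Phi K i0 (i, a) /\ supertile Phi K i0 (j, a + v).
Proof.
move=> [k [i1 [a [ia ja]]]]; have [k0 k0P] := supertile_sub.
exists (k + k0)%N => K i0 kK.
have [w ws] := k0P k K i0 i1 kK.
by exists (a + w); split; apply: ws; apply/translateP; rewrite /= ?addrK// addrAC addrK.
Qed.

(** A legal pair occurs in [T], since [T] contains supertiles of every level and type, and it is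
    visible in the ball patch around its first tile. By finite local complexity these patches are
    finitely many up to translation. *)
Lemma legal_finite (r : R) T : tiling_space Phi T -> FLC Phi ->
  finite_set [set p : 'I_l * 'I_l * V | legal p.1.1 p.1.2 p.2 /\ `|p.2| < r].
Proof.
move=> TT flc; have [[pT sT] aT] := TT.
have [D D0 DP] := diam_exists Phi.
pose rr := n.+1%:R * (`|r| + D + 1).
have rr0 : 0 < rr by rewrite mulr_gt0// ltr_wpDl// addr_ge0// ltW.
have [F finF FP] := flc T rr TT (ltW rr0).
(* [F] may have members that are not ball patches, so only its finite members are kept;
   [local_finite] shows that the relevant ones are finite. *)
pose G := \bigcup_(P in [set P | F P /\ finite_set P])
  [set ((u.1.1, u.2.1), u.2.2 - u.1.2) | u in P `*` P].
have finG : finite_set G.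
  apply: bigcup_finite.
    by apply: sub_finite_set finF => P [].
  by move=> P [_ finP]; apply: finite_image; exact: finite_setX.
apply: sub_finite_set finG => -[[i j] v] /= [lij vr].
have [k1 k1P] := legal_supertile lij.
have [a [ia ja]] := k1P k1 i (leqnn _).
have [w wT] := supertile_in_tiling k1 i TT.
have Ti : T (i, a + w) by apply: wT; apply/translateP; rewrite /= addrK.
have Tj : T (j, a + v + w) by apply: wT; apply/translateP; rewrite /= addrK.
have [P FP' [u uE]] := FP (a + w).
have inball x : `|x| < `|r| + D + 1 -> enorm x < rr.
  by move=> xr; rewrite (le_lt_trans (enorm_le_norm _))// ltr_pM2l.
have bi : ball_patch C rr (translate (- (a + w)) T) (i, 0).
  split; first by apply/translateP; rewrite /= sub0r opprK.
  rewrite gt_eqF//; have [x [/interior_subset ix _]] := overlap_refl Phi (i, 0).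
  exists x; split => //=; apply: inball; have := DP _ _ ix; rewrite subr0 => /le_lt_trans; apply.
  by rewrite addrAC ltrDr ltr_wpDl.
have bj : ball_patch C rr (translate (- (a + w)) T) (j, v).
  split; first by apply/translateP; rewrite /= opprK addrA [v + a]addrC.
  rewrite gt_eqF//; have [x [/interior_subset ix _]] := overlap_refl Phi (j, v).
  exists x; split => //=; apply: inball; have := DP _ _ ix => /= xv.
  rewrite -[x](subrK v) (le_lt_trans (ler_normD _ _))//.
  by rewrite addrC -addrA ler_ltD// ?ltr_pwDr// (le_trans (ltW vr))// ler_norm.
exists P; last first.
  exists ((i, 0 - u), (j, v - u)).
    by split; [move: bi|move: bj]; rewrite uE => /translateP.
  by rewrite /= opprB addrA subrK subr0.
split => //.
have -> : P = translate (- u) (ball_patch C rr (translate (- (a + w)) T)).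
  by rewrite uE translateD subrr translate0.
apply: finite_image.
apply: sub_finite_set (@local_finite _ _ _ Phi (translate (- (a + w)) T) (rr + D) _).
  move=> t [Tt]; rewrite gt_eqF// => -[x [tx xr]]; split => //.
  have := DP _ _ tx => xtD.
  rewrite -[t.2](subKr x) (le_trans (ler_normB _ _))// lerD//.
  by rewrite (le_trans (norm_le_enorm _))// ltW.
exact: translate_patch.
Qed.

End Supertiles.

(** * Coincidences *)

Section Coincidence.
Variables (R : realType) (n l : nat) (Phi : substitution R n.+1 l).
Local Notation V := 'rV[R]_n.+1.
Local Notation tile := (tile R n.+1 l).
Local Notation L := (expansion Phi).
Local Notation C := (proto Phi).
Local Notation supp := (tile_supp (proto Phi)).
Local Notation phi := (subst Phi).
Local Notation overlap := (overlap Phi).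
Implicit Types (P T : set tile) (t s : tile) (v w x y : V) (O : set V).

Lemma mulLXD x k m : x *m L ^+ (k + m) = x *m L ^+ k *m L ^+ m.
Proof. by rewrite exprD -[_ * _]/(_ *m _) mulmxA. Qed.

Lemma dense_sub (A B : set V) : A `<=` B -> dense A -> dense B.
Proof.
by move=> AB dA O O0 oO; have [x [Ox Ax]] := dA O O0 oO; exists x; split => //; exact: AB.
Qed.

(** One common tile with the image of [x] in its interior, in place of equality of the full patches
    at that point. This makes the set of coincidences open and the relation transitive. *)
Definition coincide_at k P P' x := exists s,
  [/\ iter k phi P s, iter k phi P' s & (supp s)° (x *m L ^+ k)].

Definition coincidence P P' : set V := [set x | exists k, coincide_at k P P' x].

Lemma coincidence_sym P P' x : coincidence P P' x -> coincidence P' P x.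
Proof. by move=> [k [s [? ? ?]]]; exists k, s. Qed.

Lemma coincidence_open P P' : open (coincidence P P').
Proof.
rewrite openE => x [k [s [Ps P's sx]]].
have oO : open [set y | (supp s)° (y *m L ^+ k)].
  exact/open_mulmx/open_interior.
move: oO; rewrite openE => /(_ x sx); apply: filterS => y sy.
by exists k, s.
Qed.

Lemma open_mulLXV O k x : open O -> O x ->
  open [set y | O (y *m L ^- k)] /\ [set y | O (y *m L ^- k)] (x *m L ^+ k).
Proof.
by move=> oO Ox; split; [exact: open_mulmx|rewrite /= mulLXVK].
Qed.

(** At a deeper level the image of [x] may lie on the boundary of a tile, hence the passage to a
    nearby [y]. *)
Lemma coincide_at_push k K P P' x O : open O -> O x -> coincide_at k P P' x ->
  exists2 y, O y & coincide_at (k + K) P P' y.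
Proof.
move=> oO Ox [s [Ps P's sx]].
pose O' := [set y | O (y *m L ^- (k + K))] `&` [set y | (supp s)° (y *m L ^- K)].
have oO' : open O' by apply: openI; apply: open_mulmx => //; exact: open_interior.
have O'x : O' (x *m L ^+ (k + K)).
  split => /=; first by rewrite mulLXVK.
  by rewrite mulLXD mulLXVK.
have cov : patch_supp C (iter K phi [set s]) (x *m L ^+ (k + K)).
  rewrite mulLXD; apply/iter_subst_supp.
  rewrite patch_supp1; exact: interior_subset.
have [u su [y [Oy sy] uy]] := open_in_patch oO' O'x cov.
exists (y *m L ^- (k + K)) => //; exists u; split; last by rewrite mulLXK.
  by rewrite addnC iter_subst_comp; apply/iter_substE; exists s.
by rewrite addnC iter_subst_comp; apply/iter_substE; exists s.
Qed.

(** Some descendant of [s] overlaps [u] near the image of [x]; both belong to the same patch, so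
    they are equal. *)
Lemma coincident_descendant k d P s u x : is_patch C P -> iter k phi P s ->
  iter (d + k) phi P u -> (supp s)° x -> (supp u)° (x *m L ^+ d) ->
  iter d phi [set s] u.
Proof.
move=> pP Ps Pu sx ux.
have cov : patch_supp C (iter d phi [set s]) (x *m L ^+ d).
  by apply/iter_subst_supp; rewrite patch_supp1; exact: interior_subset.
have [s' ss' [y uy s'y]] := open_in_patch (open_interior (supp u)) ux cov.
suff -> : u = s' by [].
apply: (patch_overlap_eq (iter_subst_patch (N := d + k) pP)) => //; last by exists y.
by rewrite iter_subst_comp; apply/iter_substE; exists s.
Qed.

(** At the larger of the two levels the common tile around the point descends from the common tile
    at the smaller level, so all three patches contain it. *)
Lemma coincidence_trans P P' P'' x : is_patch C P' ->
  coincidence P P' x -> coincidence P' P'' x -> coincidence P P'' x.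
Proof.
have H A B D k m : is_patch C B -> (k <= m)%N ->
    coincide_at k A B x -> coincide_at m B D x -> coincidence A D x.
  move=> pB /subnK <- [s [As Bs sx]] [u [Bu Du ux]].
  exists (m - k + k)%N, u; split => //.
  rewrite iter_subst_comp; apply/iter_substE; exists s => //.
  apply: coincident_descendant pB Bs Bu sx _.
  by rewrite -mulLXD addnC.
move=> pP' [k h] [m h']; have [km|/ltnW mk] := leqP k m; first exact: H km h h'.
apply: coincidence_sym; apply: (H P'' P' P m k pP' mk).
  by case: h' => s [? ? ?]; exists s.
by case: h => s [? ? ?]; exists s.
Qed.

Lemma coincidence_translate P P' v x :
  coincidence (translate v P) (translate v P') (x + v) <-> coincidence P P' x.
Proof.
split => -[k [s]].
  rewrite !iter_subst_translate => -[/translateP a /translateP b c].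
  exists k, (s.1, s.2 - v *m L ^+ k); split => //; apply/interior_supp_shift.
  by rewrite opprK -mulmxDl.
move=> [a b c]; exists k, (s.1, s.2 + v *m L ^+ k); rewrite !iter_subst_translate.
split; [by apply/translateP; rewrite /= addrK; case: (s) a
  |by apply/translateP; rewrite /= addrK; case: (s) b|].
by apply/interior_supp_shift; rewrite mulmxDl addrK.
Qed.

(** Equality of the patches may occur with [x] on a boundary; a tile of the common patch has
    interior points near the image of [x], and these give coincidences near [x]. *)
Lemma coincidence_dense T T' : patch_supp C T = setT ->
  densely_eventually_coincident Phi T T' -> dense (coincidence T T').
Proof.
move=> sT d O O0 oO; have [x [Ox [_ [k eqk]]]] := d _ O0 oO.
have : patch_supp C (iter k phi (translate (- x) T)) 0.
  rewrite -(mul0mx _ (L ^+ k)); apply/iter_subst_supp/patch_supp_translate.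
  by rewrite sT.
move=> [s Ts s0].
have : ball_patch C 0 (iter k phi (translate (- x) T')) s.
  by rewrite -eqk /ball_patch/= eqxx.
move=> [T's _]; move: Ts T's; rewrite !iter_subst_translate.
move=> /translateP Ts /translateP T's.
have [oO' O'x] := open_mulLXV k oO Ox.
have [|y Oy sy] := @supp_regular _ _ _ Phi (s.1, s.2 - - x *m L ^+ k) _ _ oO' O'x.
  by apply/supp_shift; rewrite opprK mulNmx subrr.
exists (y *m L ^- k); split => //; exists k, (s.1, s.2 - - x *m L ^+ k).
by split => //; rewrite mulLXK.
Qed.

Lemma coincidence_refl T : patch_supp C T = setT -> dense (coincidence T T).
Proof.
move=> sT O [x Ox] oO; have [|t Tt [y Oy ty]] := @open_in_patch _ _ _ Phi O T x oO Ox.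
  by rewrite sT.
by exists y; split => //; exists 0%N, t; rewrite /= expr0 mulmx1.
Qed.

Lemma dense_shift (A : set V) v : dense A -> dense [set x | A (x + v)].
Proof.
move=> dA O [x Ox] oO; have [||y [Oy Ay]] := dA [set y | O (y - v)].
- by exists (x + v); rewrite /= addrK.
- exact: open_shift.
- by exists (y - v); split => //=; rewrite subrK.
Qed.

Lemma dense_openI (A B : set V) : open A -> dense A -> dense B -> dense (A `&` B).
Proof.
move=> oA dA dB O O0 oO; have [x [Ox Ax]] := dA O O0 oO.
have oOA : open (O `&` A) by apply: openI.
have [|y [[Oy Ay] By]] := dB (O `&` A) _ oOA; first by exists x.
by exists y.
Qed.

(** [T] is compared with [T - v], and [T - v] with [T - v - w] by a translate of the second
    hypothesis; a dense set stays dense when cut with an open dense one. *)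
Lemma coincidence_dense_add T v w : is_patch C T ->
  dense (coincidence T (translate (- v) T)) ->
  dense (coincidence T (translate (- w) T)) ->
  dense (coincidence T (translate (- (v + w)) T)).
Proof.
move=> pT dv dw.
apply: (@dense_sub (coincidence T (translate (- v) T) `&`
    [set x | coincidence T (translate (- w) T) (x + v)])); last first.
  by apply: dense_openI dv _; [exact: coincidence_open|exact: dense_shift dw].
move=> x [xv /= xw]; apply: coincidence_trans xv _; first exact: translate_patch.
move: xw => /(coincidence_translate _ _ (- v)).
by rewrite addrK translateD (addrC v) opprD.
Qed.

Lemma coincidence_dense_opp T v :
  dense (coincidence T (translate (- v) T)) ->
  dense (coincidence T (translate (- - v) T)).
Proof.
move=> dv.
apply: dense_sub (@dense_shift _ (- v) dv).
move=> x h; have := (@coincidence_translate T (translate (- v) T) v (x - v)).2 h.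
by rewrite subrK translateD addNr translate0 opprK; exact: coincidence_sym.
Qed.

(** Coincidences are asked to be dense only where the interiors of tiles of the two patches overlap.
    This local form applies to single tiles and passes to descendants. *)
Definition coincide_dense P P' := forall O x, open O -> O x ->
  (exists2 t, P t & (supp t)° x) -> (exists2 t, P' t & (supp t)° x) ->
  exists2 y, O y & coincidence P P' y.

Definition dense_pair t t' := coincide_dense [set t] [set t'].

(** An open part of the common interior is pulled back by [K] levels, and a coincidence found there
    is pushed to a level of at least [K]; its common tile then descends from both [s] and [s']. *)
Lemma dense_pair_descendant K P P' s s' : is_patch C P -> is_patch C P' ->
  coincide_dense P P' -> iter K phi P s -> iter K phi P' s' -> dense_pair s s'.
Proof.
move=> pP pP' cd Ps P's' O x oO Ox [_ -> sx] [_ -> s'x].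
pose O1 := [set y | (O `&` ((supp s)° `&` (supp s')°)) (y *m L ^+ K)].
have oO1 : open O1.
  by apply: open_mulmx; apply: openI => //; apply: openI; exact: open_interior.
have O1x : O1 (x *m L ^- K) by rewrite /O1/= mulLXK.
have [t Pt ts] := (iter_substE _ _ _ _).1 Ps.
have [t' Pt' ts'] := (iter_substE _ _ _ _).1 P's'.
have [||y O1y [k cy]] := cd O1 (x *m L ^- K) oO1 O1x.
- by exists t => //; exact: iter_subst_interior ts sx.
- by exists t' => //; exact: iter_subst_interior ts' s'x.
have [z O1z] := coincide_at_push K oO1 O1y cy.
move=> [u [Pu P'u uz]]; have [Oz [sz s'z]] := O1z.
exists (z *m L ^+ K) => //; exists k, u.
have uz' : (supp u)° (z *m L ^+ K *m L ^+ k).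
  by rewrite -mulLXD addnC.
by split => //; [exact: coincident_descendant pP Ps Pu sz uz'
  |exact: coincident_descendant pP' P's' P'u s'z uz'].
Qed.

Lemma dense_coincide_dense P P' : dense (coincidence P P') -> coincide_dense P P'.
Proof.
by move=> d O x oO Ox _ _; have [||y [Oy Py]] := d O; [exists x| |exists y].
Qed.

Lemma dense_pair_translate t t' v : dense_pair t t' ->
  dense_pair (t.1, t.2 + v) (t'.1, t'.2 + v).
Proof.
move=> d O x oO Ox [_ -> /interior_supp_shift tx] [_ -> /interior_supp_shift t'x].
have [||||y Oy] := d [set y | O (y + v)] (x - v).
- exact: open_shift.
- by rewrite /= subrK.
- by exists t.
- by exists t'.
move=> /(coincidence_translate _ _ v); rewrite !translate1.
by exists (y + v).
Qed.

Lemma dense_pair_common t t' : dense_pair t t' -> overlap t t' ->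
  exists k s, iter k phi [set t] s /\ iter k phi [set t'] s.
Proof.
move=> d [x [tx t'x]]; have [||||y _ [k [s [ts t's _]]]] := d setT x.
- exact: openT.
- by [].
- by exists t.
- by exists t'.
- by exists k, s.
Qed.

End Coincidence.

(** * Density of the group generated by the periods and the translation vector *)

Section TranslationGroup.
Local Open Scope quotient_scope.
Variables (R : realType) (n : nat) (b : n.+1.-tuple 'rV[R]_n.+1) (v : 'rV[R]_n.+1).
Local Notation V := 'rV[R]_n.+1.
Implicit Types (x y w : V) (k : 'I_n.+1 -> int).

Definition translation_group : set V :=
  [set w | exists (j : int) k, w = v *~ j + lattice_pt b k].

Lemma lattice_ptD k k' : lattice_pt b k + lattice_pt b k' = lattice_pt b (fun i => k i + k' i).
Proof. by rewrite /lattice_pt -big_split/=; apply: eq_bigr => i _; rewrite mulrzDr. Qed.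

Lemma lattice_ptN k : - lattice_pt b k = lattice_pt b (fun i => - k i).
Proof. by rewrite /lattice_pt -sumrN; apply: eq_bigr => i _; rewrite mulrNz. Qed.

Lemma lattice_pt0 : lattice_pt b (fun=> 0) = 0.
Proof. by rewrite /lattice_pt big1// => i _; rewrite mulr0z. Qed.

Lemma translation_groupD x y : translation_group x -> translation_group y ->
  translation_group (x + y).
Proof.
move=> [j [k ->]] [j' [k' ->]]; exists (j + j'), (fun i => k i + k' i).
by rewrite mulrzDr addrACA lattice_ptD.
Qed.

Lemma translation_groupN x : translation_group x -> translation_group (- x).
Proof.
move=> [j [k ->]]; exists (- j), (fun i => - k i).
by rewrite mulrNz opprD lattice_ptN.
Qed.

Lemma translation_group_lattice k : translation_group (lattice_pt b k).
Proof. by exists 0, k; rewrite mulr0z add0r. Qed.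

Lemma translation_group_gen : translation_group v.
Proof. by exists 1, (fun=> 0); rewrite mulr1z lattice_pt0 addr0. Qed.

Lemma closure_translation_group x w : translation_group w ->
  closure translation_group x -> closure translation_group (x + w).
Proof.
move=> Ww Wx A nA.
have [|y [Wy Ay]] := Wx [set y | A (y + w)].
  by have := nbhs_translate w nA; rewrite addrK.
by exists (y + w); split => //; exact: translation_groupD.
Qed.

Lemma repr_torus_pi x : exists k,
  repr (torus_pi b x : {eq_quot lattice_equiv b}) = x + lattice_pt b k.
Proof.
have /eqmodP/= /asboolP[k e] :
  repr (\pi_{eq_quot lattice_equiv b} x)%qT = x %[mod {eq_quot lattice_equiv b}]%qT.
  by rewrite reprK.
by exists k; rewrite -e addrC subrK.
Qed.

(** The classes of the points in the closure of the group form a closed nonempty subset of the torus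
    invariant under the rotation, so minimality makes it everything. *)
Lemma translation_group_dense : completely_rationally_independent b v ->
  dense translation_group.
Proof.
move=> minv.
pose F : set (torus b) :=
  [set q | closure translation_group (repr (q : {eq_quot lattice_equiv b}))].
have FP x : F (torus_pi b x) <-> closure translation_group x.
  rewrite /F/=; have [k ->] := repr_torus_pi x; split; last first.
    exact/closure_translation_group/translation_group_lattice.
  move=> /(@closure_translation_group _ (- lattice_pt b k)); rewrite addrK; apply.
  exact/translation_groupN/translation_group_lattice.
have piK (q : torus b) : torus_pi b (repr (q : {eq_quot lattice_equiv b})) = q.
  by rewrite /torus_pi reprK.
have FT : F = setT.
  apply: minv.
  - rewrite -[F]setCK; apply: open_closedC; rewrite /open/= /quotient_open.
    rewrite (_ : _ @^-1` _ = ~` closure translation_group).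
      exact/closed_openC/closed_closure.
    by apply/seteqP; split => x /= nx Wx; apply: nx; apply/FP.
  - exists (torus_pi b 0); apply/FP; apply: subset_closure.
    by rewrite -lattice_pt0; exact: translation_group_lattice.
  - apply/seteqP; split => [_ [q Fq <-]|q Fq].
      rewrite -(piK q) torus_rotationE; apply/FP/closure_translation_group => //.
      exact: translation_group_gen.
    exists (torus_pi b (repr (q : {eq_quot lattice_equiv b}) - v)).
      by apply/FP/closure_translation_group => //; exact/translation_groupN/translation_group_gen.
    by rewrite torus_rotationE subrK piK.
have WT x : closure translation_group x by apply/FP; rewrite FT.
move=> O [x Ox] oO; have [|y [Wy Oy]] := WT x O; first exact: open_nbhs_nbhs.
by exists y.
Qed.

End TranslationGroup.

(** * A basis of translations with dense coincidences *)

Section GoodVectors.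
Variables (R : realType) (n l : nat) (Phi : substitution R n.+1 l).
Local Notation V := 'rV[R]_n.+1.
Local Notation tile := (tile R n.+1 l).
Local Notation L := (expansion Phi).
Local Notation C := (proto Phi).
Local Notation supp := (tile_supp (proto Phi)).
Local Notation phi := (subst Phi).
Local Notation overlap := (overlap Phi).
Implicit Types (P T Q : set tile) (t s : tile) (v w x y : V) (O : set V).

Lemma periodic_extension_translate b Q k :
  translate (lattice_pt b k) (periodic_extension b Q) = periodic_extension b Q.
Proof.
suff H k' : translate (lattice_pt b k') (periodic_extension b Q) `<=` periodic_extension b Q.
  apply/seteqP; split; first exact: H.
  move=> t Qt; have := H (fun i => - k i); rewrite -lattice_ptN => Hk.
  by rewrite -[t]/(id t); apply/translateP/Hk/translateP; rewrite /= opprK subrK; case: t Qt.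
move=> t /translateP[m _ /translateP Qt]; exists (fun i => m i + k' i) => //.
by apply/translateP; move: Qt; rewrite /= -lattice_ptD opprD addrA addrAC.
Qed.

(** The periods leave the tiling unchanged, so only multiples of [v] require the additivity of
    coincidences. *)
Lemma translation_group_coincidence b Q v w :
  is_tiling C (periodic_extension b Q) ->
  dense (coincidence Phi (periodic_extension b Q) (translate (- v) (periodic_extension b Q))) ->
  translation_group b v w ->
  dense (coincidence Phi (periodic_extension b Q) (translate (- w) (periodic_extension b Q))).
Proof.
set T := periodic_extension b Q => -[pT sT] dv [j [k ->]].
have d0 : dense (coincidence Phi T (translate (- 0) T)).
  by rewrite oppr0 translate0; exact: coincidence_refl.
apply: coincidence_dense_add => //; last first.
  by rewrite lattice_ptN periodic_extension_translate; exact: coincidence_refl.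
have dn (m : nat) : dense (coincidence Phi T (translate (- (v *+ m)) T)).
  elim: m => [|m IH]; first by rewrite mulr0n.
  by rewrite mulrS; exact: coincidence_dense_add.
case: j => m; first by rewrite -pmulrn.
by rewrite NegzE mulrNz -pmulrn; apply: coincidence_dense_opp.
Qed.

Lemma finite_eventually (A : choiceType) (S : set A) (Q : A -> nat -> Prop) :
  finite_set S -> (forall p, S p -> exists k1, forall K, (k1 <= K)%N -> Q p K) ->
  exists K0, forall K p, (K0 <= K)%N -> S p -> Q p K.
Proof.
move=> /finite_seqP[s ->]; elim: s => [|a s IH] h; first by exists 0%N.
have [k1 k1P] := h a (mem_head _ _).
have [|k2 k2P] := IH; first by move=> p ps; apply: h; rewrite /= inE ps orbT.
exists (maxn k1 k2) => K p; rewrite geq_max => /andP[k1K k2K].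
by rewrite /= inE => /orP[/eqP ->|ps]; [exact: k1P|exact: k2P].
Qed.

(** Diagonal dominance, read off at a coordinate where a kernel vector attains its sup norm. *)
Lemma near_scalar_unit (M : 'M[R]_n.+1) (c : R) : 0 < c ->
  (forall i j, `|M i j - c *+ (i == j)| < c / n.+1%:R) -> M \in unitmx.
Proof.
move=> c0 Mc; apply/negPn/negP; rewrite unitmxE unitfE negbK => /det0P[x x0 xM].
have x1 : 0 < `|x| by rewrite normr_gt0.
suff : c * `|x| < c * `|x| by rewrite ltxx.
suff H j : `|x ord0 j| * c <= \sum_(i < n.+1) `|x| * `|M i j - c *+ (i == j)|.
  have [j xj] : exists j, `|x| = `|x ord0 j|.
    have /mx_norm_neq0[[i j]] : mx_norm x != 0 by rewrite gt_eqF.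
    by rewrite (ord1 i) => h; exists j.
  rewrite [X in X < _]mulrC [X in X < _](_ : _ = `|x ord0 j| * c); last by rewrite -xj.
  apply: le_lt_trans (H j) _.
  have -> : c * `|x| = \sum_(i < n.+1) `|x| * (c / n.+1%:R).
    by rewrite sumr_const card_ord -mulrnAr -[X in _ = _ * X]mulr_natr divfK ?pnatr_eq0// mulrC.
  apply: ltr_sum => [|i _]; last by rewrite ltr_pM2l.
  by apply/hasP; exists ord0; rewrite ?mem_index_enum.
have : \sum_i x ord0 i * M i j = 0.
  by have := congr1 (fun z : V => z ord0 j) xM; rewrite !mxE.
rewrite (eq_bigr (fun i => x ord0 i * (M i j - c *+ (i == j)) + x ord0 i * (c *+ (i == j)))); last first.
  by move=> i _; rewrite -mulrDr subrK.
rewrite big_split/= [X in _ + X](bigD1 j)//= eqxx mulr1n [X in _ + (_ + X)]big1; last first.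
  by move=> i ij; rewrite (negbTE ij) mulr0n mulr0.
rewrite addr0 => /eqP; rewrite addrC addr_eq0 => /eqP h.
rewrite -[X in _ * X](gtr0_norm c0) -normrM h normrN (le_trans (ler_norm_sum _ _ _))//.
by apply: ler_sum => i _; rewrite normrM ler_wpM2r// coord_le_norm.
Qed.

(** At a suitable level [K] one supertile of the periodic tiling contains a copy of every legal pair
    of bounded displacement. Take [u = w *m L ^+ K] with [w] in the dense group. A pair that becomes
    legal when [t'] is shifted by [u] is then a copy of a tile of the [K]-th image of the periodic
    tiling and a tile of the [K]-th image of its translate by [- w], and coincidences pass to
    descendants. *)
Lemma good_vectors_exist b Q v T0 : primitive Phi -> FLC Phi -> tiling_space Phi T0 ->
  is_tiling C (periodic_extension b Q) ->
  completely_rationally_independent b v ->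
  densely_eventually_coincident Phi
     (periodic_extension b Q) (translate (- v) (periodic_extension b Q)) ->
  exists2 U : 'M[R]_n.+1, U \in unitmx & forall i t t',
    legal Phi t.1 t'.1 (t'.2 + row i U - t.2) -> overlap t t' ->
    dense_pair Phi t t'.
Proof.
move=> prim flc TT0 tQ indep dec; have [pQ sQ] := tQ.
have [D D0 DP] := diam_exists Phi.
have dco := coincidence_dense sQ dec.
have [[i0 q] Qt _] : patch_supp C (periodic_extension b Q) 0 by rewrite sQ.
have [|K KP] := @finite_eventually _ _
    (fun p K => exists a, supertile Phi K i0 (p.1.1, a) /\ supertile Phi K i0 (p.1.2, a + p.2))
    (legal_finite prim (D + D + 1) TT0 flc).
  move=> p [lp _]; have [k1 k1P] := legal_supertile prim lp.
  by exists k1 => K; exact: k1P.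
(* The rows are taken within [c / n.+1%:R] of half the unit vectors: close enough to be independent,
   and of norm below 1, which keeps the displacements of overlapping pairs within the bound for
   which [K] was chosen. *)
pose c : R := 2^-1.
have c0 : 0 < c by rewrite invr_gt0.
have dW := translation_group_dense indep.
have /choice[u uP] i : exists u, (exists2 w, translation_group b v w & u = w *m L ^+ K) /\
    `|u - c *: delta_mx ord0 i| < c / n.+1%:R.
  pose O := [set w : V | `|w *m L ^+ K - c *: delta_mx ord0 i| < c / n.+1%:R].
  have oO : open O.
    have h1 : open [set y : V | `|y - c *: delta_mx ord0 i| < c / n.+1%:R].
      exact: (@open_shift _ _ (- (c *: delta_mx ord0 i)) _ (@open_norm_lt R n (c / n.+1%:R))).
    exact: (@open_mulmx _ _ (L ^+ K) _ h1).
  have [|w [Ow Ww]] := dW O _ oO.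
    exists (c *: delta_mx ord0 i *m L ^- K); rewrite /O/= mulLXK subrr normr0.
    by rewrite divr_gt0.
  by exists (w *m L ^+ K); split => //; exists w.
exists (\matrix_i u i).
  apply: near_scalar_unit c0 _ => i j; have [_] := uP i.
  apply: le_lt_trans.
  have -> : (\matrix_i u i) i j - c *+ (i == j) = (u i - c *: delta_mx ord0 i) ord0 j.
    by rewrite !mxE eqxx/= eq_sym mulr_natr.
  exact: coord_le_norm.
move=> i [a x] [a' x']; rewrite rowK /= => leg ov.
have [[w Ww uw] uc] := uP i.
have u1 : `|u i| < 1.
  rewrite -[u i](subrK (c *: delta_mx ord0 i)) (le_lt_trans (ler_normD _ _))//.
  have c1 : `|c *: (delta_mx ord0 i : V)| <= c.
    rewrite normrZ gtr0_norm//; apply: ler_piMr; first exact: ltW.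
    apply: norm_le_coord => // j.
    by rewrite !mxE; case: (_ && _); rewrite ?normr1 ?normr0.
  have cn : c / n.+1%:R <= c by rewrite ler_pdivrMr//; apply: ler_peMr; [exact: ltW|rewrite ler1n].
  have cc : c + c = 1 by rewrite -mulr2n -mulr_natl /c divff.
  by rewrite -cc ltr_leD// (lt_le_trans uc).
have xx' : `|x' + u i - x| < D + D + 1.
  have [y [/interior_subset y1 /interior_subset y2]] := ov.
  have := DP _ _ y1; have := DP _ _ y2 => /= d2 d1.
  have -> : x' + u i - x = (y - x) - (y - x') + u i.
    by apply/rowP => j; rewrite !mxE; ring.
  rewrite (le_lt_trans (ler_normD _ _))// ler_ltD//.
  by rewrite (le_trans (ler_normB _ _))// lerD.
have [z [z1 z2]] := KP K (a, a', x' + u i - x) (leqnn K) (conj leg xx').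
have s1 : iter K phi (periodic_extension b Q) (a, q *m L ^+ K + z).
  apply/iter_substE; exists (i0, q) => //; rewrite iter_subst1.
  by apply/translateP; rewrite /= addrC addKr.
have s2 : iter K phi (translate (- w) (periodic_extension b Q))
    (a', q *m L ^+ K + z + (x' - x)).
  rewrite iter_subst_translate; apply/translateP => /=.
  rewrite mulNmx opprK -uw; apply/iter_substE; exists (i0, q) => //.
  rewrite iter_subst1; apply/translateP => /=.
  move: z2; congr (supertile _ _ _ (_, _)).
  by apply/rowP => j; rewrite !mxE; ring.
have dp : dense_pair Phi (a, q *m L ^+ K + z) (a', q *m L ^+ K + z + (x' - x)).
  apply: dense_pair_descendant s1 s2 => //; first exact: translate_patch.
  apply: dense_coincide_dense; exact: translation_group_coincidence tQ dco Ww.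
have := @dense_pair_translate _ _ _ Phi _ _ (x - (q *m L ^+ K + z)) dp.
rewrite /= addrC subrK; congr (dense_pair _ _ (_, _)).
by apply/rowP => j; rewrite !mxE; ring.
Qed.

End GoodVectors.

(** * Pisot families and finiteness of descendants *)

Section MinimalPolynomial.
Variable R : realType.

Lemma irreducible_dvd_root (p q : {poly rat}) (z : R[i]) :
  irreducible_poly p -> root (map_poly ratr p) z -> root (map_poly ratr q) z ->
  p %| q.
Proof.
move=> irp pz qz; apply/negPn/negP; rewrite -irreducible_poly_coprime//.
rewrite -(coprimep_map (@ratr R[i])) => /coprimep_root/(_ pz).
by rewrite (rootP qz) eqxx.
Qed.

Lemma irreducible_coprime_deriv (p : {poly rat}) : irreducible_poly p ->
  coprimep p p^`().
Proof.
move=> irp; rewrite irreducible_poly_coprime//; apply/negP => /dvdp_leq.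
have [p1 _] := irp; have sp := polyorder.size_deriv p.
rewrite -size_poly_gt0 sp -subn1 subn_gt0 => /(_ p1).
by rewrite leq_subRL ?ltnn// ltnW.
Qed.

Lemma root_map_int_rat (P : {poly int}) (z : R[i]) :
  root (map_poly ratr (map_poly intr P : {poly rat})) z = root (map_poly intr P) z.
Proof.
rewrite -map_poly_comp; congr (root _ z); apply: eq_map_poly => a /=.
exact: ratr_int.
Qed.

(** Gauss's lemma: the monic [p] divides a monic integer polynomial, so the integer polynomial [p1]
    proportional to [p] has leading coefficient 1 or -1. *)
Lemma integral_min_poly (p : {poly rat}) (z : R[i]) :
  is_min_poly p z -> integralOver (intr : int -> R[i]) z ->
  exists2 P : {poly int}, P \is monic & map_poly intr P = p.
Proof.
move=> [pm irp pz] [q qm qz].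
have : p %| map_poly intr q.
  by apply: (irreducible_dvd_root irp pz); rewrite root_map_int_rat.
move=> /dvdpP_rat_int[p1 [a a0 pE] [r qE]].
have lead1 : lead_coef p1 * lead_coef r = 1 by rewrite -lead_coefM -qE; exact/eqP.
have lp : lead_coef p = a * (lead_coef p1)%:~R.
  by rewrite pE lead_coefZ lead_coef_map_inj//; exact: intr_inj.
have lp1 : lead_coef p1 * lead_coef p1 = 1.
  have := congr1 absz lead1; rewrite abszM => /eqP; rewrite muln_eq1 => /andP[/eqP h _].
  by have [->|->] : lead_coef p1 = 1 \/ lead_coef p1 = -1 by lia.
exists (lead_coef p1 *: p1); first by rewrite monicE lead_coefZ lp1.
have -> : map_poly intr (lead_coef p1 *: p1) = (lead_coef p1)%:~R *: map_poly intr p1 :> {poly rat}.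
  by apply/polyP => i; rewrite coefZ !coef_map/= coefZ rmorphM.
rewrite pE; congr (_ *: _).
move: lp; rewrite (eqP pm) => /(congr1 (fun x => x * (lead_coef p1)%:~R)).
by rewrite mul1r -mulrA -rmorphM/= lp1 rmorph1 mulr1.
Qed.

(** [P] is the common minimal polynomial of the eigenvalues. It annihilates [L] because [L] is
    diagonalizable, and is separable because it is irreducible. A root of modulus at least 1 is an
    eigenvalue by the Pisot condition, and eigenvalues have modulus above 1. *)
Lemma pisot_family_poly (n m d : nat) (L : 'M[R]_n.+1) :
  (forall z : R[i], eigenvalue (map_mx (real_complex R) L) z -> 1 < `|z|) ->
  pisot_family_type L m d ->
  exists P : {poly int}, [/\ P \is monic, horner_mx L (map_poly intr P) = 0,
    coprimep (map_poly (intr : int -> R) P) (map_poly intr P)^`() &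
    forall w : R[i], root (map_poly intr P) w -> `|w| < 1 \/ 1 < `|w|].
Proof.
move=> L1 [diagL conjL degL _ pisL]; set A := map_mx _ _ in L1 diagL conjL degL pisL.
have [z0 z0A] : exists z, eigenvalue A z.
  have /closed_rootP[z] : size (char_poly A) != 1%N by rewrite size_char_poly.
  by rewrite -eigenvalue_root_char; exists z.
have [p pz0 _] := degL _ z0A; have [pm irp pr] := pz0.
have [P Pm PE] := integral_min_poly pz0 (pisL _ z0A).1.
have rootP' (w : R[i]) : root (map_poly intr P) w = root (map_poly ratr p) w.
  by rewrite -PE root_map_int_rat.
have eigp (w : R[i]) : eigenvalue A w -> root (map_poly ratr p) w.
  move=> /(conjL _ _ z0A)[p' [p'm irp' p'r] p'w].
  suff -> : p = p' by [].
  apply/eqP; rewrite -eqp_monic// /eqp (irreducible_dvd_root irp pr p'r).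
  exact: irreducible_dvd_root irp' p'r pr.
exists P; split => //.
- have : horner_mx A (map_poly ratr p) = 0.
    apply/mxminpoly_minP.
    have /diagonalizableP[rs urs /dvdp_prod_XsubC[msk mE]] := diagL.
    rewrite (eqp_dvdl _ mE); apply: uniq_roots_dvdp; last first.
      by rewrite uniq_rootsE; exact: mask_uniq.
    apply/allP => w wm; apply: eigp; rewrite eigenvalue_root_min (eqp_root mE).
    by rewrite root_prod_XsubC.
  rewrite -PE -map_poly_comp.
  have -> : map_poly (@ratr R[i] \o intr) P = map_poly (real_complex R) (map_poly intr P).
    rewrite -map_poly_comp; apply: eq_map_poly => a /=.
    by rewrite ratr_int rmorph_int.
  rewrite -map_horner_mx => /eqP; rewrite map_mx_eq0 => /eqP //.
- have -> : map_poly (intr : int -> R) P = map_poly ratr p.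
    rewrite -PE -map_poly_comp; apply: eq_map_poly => a /=; by rewrite ratr_int.
  by rewrite deriv_map coprimep_map irreducible_coprime_deriv.
- move=> w Pw; have [w1|w1|w1] := real_ltgtP (normr_real w) (@real1 R[i]); [by left|by right|].
  have [_ /(_ w)] := pisL _ z0A; case.
  + by exists p; rewrite -?rootP'.
  + by rewrite w1 lexx.
  + by move=> /L1; rewrite w1 ltxx.
Qed.

End MinimalPolynomial.

(** * Finitely generated groups of vectors and their integer coordinates *)

Section IntegerSpan.
Variables (R : numDomainType) (V : lmodType R).
Hypothesis lmod_torsion_free : forall (x : V) (D : int), D != 0 -> x *~ D = 0 -> x = 0.
Implicit Types (S : seq V) (x y : V).

Fixpoint int_span S : set V :=
  if S is s :: S' then [set x | exists (z : int) y, int_span S' y /\ x = s *~ z + y]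
  else [set 0].

Lemma int_span0 S : int_span S 0.
Proof. by elim: S => //= s S IH; exists 0, 0; rewrite mulr0z addr0. Qed.

Lemma int_spanD S x y : int_span S x -> int_span S y -> int_span S (x + y).
Proof.
elim: S x y => [x y ->-> /=|s S IH x y /= [z [u [Su ->]]] [z' [u' [Su' ->]]]].
  by rewrite addr0.
by exists (z + z'), (u + u'); split; [exact: IH|rewrite mulrzDr addrACA].
Qed.

Lemma int_spanMz S x (z : int) : int_span S x -> int_span S (x *~ z).
Proof.
elim: S x => [x -> /=|s S IH x /= [z' [u [Su ->]]]]; first by rewrite mul0rz.
by exists (z' * z), (u *~ z); split; [exact: IH|rewrite mulrzDl -mulrzA].
Qed.

Lemma int_spanN S x : int_span S x -> int_span S (- x).
Proof. by move=> Sx; rewrite -mulrN1z; exact: int_spanMz. Qed.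

Lemma int_spanB S x y : int_span S x -> int_span S y -> int_span S (x - y).
Proof. by move=> Sx Sy; apply: int_spanD => //; exact: int_spanN. Qed.

Lemma int_span_mem S x : x \in S -> int_span S x.
Proof.
elim: S => //= s S IH; rewrite inE => /orP[/eqP ->|/IH Sx].
  by exists 1, 0; rewrite mulr1z addr0; split => //; exact: int_span0.
by exists 0, x; rewrite mulr0z add0r.
Qed.

Lemma int_span_sum S (I : Type) (r : seq I) (F : I -> V) :
  (forall i, int_span S (F i)) -> int_span S (\sum_(i <- r) F i).
Proof.
by move=> h; elim/big_rec : _ => [|i x _ Sx]; [exact: int_span0|exact: int_spanD].
Qed.

Lemma int_span_sub S S' (f : {additive V -> V}) x :
  (forall y, y \in S -> int_span S' (f y)) -> int_span S x -> int_span S' (f x).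
Proof.
elim: S x => [x _ -> /=|s S IH x h [z [y [Sy ->]]]].
  by rewrite raddf0; exact: int_span0.
rewrite raddfD raddfMz; apply: int_spanD.
  by apply/int_spanMz/h; rewrite mem_head.
by apply: IH => // u uS; apply: h; rewrite inE uS orbT.
Qed.

(** Induction on the generators. If a nonzero multiple of [s] by [D] is a combination of the others,
    multiplication by [D] maps the group into their span, injectively as there is no torsion.
    Otherwise the coefficient of [s] is well defined and gives one more coordinate. Only an additive
    injection is built, not a basis. *)
Lemma int_span_coordinates S : exists r (c : V -> 'rV[int]_r),
  (forall x y, int_span S x -> int_span S y -> c (x + y) = c x + c y) /\
  (forall x, int_span S x -> c x = 0 -> x = 0).
Proof.
elim: S => [|s S [r [c [cD c0]]]].
  by exists 0%N, (fun=> 0); split => [x y|x] /=; rewrite ?addr0.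
have [[D [D0 SD]]|nD] := pselect (exists D : int, D != 0 /\ int_span S (s *~ D)).
  have SxD x : int_span (s :: S) x -> int_span S (x *~ D).
    move=> [z [y [Sy ->]]]; rewrite mulrzDl -mulrzA mulrC mulrzA.
    by apply: int_spanD; exact: int_spanMz.
  exists r, (fun x => c (x *~ D)); split => [x y Sx Sy|x Sx cx].
    by rewrite mulrzDl cD//; exact: SxD.
  by apply: (lmod_torsion_free D0); apply: c0 => //; exact: SxD.
have uni (z z' : int) y y' : int_span S y -> int_span S y' -> s *~ z + y = s *~ z' + y' ->
    z = z' /\ y = y'.
  move=> Sy Sy' e.
  have e' : s *~ (z - z') = y' - y.
    have e2 : s *~ z = s *~ z' + y' - y by rewrite -e addrK.
    by rewrite mulrzBr e2 -(addrA (s *~ z')) (addrC (s *~ z')) addrK.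
  have zz : z = z'.
    apply: contrapT => zz'; apply: nD; exists (z - z'); split.
      by rewrite subr_eq0; apply/eqP.
    by rewrite e'; exact: int_spanB.
  by split => //; move: e; rewrite zz => /addrI.
have /choice[f fP] x : exists p : int * V, int_span (s :: S) x ->
    int_span S p.2 /\ x = s *~ p.1 + p.2.
  have [[z [y [Sy xE]]]|] := pselect (int_span (s :: S) x); last by exists (0, 0).
  by exists (z, y).
exists (1 + r)%N, (fun x => row_mx (const_mx (f x).1) (c (f x).2)); split.
  move=> x y Sx Sy; have [Sx' xE] := fP _ Sx; have [Sy' yE] := fP _ Sy.
  have [Sxy xyE] := fP _ (int_spanD Sx Sy).
  have [|-> ->] := @uni (f (x + y)).1 ((f x).1 + (f y).1) _ _ Sxy (int_spanD Sx' Sy').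
    by rewrite -xyE mulrzDr addrACA -xE -yE.
  rewrite cD// add_row_mx; congr row_mx.
  by apply/rowP => i; rewrite !mxE.
move=> x Sx; have [Sx' xE] := fP _ Sx => e.
have := congr1 lsubmx e; rewrite row_mxKl => /rowP/(_ ord0); rewrite !mxE => f1.
have := congr1 rsubmx e; rewrite row_mxKr => f2.
rewrite xE f1 mulr0z add0r; apply: c0 => //.
by rewrite f2; apply/rowP => i; rewrite !mxE.
Qed.

End IntegerSpan.

Section BoundedIntegers.

Lemma finite_int_rows r (N : nat) :
  finite_set [set c : 'rV[int]_r | forall i, (`|c ord0 i| <= N%:Z)%R].
Proof.
pose g (f : {ffun 'I_r -> 'I_(N + N).+1}) : 'rV[int]_r := \row_i ((f i)%:Z - N%:Z).
apply: (@sub_finite_set _ _ (g @` setT)); last exact/finite_image/finite_finset.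
move=> c cN; exists [ffun i => inord (absz (c ord0 i + N%:Z))] => //.
have lt_absz (k : int) : (`|k| <= N%:Z)%R -> (absz (k + N%:Z)%R < (N + N).+1)%N.
  by lia.
apply/rowP => i; rewrite mxE ffunE inordK ?lt_absz//.
have absz_id (z : int) : (`|z| <= N%:Z)%R -> (absz (z + N%:Z)%R)%:Z - N%:Z = z.
  by lia.
exact: absz_id (cN i).
Qed.

Lemma finite_preimage_inj (A B : choiceType) (E : set A) (F : set B) (c : A -> B) :
  finite_set F -> (forall x, E x -> F (c x)) ->
  (forall x y, E x -> E y -> c x = c y -> x = y) -> finite_set E.
Proof.
move=> finF EF inj.
have [->|/set0P[x0 Ex0]] := eqVneq E set0; first exact: finite_set0.
have /choice[g gP] (b : B) : exists x, (exists2 y, E y & c y = b) -> E x /\ c x = b.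
  have [[y Ey yb]|] := pselect (exists2 y, E y & c y = b); first by exists y.
  by exists x0.
apply: (@sub_finite_set _ _ (g @` F)); last exact: finite_image.
move=> x Ex; exists (c x); first exact: EF.
have [|h1 h2] := gP (c x); first by exists x.
exact: inj.
Qed.

End BoundedIntegers.

(** * Linear forms on polynomials *)

Section PolynomialFunctional.
Variable K : comNzRingType.
Implicit Types (p q : {poly K}) (a : nat -> K).

(** The linear form sending ['X^j] to [a j]. When [a j] is a function of [x *m L ^+ j], multiplying
    [q] by ['X] amounts to replacing [x] by [x *m L]. *)
Definition poly_functional a q := \sum_(j < size q) q`_j * a j.

Lemma poly_functional_widen a q N : (size q <= N)%N ->
  poly_functional a q = \sum_(j < N) q`_j * a j.
Proof.
move=> qN; rewrite /poly_functional (big_ord_widen _ (fun j => q`_j * a j) qN).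
rewrite big_mkcond/=; apply: eq_bigr => j _; case: ltnP => // qj.
by rewrite nth_default// mul0r.
Qed.

Lemma poly_functional_mulXsubC a q (th : K) :
  poly_functional a (q * ('X - th%:P)) =
  poly_functional (fun j => a j.+1) q - th * poly_functional a q.
Proof.
have s1 : (size (q * ('X - th%:P))%R <= (size q).+1)%N.
  have [->|q0] := eqVneq q 0; first by rewrite mul0r size_poly0.
  by rewrite size_Mmonic ?monicXsubC// size_XsubC addn2.
rewrite (poly_functional_widen _ s1) (poly_functional_widen a (leqnSn (size q))).
rewrite mulr_sumr.
under eq_bigr do rewrite mulrBr coefB coefMX coefMC mulrBl.
rewrite big_split/= sumrN; congr (_ - _); last first.
  by apply: eq_bigr => i _; rewrite mulrCA mulrA.
rewrite big_ord_recl/= mul0r add0r; apply: eq_bigr => i _; by [].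
Qed.

Lemma poly_functionalD a a' q :
  poly_functional (fun j => a j + a' j) q = poly_functional a q + poly_functional a' q.
Proof. by rewrite -big_split/=; apply: eq_bigr => j _; rewrite mulrDr. Qed.

Lemma poly_functional1 a : poly_functional a 1 = a 0%N.
Proof. by rewrite /poly_functional size_poly1 big_ord1 coefC eqxx mul1r. Qed.

End PolynomialFunctional.

Lemma horner_mx_sum (R : comNzRingType) n (L : 'M[R]_n.+1) (p : {poly R}) :
  horner_mx L p = \sum_(i < size p) p`_i *: L ^+ i.
Proof.
rewrite -{1}[p]coefK poly_def raddf_sum/=; apply: eq_bigr => i _.
by rewrite linearZ/= rmorphXn/= horner_mx_X.
Qed.

Lemma finite_norm_bound (A : choiceType) (K : numDomainType) (S : set A) (G : A -> K) :
  finite_set S -> exists2 B : K, 0 <= B & forall x, S x -> `|G x| <= B.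
Proof.
move=> /finite_seqP[s ->]; exists (\sum_(x <- s) `|G x|); first exact: sumr_ge0.
elim: s => [//|a s IH] x /=; rewrite inE big_cons => /orP[/eqP ->|/IH xs].
  by rewrite lerDl sumr_ge0.
by rewrite (le_trans xs)// lerDr.
Qed.

Lemma int_le_complex (R : realType) (B : R[i]) :
  exists N : nat, forall z : int, `|z%:~R : R[i]| <= B -> (`|z| <= N%:Z)%R.
Proof.
exists (Num.truncn (complex.Re B)).+1 => z.
rewrite -(rmorph_int (real_complex R)) normc_def/= expr0n addr0 sqrtr_sqr lecE/=.
move=> /andP[_ zB]; rewrite -(ler_int R) intr_norm (le_trans zB)//.
by apply/ltW; rewrite -[X in _ < X]pmulrn; exact: truncnS_gt.
Qed.

Lemma int_row_mulz r (u : 'rV[int]_r) (z : int) i : (u *~ z) ord0 i = z * u ord0 i.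
Proof. by rewrite -scaler_int mxE intz. Qed.

(** * Displacements of descendant pairs *)

Section Descendants.
Variables (R : realType) (n l : nat) (Phi : substitution R n.+1 l).
Local Notation V := 'rV[R]_n.+1.
Local Notation tile := (tile R n.+1 l).
Local Notation L := (expansion Phi).
Local Notation C := (proto Phi).
Local Notation supp := (tile_supp (proto Phi)).
Local Notation phi := (subst Phi).
Local Notation overlap := (overlap Phi).
Local Notation K := R[i].
Implicit Types (t s : tile) (x y e : V).

Inductive descendant (base : tile -> tile -> Prop) : tile -> tile -> Prop :=
| Descendant0 t t' : base t t' -> overlap t t' -> descendant base t t'
| DescendantS t t' s s' : descendant base t t' -> phi [set t] s -> phi [set t'] s' ->
    overlap s s' -> descendant base s s'.

Lemma descendant_overlap base t t' : descendant base t t' -> overlap t t'.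
Proof. by case. Qed.

Lemma descendant_iter base N t t' s s' : descendant base t t' ->
  iter N phi [set t] s -> iter N phi [set t'] s' -> overlap s s' -> descendant base s s'.
Proof.
elim: N s s' => [|N IH] s s' d; first by move=> /= -> ->.
move=> /= /substE[u tu us] /substE[u' tu' us'] ov.
apply: (DescendantS _ us us' ov); apply: IH => //.
exact: (@overlap_ancestor _ _ _ Phi 1 u u' s s').
Qed.

Variable base : tile -> tile -> Prop.
Let disp : set V := [set e | exists t t', descendant base t t' /\ e = t'.2 - t.2].
Let disp0 : set V := [set e | exists t t', [/\ base t t', overlap t t' & e = t'.2 - t.2]].
Let digits : set V := \bigcup_(p in [set: 'I_l * 'I_l])
  [set u.2.2 - u.1.2 | u in rule Phi p.1 `*` rule Phi p.2].

Lemma digits_finite : finite_set digits.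
Proof.
apply: bigcup_finite => [|p _]; first exact: finite_finset.
by apply: finite_image; apply: finite_setX; exact: rule_finite.
Qed.

Lemma digits_subst t t' s s' : phi [set t] s -> phi [set t'] s' ->
  exists2 d, digits d & s'.2 - s.2 = (t'.2 - t.2) *m L + d.
Proof.
rewrite !subst1E => /translateP ts /translateP ts'.
exists ((s'.2 - t'.2 *m L) - (s.2 - t.2 *m L)).
  by exists (t.1, t'.1) => //; exists ((s.1, s.2 - t.2 *m L), (s'.1, s'.2 - t'.2 *m L)).
rewrite mulmxBl; apply/rowP => i; rewrite !mxE.
set a := (\sum_j _); set a' := (\sum_j _); ring.
Qed.

Section Bound.
Variables (M : set V).
Hypotheses (M0 : disp0 `<=` M) (Md : digits `<=` M).
Hypotheses (MD : forall x y, M x -> M y -> M (x + y)) (ML : forall x, M x -> M (x *m L)).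

Lemma disp_sub : disp `<=` M.
Proof.
move=> _ [t [t' [d ->]]]; elim: d => {t t'} [t t' b ov|t t' s s' _ Mt ts t's' ov].
  by apply: M0; exists t, t'.
have [d dd ->] := digits_subst ts t's'.
by apply: MD; [exact: ML|exact: Md].
Qed.

Hypothesis finite_disp0 : finite_set disp0.
Hypothesis common : forall t t', descendant base t t' ->
  exists k s, iter k phi [set t] s /\ iter k phi [set t'] s.

(** From one generation to the next [G] is multiplied by [th] up to a bounded error. A contracting
    [th] gives a bound by induction from the base pairs. An expanding one is inverted: the bound
    goes backwards from a common descendant, where the displacement is 0, and does not depend on its
    depth. *)
Lemma disp_bounded_step (G H : V -> K) (th : K) (B : K) : 0 <= B ->
  (forall x y, M x -> M y -> G (x + y) = G x + G y) ->
  (forall x, M x -> H x = G (x *m L) - th * G x) ->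
  (`|th| < 1 \/ 1 < `|th|) ->
  (forall e, disp e -> `|H e| <= B) ->
  exists2 B' : K, 0 <= B' & forall e, disp e -> `|G e| <= B'.
Proof.
move=> B0 GD HE th1 HB.
have [Bd Bd0 BdP] := finite_norm_bound G digits_finite.
have [Bb Bb0 BbP] := finite_norm_bound G finite_disp0.
have GS t t' s s' : descendant base t t' -> phi [set t] s -> phi [set t'] s' ->
    exists2 d, digits d & G (s'.2 - s.2) = th * G (t'.2 - t.2) + (H (t'.2 - t.2) + G d).
  move=> dt ts t's'; have [d dd ->] := digits_subst ts t's'; exists d => //.
  have Me : M (t'.2 - t.2) by apply: disp_sub; exists t, t'.
  rewrite (GD _ _ (ML Me) (Md dd)) (HE _ Me).
  by rewrite addrA [_ + (G _ - _)]addrC subrK.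
have HGB t t' d : descendant base t t' -> digits d ->
    `|H (t'.2 - t.2) + G d| <= B + Bd.
  move=> dt dd; rewrite (le_trans (ler_normD _ _))// lerD ?BdP//.
  by apply: HB; exists t, t'.
have [th_lt1|th_gt1] := th1.
  have th0 : 0 < 1 - `|th| by rewrite subr_gt0.
  have Q0 : 0 <= (B + Bd) / (1 - `|th|) by apply: divr_ge0; [exact: addr_ge0|exact: ltW].
  exists (Bb + (B + Bd) / (1 - `|th|)); first exact: addr_ge0.
  move=> _ [t [t' [d ->]]]; elim: d => {t t'} [t t' b ov|t t' s s' dt Gt ts t's' ov].
    rewrite (@le_trans _ _ Bb)//; first by apply: BbP; exists t, t'.
    by rewrite lerDl.
  have [d dd ->] := GS _ _ _ _ dt ts t's'.
  rewrite (le_trans (ler_normD _ _))// normrM.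
  apply: (@le_trans _ _ (`|th| * (Bb + (B + Bd) / (1 - `|th|)) + (B + Bd))).
    by apply: lerD; [exact: ler_wpM2l|exact: HGB].
  rewrite -subr_ge0.
  have -> : Bb + (B + Bd) / (1 - `|th|) - (`|th| * (Bb + (B + Bd) / (1 - `|th|)) + (B + Bd))
    = (1 - `|th|) * Bb.
    by field; rewrite gt_eqF.
  by rewrite mulr_ge0// ltW.
have th0 : 0 < `|th| - 1 by rewrite subr_gt0.
have Q0 : 0 <= (B + Bd) / (`|th| - 1) by apply: divr_ge0; [exact: addr_ge0|exact: ltW].
exists ((B + Bd) / (`|th| - 1)); first exact: Q0.
move=> _ [t [t' [dt ->]]]; have [k [s [ts t's]]] := common dt.
elim: k t t' dt ts t's => [|k IH] t t' dt.
  move=> /= -> tt'; rewrite tt' in dt *; rewrite subrr.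
  have M00 : M 0 by rewrite -(subrr t'.2); apply: disp_sub; exists t', t'.
  have := GD 0 0 M00 M00; rewrite addr0 => /eqP; rewrite -subr_eq subrr => /eqP <-.
  by rewrite normr0.
rewrite !iterSr => /iter_substE[t1 tt1 t1s] /iter_substE[t1' tt1' t1s'].
have ov1 : overlap t1 t1' by exact: overlap_ancestor t1s t1s' (overlap_refl _ _).
have dt1 : descendant base t1 t1' by exact: DescendantS dt tt1 tt1' ov1.
have G1 := IH _ _ dt1 t1s t1s'.
have [d dd GE] := GS _ _ _ _ dt tt1 tt1'.
have : th * G (t'.2 - t.2) = G (t1'.2 - t1.2) - (H (t'.2 - t.2) + G d) by rewrite GE addrK.
move=> /(congr1 Num.norm); rewrite normrM => thG.
have th00 : 0 < `|th| by rewrite (lt_trans ltr01).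
rewrite -(ler_pM2l th00) thG (le_trans (ler_normB _ _))//.
apply: (@le_trans _ _ ((B + Bd) / (`|th| - 1) + (B + Bd))).
  by apply: lerD => //; exact: HGB.
rewrite -subr_ge0.
have -> : `|th| * ((B + Bd) / (`|th| - 1)) - ((B + Bd) / (`|th| - 1) + (B + Bd)) = 0.
  by field; rewrite gt_eqF.
exact: lexx.
Qed.

End Bound.

(** The displacements lie in the group spanned by finitely many vectors [g *m L ^+ j], with [g] a
    base displacement or a digit; it is stable under [L] because [P] is monic and annihilates [L].
    It remains to bound the integer coordinates of the displacements. *)
Lemma descendant_finite (P : {poly int}) : P \is monic ->
  horner_mx L (map_poly intr P) = 0 ->
  (forall w : K, root (map_poly intr P) w -> `|w| < 1 \/ 1 < `|w|) ->
  finite_set disp0 ->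
  (forall t t', descendant base t t' ->
    exists k s, iter k phi [set t] s /\ iter k phi [set t'] s) ->
  finite_set disp.
Proof.
move=> Pm PL Proot fin0 common.
have finU : finite_set (disp0 `|` digits) by rewrite finite_setU; split; last exact: digits_finite.
have [S0 S0E] := (finite_seqP _).1 finU.
pose S := [seq g *m L ^+ j | g <- S0, j <- iota 0 (size P)].
have tf (x : V) (D : int) : D != 0 -> x *~ D = 0 -> x = 0.
  move=> D0; rewrite -scaler_int => /eqP; rewrite scaler_eq0 intr_eq0 (negbTE D0).
  by move=> /eqP.
have [r [c [cD c0]]] := int_span_coordinates tf S.
pose M := int_span S.
have P0 : (0 < size P)%N by rewrite size_poly_gt0 monic_neq0.
have PLsum x : \sum_(i < size P) (x *m L ^+ i) *~ P`_i = 0.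
  have := congr1 (fun A => x *m A) PL; rewrite mulmx0 horner_mx_sum => h; rewrite -[RHS]h.
  rewrite size_map_poly_id0; last by rewrite (eqP Pm) oner_neq0.
  rewrite mulmx_sumr; apply: eq_bigr => i _.
  by rewrite coef_map/= -scalemxAr scaler_int.
have S0M : disp0 `|` digits `<=` M.
  rewrite S0E => g gS0; apply: int_span_mem; apply/allpairsP; exists (g, 0%N).
  by rewrite mem_iota/= expr0 mulmx1.
have MD x y : M x -> M y -> M (x + y) by exact: int_spanD.
have ML x : M x -> M (x *m L).
  apply: (@int_span_sub _ _ S S (mulmxr L)) => _ /allpairsP[[g j] [gS0 +] ->] /=.
  rewrite mem_iota add0n => /andP[_ jP].
  rewrite -mulmxA -[_ *m L]/(_ * L) -exprSr.
  have [j1P|Pj1] := ltnP j.+1 (size P).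
    by apply: int_span_mem; apply/allpairsP; exists (g, j.+1); rewrite mem_iota.
  have Pj : size P = j.+1 by apply/eqP; rewrite eqn_leq jP Pj1.
  have := PLsum (g *m L); rewrite Pj big_ord_recr/=.
  have -> : P`_j = 1 by move: Pm => /monicP; rewrite /lead_coef Pj.
  rewrite mulr1z -mulmxA -[L *m _]/(L * _) -exprS => /eqP.
  rewrite addrC addr_eq0 => /eqP ->; apply: int_spanN.
  apply: int_span_sum => i; apply: int_spanMz.
  rewrite -mulmxA -[L *m _]/(L * _) -exprS.
  apply: int_span_mem; apply/allpairsP; exists (g, i.+1); split => //.
  by rewrite mem_iota Pj /= ltnS ltn_ord.
have c00 : c 0 = 0.
  have := cD 0 0 (int_span0 _) (int_span0 _).
  by rewrite addr0 => /eqP; rewrite -subr_eq subrr => /eqP.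
have cN x : M x -> c (- x) = - c x.
  move=> Mx; apply/eqP; rewrite -addr_eq0 -cD ?addNr ?c00//; exact: int_spanN.
have cMz x (z : int) : M x -> c (x *~ z) = c x *~ z.
  move=> Mx; have cMn (k : nat) : c (x *+ k) = c x *+ k.
    elim: k => [|k IH]; first by rewrite !mulr0n c00.
    rewrite !mulrS cD// ?IH//; rewrite pmulrn; exact: int_spanMz.
  case: z => k; first by rewrite -!pmulrn.
  by rewrite NegzE !mulrNz -!pmulrn cN ?cMn// pmulrn; exact: int_spanMz.
have csum (I : Type) (s : seq I) (F : I -> V) : (forall i, M (F i)) ->
    c (\sum_(i <- s) F i) = \sum_(i <- s) c (F i).
  move=> MF; elim: s => [|i s IH]; first by rewrite !big_nil.
  by rewrite !big_cons (cD _ _ (MF i) (int_span_sum _ MF)) IH.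
have MLX x j : M x -> M (x *m L ^+ j).
  move=> Mx; elim: j => [|j IH]; first by rewrite expr0 mulmx1.
  by rewrite exprSr -[_ * _]/(_ *m _) mulmxA; exact: ML.
(* For an integer polynomial [q] this is the [i]-th coordinate of [x] multiplied by the value of [q]
   at [L]; the formula extends it to complex [q], which do not act on the group. *)
pose F (i : 'I_r) (q : {poly K}) (x : V) : K :=
  poly_functional (fun j => (c (x *m L ^+ j) ord0 i)%:~R) q.
have dispM : disp `<=` M by apply: disp_sub => // x Mx; apply: S0M; [left|right].
have bnd i : exists B : K, forall e, disp e -> `|(c e ord0 i)%:~R : K| <= B.
  pose PC : {poly K} := map_poly intr P.
  have [rs rsE] := closed_field_poly_normal PC.
  have PCm : lead_coef PC = 1.
    by rewrite lead_coef_map_eq (eqP Pm) ?oner_neq0.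
  rewrite PCm scale1r in rsE.
  have rsP : {in rs, forall w, `|w| < 1 \/ 1 < `|w|}.
    by move=> w wrs; apply: Proot; rewrite -/PC rsE root_prod_XsubC.
  (* The product of all linear factors is [P], for which the form vanishes; the factors are removed
     one at a time until [q] is 1, where the form is the coordinate itself. *)
  suff H (q : {poly K}) : (exists2 B, 0 <= B &
        forall e, disp e -> `|F i (q * \prod_(w <- rs) ('X - w%:P)) e| <= B) ->
      exists2 B, 0 <= B & forall e, disp e -> `|F i q e| <= B.
    have [|B _ BP] := H 1.
      exists 0 => // e /dispM Me; rewrite mul1r -rsE.
      suff -> : F i PC e = 0 by rewrite normr0.
      rewrite /F (@poly_functional_widen _ _ PC (size P)); last exact: size_poly.
      have := congr1 (fun x => (c x ord0 i)%:~R : K) (PLsum e).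
      rewrite c00 mxE mulr0z => h0; rewrite -[RHS]h0 csum; last first.
        by move=> j; apply: int_spanMz; exact: MLX.
      rewrite summxE rmorph_sum; apply: eq_bigr => j _.
      rewrite cMz; last exact: MLX.
      by rewrite coef_map/= int_row_mulz rmorphM.
    exists B => e /BP; by rewrite /F poly_functional1 expr0 mulmx1.
  clear rsE; elim: rs q rsP => [|w rs IH] q rsP; first by rewrite big_nil mulr1.
  rewrite big_cons mulrA => /IH[|B B0 BP].
    by move=> z zrs; apply: rsP; rewrite inE zrs orbT.
  apply: (@disp_bounded_step M _ _ MD ML fin0 common (F i q) (F i (q * ('X - w%:P))) w B) => //.
  - by move=> x Dx; apply: S0M; left.
  - by move=> x Dx; apply: S0M; right.
  - move=> x y Mx My; rewrite /F -poly_functionalD; congr poly_functional.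
    apply: funext => j; rewrite mulmxDl cD ?mxE ?rmorphD//; exact: MLX.
  - move=> x Mx; rewrite /F poly_functional_mulXsubC; congr (_ - _).
    congr poly_functional; apply: funext => j.
    by rewrite -mulmxA -[L *m _]/(L * _) -exprS.
  - by apply: rsP; rewrite mem_head.
have /choice[B BP] := bnd.
have /choice[N NP] i := int_le_complex (B i).
pose N0 := (\sum_(i < r) N i)%N.
apply: (@finite_preimage_inj _ _ disp _ c (finite_int_rows r N0)).
  move=> e de i; have := NP i _ (BP i _ de) => /le_trans; apply.
  by rewrite lez_nat /N0 (bigD1 i)//= leq_addr.
move=> x y /dispM Mx /dispM My cxy; apply/eqP; rewrite -subr_eq0; apply/eqP.
by apply: c0; [exact: int_spanB|rewrite cD ?cN ?cxy ?subrr//; exact: int_spanN].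
Qed.

End Descendants.

(** * Frequency of disagreements *)

Section Counting.
Variables (R : realType) (n l : nat) (Phi : substitution R n.+1 l).
Local Notation V := 'rV[R]_n.+1.
Local Notation tile := (tile R n.+1 l).
Local Notation L := (expansion Phi).
Local Notation C := (proto Phi).
Local Notation supp := (tile_supp (proto Phi)).
Local Notation phi := (subst Phi).
Local Notation overlap := (overlap Phi).
Implicit Types (P T : set tile) (t s : tile) (v x : V).
Implicit Types (i j : 'I_l).

(** [t] and [t'] shifted by [u] occur in a common supertile; so [t] and [t'] are compared as tiles
    of a patch and of its translate by [- u]. *)
Definition return_pair (u : V) t t' := legal Phi t.1 t'.1 (t'.2 + u - t.2).

Lemma iter_subst1_translate k t v s :
  iter k phi [set t] s ->
  iter k phi [set (t.1, t.2 + v)] (s.1, s.2 + v *m L ^+ k).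
Proof.
rewrite -translate1 iter_subst_translate => ts; apply/translateP.
by rewrite /= addrK; case: s ts.
Qed.

(** A common descendant persists at all later levels; as there are finitely many descendant pairs up
    to translation, one level serves for all of them. *)
Lemma coincidence_level (u : V) (P : {poly int}) T0 : primitive Phi -> FLC Phi ->
  tiling_space Phi T0 -> P \is monic -> horner_mx L (map_poly intr P) = 0 ->
  (forall w : R[i], root (map_poly intr P) w -> `|w| < 1 \/ 1 < `|w|) ->
  (forall t t', return_pair u t t' -> overlap t t' -> dense_pair Phi t t') ->
  exists k0, forall k t t', (k0 <= k)%N -> descendant Phi (return_pair u) t t' ->
    exists s, iter k phi [set t] s /\ iter k phi [set t'] s.
Proof.
move=> prim flc TT0 Pm PL Proot dp.
have [D D0 DP] := diam_exists Phi.
have ddp t t' : descendant Phi (return_pair u) t t' -> dense_pair Phi t t'.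
  elim=> {t t'} [t t' b ov|t t' s s' _ dtt' ts t's' ov]; first exact: dp.
  by apply: (@dense_pair_descendant _ _ _ Phi 1 [set t] [set t']) => //; exact: patch1.
have common t t' : descendant Phi (return_pair u) t t' ->
    exists k s, iter k phi [set t] s /\ iter k phi [set t'] s.
  move=> dtt'; apply: dense_pair_common; first exact: ddp.
  exact: descendant_overlap dtt'.
have fin0 : finite_set [set e | exists t t',
    [/\ return_pair u t t', overlap t t' & e = t'.2 - t.2]].
  apply: (@sub_finite_set _ _ [set p.2 - u |
      p in [set p : 'I_l * 'I_l * V | legal Phi p.1.1 p.1.2 p.2 /\ `|p.2| < D + D + (`|u| + 1)]]).
    move=> _ [t [t' [leg ov ->]]]; exists (t.1, t'.1, t'.2 + u - t.2); last first.
      by rewrite /= addrAC addrK.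
    split => //=; have [y [/interior_subset y1 /interior_subset y2]] := ov.
    have := DP _ _ y1; have := DP _ _ y2 => d2 d1.
    have -> : t'.2 + u - t.2 = (y - t.2) - (y - t'.2) + u.
      by apply/rowP => k; rewrite !mxE; ring.
    rewrite (le_lt_trans (ler_normD _ _))// ler_ltD ?ltrDl//.
    by rewrite (le_trans (ler_normB _ _))// lerD.
  by apply: finite_image; exact: (legal_finite prim (D + D + (`|u| + 1)) TT0 flc).
have fin := descendant_finite Pm PL Proot fin0 common.
have [||k0 k0P] := @finite_eventually _
    [set p : 'I_l * 'I_l * V | exists t t', descendant Phi (return_pair u) t t' /\
      p = (t.1, t'.1, t'.2 - t.2)]
    (fun p k => exists s, iter k phi [set (p.1.1, 0)] s /\ iter k phi [set (p.1.2, p.2)] s).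
- apply: sub_finite_set (finite_setX (@finite_finset _ [set: 'I_l * 'I_l]) fin).
  move=> _ [t [t' [d ->]]]; split => //=.
  by exists t, t'.
- move=> _ [t [t' [d ->]]] /=; have [k1 [s [ts t's]]] := common _ _ d.
  exists k1 => k k1k.
  have [s' ss'] := iter_subst1_nonempty Phi (k - k1) s.
  have H (t1 : tile) : iter k1 phi [set t1] s -> iter k phi [set t1] s'.
    by move=> h; rewrite -(subnK k1k) iter_subst_comp; apply/iter_substE; exists s.
  have := iter_subst1_translate (- t.2) (H _ ts).
  have := iter_subst1_translate (- t.2) (H _ t's).
  by rewrite /= subrr; exists (s'.1, s'.2 + - t.2 *m L ^+ k).
exists k0 => k t t' k0k dtt'.
have [|s [/= s1 s2]] := k0P k (t.1, t'.1, t'.2 - t.2) k0k; first by exists t, t'.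
exists (s.1, s.2 + t.2 *m L ^+ k); split.
  by have := iter_subst1_translate t.2 s1; rewrite /= add0r; case: (t).
by have := iter_subst1_translate t.2 s2; rewrite /= subrK; case: (t').
Qed.

Lemma iter_subst1_finite N t : finite_set (iter N phi [set t]).
Proof.
elim: N => [|N IH]; first exact: finite_set1.
rewrite iterS; apply: bigcup_finite => // s _.
exact/finite_image/rule_finite.
Qed.

Lemma descendants_exist N t :
  exists r : seq tile, uniq r /\ forall s, s \in r <-> iter N phi [set t] s.
Proof.
have [r rE] := (finite_seqP _).1 (iter_subst1_finite N t).
exists (undup r); split; first exact: undup_uniq.
by move=> s; rewrite mem_undup rE.
Qed.

Definition descendants N t : seq tile := sval (cid (descendants_exist N t)).

Lemma mem_descendants N t s : s \in descendants N t <-> iter N phi [set t] s.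
Proof. by rewrite /descendants; case: cid => r [_ rE] /=. Qed.

Lemma descendants_uniq N t : uniq (descendants N t).
Proof. by rewrite /descendants; case: cid => r []. Qed.

Lemma flatten_uniq (A B : eqType) (f : A -> seq B) (r : seq A) :
  uniq r -> (forall a, a \in r -> uniq (f a)) ->
  (forall a b c, a \in r -> b \in r -> c \in f a -> c \in f b -> a = b) ->
  uniq (flatten [seq f a | a <- r]).
Proof.
elim: r => //= a r IH /andP[ar ur] uf disj.
rewrite cat_uniq uf ?mem_head//= IH//; last 2 first.
- by move=> b br; apply: uf; rewrite inE br orbT.
- by move=> b c d br cr; apply: disj; rewrite inE ?br ?cr orbT.
rewrite andbT; apply/hasPn => c /flatten_mapP[b br cb]; apply/negP => ca.
have ba : b = a by apply: disj cb ca; rewrite ?mem_head// inE br orbT.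
by move: ar; rewrite -ba br.
Qed.

Lemma descendants_flatten_uniq N P (r : seq tile) : is_patch C P -> uniq r ->
  (forall t, t \in r -> P t) -> uniq (flatten [seq descendants N t | t <- r]).
Proof.
move=> pP ur rP; apply: flatten_uniq => // [x _|x y z xr yr].
  exact: descendants_uniq.
move=> /mem_descendants zx /mem_descendants zy.
apply: patch_overlap_eq pP (rP _ xr) (rP _ yr) _.
exact: overlap_ancestor zx zy (overlap_refl _ _).
Qed.

Lemma descendants_comp N M t :
  perm_eq (descendants (N + M) t) (flatten [seq descendants N s | s <- descendants M t]).
Proof.
apply: uniq_perm; first exact: descendants_uniq.
  apply: (@descendants_flatten_uniq N (iter M phi [set t])).
  - by apply: iter_subst_patch; exact: patch1.
  - exact: descendants_uniq.
  - by move=> s /mem_descendants.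
move=> s; apply/idP/idP.
  move=> /mem_descendants; rewrite iter_subst_comp => /iter_substE[u tu us].
  by apply/flatten_mapP; exists u; apply/mem_descendants.
move=> /flatten_mapP[u /mem_descendants tu /mem_descendants us].
by apply/mem_descendants; rewrite iter_subst_comp; apply/iter_substE; exists u.
Qed.

Definition weight N t : nat := size (descendants N t).

Lemma weightD N M t : weight (N + M) t = (\sum_(s <- descendants M t) weight N s)%N.
Proof.
rewrite /weight (perm_size (descendants_comp N M t)) size_flatten /shape -map_comp.
by rewrite sumnE big_map.
Qed.

Lemma weight_shift N t v : weight N (t.1, t.2 + v) = weight N t.
Proof.
suff H t' v' : (weight N t' <= weight N (t'.1, (t'.2 + v')%R))%N.
  apply/eqP; rewrite eqn_leq H andbT.
  by have := H (t.1, t.2 + v) (- v); rewrite /= addrK; case: (t).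
pose f (s : tile) : tile := (s.1, s.2 + v' *m L ^+ N).
have finj : injective f by move=> [i x] [j y] [-> /addIr ->].
rewrite /weight -(size_map f); apply: uniq_leq_size.
  by rewrite map_inj_uniq// descendants_uniq.
move=> _ /mapP[s /mem_descendants ts ->]; apply/mem_descendants.
exact: iter_subst1_translate.
Qed.

Lemma weight_type N i v : weight N (i, v) = weight N (i, 0).
Proof. by rewrite -(weight_shift N (i, 0) v)/= add0r. Qed.

(** The [k0]-th image of [t'] contains a translate of [t]; the descendants of [t'] at level [N + k0]
    are then counted by splitting the levels in both orders. *)
Lemma weight_compare : primitive Phi ->
  exists2 K, (0 < K)%N & forall N t t', (weight N t <= K * weight N t')%N.
Proof.
move=> prim; have [k0 k0P] := supertile_all_types prim.
pose K := (\sum_(i < l) weight k0 (i, 0%R))%N.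
have wK t : (weight k0 t <= K)%N.
  by case: t => i v; rewrite weight_type /K (bigD1 i)//= leq_addr.
exists K.+1 => // N [j w] [i v].
have [x jx] := k0P k0 i j (leqnn _).
have h1 : (weight N (j, w) <= weight (N + k0) (i, 0%R))%N.
  rewrite weightD (big_rem (j, x))/=; last exact/mem_descendants.
  by rewrite weight_type -(weight_type N j x) leq_addr.
apply: (leq_trans h1); rewrite addnC weightD weight_type.
apply: (@leq_trans (\sum_(s <- descendants N (i, 0%R)) K)%N).
  by apply: leq_sum => s _; exact: wK.
rewrite big_const_seq count_predT iter_addn_0 leq_mul2r leqnSn orbT//.
Qed.

(** As [K] does not depend on [N], a single tile in common after [k] levels will remove a fixed
    proportion of the disagreements. *)
Lemma weight_fraction k : primitive Phi ->
  exists2 K, (0 < K)%N & forall N t s, (weight (N + k) t <= K * weight N s)%N.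
Proof.
move=> prim; have [K K0 KP] := weight_compare prim.
exists (K * (\sum_(i < l) weight k (i, 0%R)).+1)%N; first by rewrite muln_gt0 K0.
move=> N t s; rewrite weightD mulnAC.
apply: (@leq_trans (\sum_(u <- descendants k t) K * weight N s)%N).
  by apply: leq_sum => u _; exact: KP.
rewrite big_const_seq count_predT iter_addn_0 leq_mul2l.
apply/orP; right; rewrite -/(weight k t); case: t => i v.
by rewrite weight_type (bigD1 i)//= -addnS leq_addr.
Qed.

Section BadTiles.
Variables (u : V) (k0 : nat).
Hypothesis primitive_Phi : primitive Phi.
Hypothesis common : forall t t', descendant Phi (return_pair u) t t' ->
  exists s, iter k0 phi [set t] s /\ iter k0 phi [set t'] s.

(** The local knowledge about a translated patch [P] above a tile [t]. It is inherited by the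
    descendants of [t], which makes the count of disagreements inductive. *)
Definition covered_context t P := (forall x, supp t x -> patch_supp C P x) /\
  forall t', P t' -> overlap t t' -> descendant Phi (return_pair u) t t'.

Lemma covered_context_iter k t P s : covered_context t P -> iter k phi [set t] s ->
  covered_context s (iter k phi P).
Proof.
move=> [cov ov] ts; split=> [x sx|s' /iter_substE[t' Pt' t's'] ss'].
  rewrite -(mulLXK Phi k x); apply/iter_subst_supp/cov.
  rewrite -patch_supp1; apply/(@iter_subst_supp _ _ _ Phi k); rewrite mulLXK.
  by exists s.
have tt' : overlap t t' by exact: overlap_ancestor ts t's' ss'.
exact: (descendant_iter (ov _ Pt' tt') ts t's' ss').
Qed.

Definition bad_count N t P := count (fun s => ~~ `[< iter N phi P s >]) (descendants N t).

Lemma bad_countD N M t P :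
  bad_count (N + M) t P = (\sum_(s <- descendants M t) bad_count N s (iter M phi P))%N.
Proof.
rewrite /bad_count (permP (descendants_comp N M t)) count_flatten -map_comp.
by rewrite sumnE big_map; apply: eq_bigr => s _ /=; rewrite iter_subst_comp.
Qed.

Lemma bad_count_common N t P : P t -> bad_count N t P = 0%N.
Proof.
move=> Pt; apply/eqP; rewrite -leqn0 leqNgt -has_count; apply/hasPn => s.
move=> /mem_descendants ts; rewrite negbK; apply/asboolP/iter_substE.
by exists t.
Qed.

Lemma context_common t P : covered_context t P ->
  exists s, iter k0 phi [set t] s /\ iter k0 phi P s.
Proof.
move=> [cov ov]; have [x [tx _]] := overlap_refl Phi t.
have [t' Pt' [y ty t'y]] := open_in_patch (open_interior _) tx (cov x (interior_subset tx)).
have [|s [ts t's]] := @common t t'; first by apply: ov => //; exists y.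
by exists s; split => //; apply/iter_substE; exists t'.
Qed.

(** After [k0] levels [t] and [P] share a tile, all of whose descendants agree. Its share of the
    descendants is at least [K%:R^-1], and the estimate is repeated on the remaining tiles. *)
Lemma bad_count_bound : exists2 r : R, 0 < r < 1 & forall q t P, covered_context t P ->
  (bad_count (q * k0) t P)%:R <= r ^+ q * (weight (q * k0) t)%:R.
Proof.
have [K K0 KP] := weight_fraction k0 primitive_Phi.
(* [K.+1] in place of [K] keeps the ratio positive. *)
pose r : R := 1 - K.+1%:R^-1.
have r0 : 0 < r.
  by rewrite subr_gt0 invf_lt1 ?ltr0n// ltr1n ltnS.
have r1 : r < 1 by rewrite ltrBlDr ltrDl invr_gt0 ltr0n.
exists r; first by rewrite r0.
elim=> [|q IH] t P ctx.
  by rewrite expr0 mul1r ler_nat count_size.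
have [s0 [ts0 Ps0]] := context_common ctx.
rewrite mulSn addnC bad_countD.
have s0d : s0 \in descendants k0 t by exact/mem_descendants.
rewrite (big_rem s0)//= bad_count_common// add0n.
have tot := weightD (q * k0) k0 t; rewrite (big_rem s0)//= in tot.
rewrite tot.
set S := (\sum_(s <- rem s0 _) weight _ s)%N in tot *.
have h1 : (\sum_(s <- rem s0 (descendants k0 t)) bad_count (q * k0) s (iter k0 phi P))%:R
    <= r ^+ q * S%:R.
  rewrite /S !natr_sum mulr_sumr big_seq [leRHS]big_seq; apply: ler_sum => s sd.
  apply: IH; apply: covered_context_iter ctx _; apply/mem_descendants.
  exact: mem_rem sd.
apply: (le_trans h1); rewrite exprSr -mulrA ler_wpM2l ?exprn_ge0 ?(ltW r0)//.
have := KP (q * k0)%N t s0; rewrite tot => Kw.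
have {}Kw : (weight (q * k0) s0 + S)%:R <= K%:R * (weight (q * k0) s0)%:R :> R.
  by rewrite -natrM ler_nat.
rewrite /r mulrBl mul1r lerBrDr [X in _ <= X]natrD [X in X <= _]addrC lerD2r.
rewrite mulrC ler_pdivrMr ?ltr0n// mulrC (le_trans Kw)//.
by rewrite ler_wpM2r// ler_nat.
Qed.

(** The shape [K' * (1 - K'^-1) ^+ N] has a single parameter and holds for all larger ones, so that
    one constant can later be taken for all rows of the basis. *)
Lemma bad_count_exponential : (0 < k0)%N -> exists2 K : R, 1 < K &
  forall K' : R, K <= K' -> forall N t P, covered_context t P ->
  (bad_count N t P)%:R <= K' * (1 - K'^-1) ^+ N * (weight N t)%:R.
Proof.
move=> k00; have [r /andP[r0 r1] rP] := bad_count_bound.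
have kR : 0 < k0%:R :> R by rewrite ltr0n.
(* By Bernoulli's inequality [(1 - h) ^+ k0] is at least [r]. *)
pose h := (1 - r) / k0%:R.
have h0 : 0 < h by rewrite divr_gt0 ?subr_gt0.
have h1 : h < 1.
  rewrite ltr_pdivrMr// mul1r (@lt_le_trans _ _ 1)//; last by rewrite ler1n.
  by rewrite ltrBlDr ltrDl.
have rh : r <= (1 - h) ^+ k0.
  have bern (k : nat) : 1 - k%:R * h <= (1 - h) ^+ k.
    elim: k => [|k IH]; first by rewrite expr0 mul0r subr0.
    rewrite exprS (@le_trans _ _ ((1 - h) * (1 - k%:R * h)))//; last first.
      by rewrite ler_wpM2l// subr_ge0 ltW.
    rewrite -natr1 mulrDl mul1r mulrBr mulr1 mulrBl mul1r.
    have : 0 <= h * (k%:R * h).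
      by apply: mulr_ge0; [exact: ltW|apply: mulr_ge0 => //; exact: ltW].
    lra.
  apply: le_trans (bern k0); rewrite /h mulrCA divff ?gt_eqF// mulr1.
  by rewrite opprB addrCA subrr addr0.
(* The summands respectively make the constant exceed 1, make [1 - K'^-1] at least [1 - h], and
   absorb the remainder of [N] modulo [k0]. *)
exists (1 + h^-1 + (1 - h)^-1 ^+ k0).
  rewrite -addrA ltrDl addr_gt0 ?invr_gt0// exprn_gt0// invr_gt0 subr_gt0//.
move=> K' KK' N t P ctx.
have q0 : 0 < (1 - h)^-1 by rewrite invr_gt0 subr_gt0.
have K'h : h^-1 <= K'.
  by apply: le_trans KK'; rewrite -addrA addrCA lerDl addr_ge0// exprn_ge0// ltW.
have K'q : (1 - h)^-1 ^+ k0 <= K'.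
  by apply: le_trans KK'; rewrite lerDr addr_ge0// invr_ge0 ltW.
have K'0 : 0 < K' by apply: lt_le_trans K'h; rewrite invr_gt0.
have hK : 1 - h <= 1 - K'^-1.
  by rewrite lerD2l lerN2 invf_ple ?posrE.
have step : (bad_count N t P)%:R <= r ^+ (N %/ k0) * (weight N t)%:R.
  rewrite {1 3}(divn_eq N k0) bad_countD weightD !natr_sum mulr_sumr big_seq [leRHS]big_seq.
  apply: ler_sum => s /mem_descendants sd; apply: rP.
  exact: covered_context_iter ctx sd.
apply: (le_trans step); rewrite ler_wpM2r//.
apply: (@le_trans _ _ ((1 - h) ^+ (N %/ k0 * k0))).
  by rewrite mulnC exprM lerXn2r ?nnegrE ?exprn_ge0// ?ltW// subr_gt0.
apply: (@le_trans _ _ (K' * (1 - h) ^+ N)); last first.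
  rewrite ler_wpM2l ?(ltW K'0)// lerXn2r ?nnegrE//.
    by rewrite subr_ge0 ltW.
  by rewrite (le_trans _ hK)// subr_ge0 ltW.
have p0 : 0 < (1 - h) ^+ (N %/ k0 * k0) by rewrite exprn_gt0// subr_gt0.
rewrite [in leRHS](divn_eq N k0) exprD mulrCA ler_peMr ?(ltW p0)//.
apply: (@le_trans _ _ ((1 - h)^-1 ^+ k0 * (1 - h) ^+ k0)).
  by rewrite -exprMn mulVf ?expr1n// gt_eqF// subr_gt0.
apply: ler_pM => //; first by rewrite exprn_ge0// ltW.
  by rewrite exprn_ge0// subr_ge0 ltW.
apply: ler_wiXn2l.
- by rewrite subr_ge0 ltW.
- by rewrite lerBlDr lerDl ltW.
- by rewrite ltnW// ltn_mod.
Qed.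

End BadTiles.
End Counting.

(** * Uniform frequency of disagreements under a translation *)

Section Discrepancy.
Variables (R : realType) (n l : nat) (Phi : substitution R n.+1 l).
Local Notation V := 'rV[R]_n.+1.
Local Notation tile := (tile R n.+1 l).
Local Notation L := (expansion Phi).
Local Notation C := (proto Phi).
Local Notation supp := (tile_supp (proto Phi)).
Local Notation phi := (subst Phi).
Local Notation overlap := (overlap Phi).
Implicit Types (P T : set tile) (t s : tile) (u v x : V) (r e : R).

Definition agree r T T' := forall t, meets Phi r t -> (T t <-> T' t).

Definition grid_pt H (f : {ffun 'I_n.+1 -> 'I_H}) : V := \row_i (f i : nat)%:R.

Definition disagreements r v T H : {pred {ffun 'I_n.+1 -> 'I_H}} :=
  [pred f | ~~ `[< agree r (translate (- grid_pt f) T) (translate (- (grid_pt f + v)) T) >]].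

Arguments disagreements : clear implicits.

(** The bound is uniform over the tiling space, so [T] may be replaced by its translates; this makes
    the discrepancy subadditive and even in [v]. The grid points stand for an average over a large
    cube. *)
Definition discrepancy_le r v e := exists H0, forall H T, (H0 <= H)%N ->
  tiling_space Phi T -> (#|disagreements r v T H|)%:R <= e * H%:R ^+ n.+1.

Lemma discrepancy_le0 r : discrepancy_le r 0 0.
Proof.
exists 0%N => H T _ _; rewrite mul0r (_ : #|_| = 0%N)//; apply: eq_card0 => f.
by apply/negbTE; rewrite inE negbK; apply/asboolP; rewrite addr0.
Qed.

Lemma discrepancy_le_mono r v e e' : e <= e' -> discrepancy_le r v e -> discrepancy_le r v e'.
Proof.
move=> ee' [H0 H0P]; exists H0 => H T HH TT; apply: le_trans (H0P _ _ HH TT) _.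
by rewrite ler_wpM2r// exprn_ge0.
Qed.

(** If [T] and [T - (v + v')] disagree at a grid point, then there either [T] and [T - v] disagree,
    or [T - v] and its own translate by [- v'] do. *)
Lemma discrepancy_leD r v v' e e' : discrepancy_le r v e -> discrepancy_le r v' e' ->
  discrepancy_le r (v + v') (e + e').
Proof.
move=> [H0 H0P] [H1 H1P]; exists (maxn H0 H1) => H T; rewrite geq_max => /andP[HH0 HH1] TT.
have TT1 := tiling_space_translate (- v) TT.
have := lerD (H0P _ _ HH0 TT) (H1P _ _ HH1 TT1).
rewrite -mulrDl; apply: le_trans; rewrite -natrD ler_nat -cardUI.
apply: leq_trans (leq_addr _ _); apply/subset_leq_card/fintype.subsetP => f.
rewrite !inE -negb_and; apply: contra => /andP[/asboolP a1 /asboolP a2]; apply/asboolP.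
move: a2; rewrite !translateD -!opprD [v + (grid_pt f + v')]addrCA [v + grid_pt f]addrC => a2 t mt.
exact: iff_trans (a1 t mt) (a2 t mt).
Qed.

Lemma discrepancy_leN r v e : discrepancy_le r v e -> discrepancy_le r (- v) e.
Proof.
move=> [H0 H0P]; exists H0 => H T HH TT.
have := H0P _ _ HH (tiling_space_translate v TT); apply: le_trans.
rewrite ler_nat; apply/subset_leq_card/fintype.subsetP => f.
rewrite !inE; apply: contra => /asboolP a; apply/asboolP.
move: a; rewrite !translateD opprD [v + (_ - v)]addrCA subrr addr0 => a t mt.
by rewrite -(a t mt) opprD opprK addrC.
Qed.

Lemma discrepancy_le_mulz r v e (z : int) : discrepancy_le r v e ->
  discrepancy_le r (v *~ z) (`|z|%:~R * e).
Proof.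
move=> d; have dn (k : nat) : discrepancy_le r (v *+ k) (k%:R * e).
  elim: k => [|k IH]; first by rewrite mulr0n mul0r; exact: discrepancy_le0.
  by rewrite mulrS -natr1 mulrDl mul1r addrC; apply: discrepancy_leD.
case: z => k; first exact: dn.
by rewrite NegzE mulrNz normrN; exact/discrepancy_leN/dn.
Qed.

Lemma discrepancy_le_sum r (I : Type) (s : seq I) (v : I -> V) (e : I -> R) :
  (forall i, discrepancy_le r (v i) (e i)) ->
  discrepancy_le r (\sum_(i <- s) v i) (\sum_(i <- s) e i).
Proof.
move=> d; elim: s => [|i s IH]; first by rewrite !big_nil; exact: discrepancy_le0.
by rewrite !big_cons; exact: discrepancy_leD.
Qed.

Lemma supp_dist D t t' x : (forall t x, supp t x -> `|x - t.2| <= D) ->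
  supp t x -> supp t' x -> `|t.2 - t'.2| <= D + D.
Proof.
move=> DP tx t'x; have -> : t.2 - t'.2 = (x - t'.2) - (x - t.2).
  by apply/rowP => k; rewrite !mxE; ring.
by rewrite (le_trans (ler_normB _ _))// lerD ?DP.
Qed.

(** If the tile witnessing the disagreement, moved to [x], is in [T], it is the tile sought.
    Otherwise its translate by [v] is in [T], and a tile of [T] overlapping it cannot also have its
    translate by [v] in [T], as the two translates would overlap. *)
Lemma disagreement_tile D r v T x : (forall t x, supp t x -> `|x - t.2| <= D) ->
  tiling_space Phi T -> ~ agree r (translate (- x) T) (translate (- (x + v)) T) ->
  exists t, [/\ T t, ~ T (t.1, t.2 + v) & `|t.2 - x| <= r + D + (D + D)].
Proof.
move=> DP [[pT sT] _] /existsNP[t0 /not_implyP[[y ty yr] nt]].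
have t0x : `|(t0.2 + x) - x| <= r + D.
  rewrite addrK -[t0.2](subKr y) (le_trans (ler_normB _ _))//.
  by apply: lerD; [exact: ltW|exact: DP].
have D0 : 0 <= D by rewrite (le_trans _ (DP _ _ ty)).
have [Tt0|nTt0] := pselect (T (t0.1, t0.2 + x)).
  exists (t0.1, t0.2 + x); split => //.
    move=> Tv; apply: nt; split => _.
      by apply/translateP; rewrite /= opprK addrA.
    by apply/translateP; rewrite /= opprK.
  by rewrite (le_trans t0x)// lerDl addr_ge0.
have Tv : T (t0.1, t0.2 + x + v).
  apply: contrapT => nTv; apply: nt; split => /translateP /=; rewrite opprK ?addrA //.
pose t1 : tile := (t0.1, t0.2 + x).
have [z [t1z _]] := overlap_refl Phi t1.
have [||t Tt [w t1w tw]] := @open_in_patch _ _ _ Phi (supp t1)° T z (open_interior _).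
- exact: t1z.
- by rewrite sT.
exists t; split => //.
  move=> Ttv; apply: nTt0.
  suff tt1 : t = t1 by rewrite -/t1 -tt1.
  have : (t.1, t.2 + v) = (t1.1, t1.2 + v).
    apply: (patch_overlap_eq pT Ttv Tv); apply: (@overlap_shift _ _ _ Phi t t1 v).2.
    by exists w.
  by case: (t) (t1) => [? ?] [? ?] /= [-> /addIr ->].
have := @supp_dist D t t1 w DP (interior_subset tw) (interior_subset t1w) => d.
rewrite -[t.2 - x](subrK (t1.2 - x)) -[_ - _ - _](_ : t.2 - t1.2 = _); last first.
  by apply/rowP => k; rewrite !mxE; ring.
by rewrite addrC (le_trans (ler_normD _ _))// lerD.
Qed.

(** A grid point is determined by a nearby tile of [S] and its offset from the rounded position of
    that tile, which has at most [(m + m).+1] values in each coordinate. *)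
Lemma disagreements_card (m H : nat) (rho : R) r v T (S : seq tile) : rho <= m%:R ->
  (forall f, f \in disagreements r v T H -> exists2 t, t \in S & `|t.2 - grid_pt f| <= rho) ->
  (#|disagreements r v T H| <= size S * (m + m).+1 ^ n.+1)%N.
Proof.
move=> rm fS; set A := disagreements r v T H.
pose z t (f : {ffun 'I_n.+1 -> 'I_H}) i : int := Num.floor (t.2 ord0 i) - (f i : nat)%:Z.
have zm t f i : `|t.2 - grid_pt f| <= rho -> (- m%:Z <= z t f i <= m%:Z).
  move=> /(le_trans (coord_le_norm _ i)) /le_trans/(_ rm); rewrite !mxE.
  rewrite ler_norml => /andP[y1 y2].
  have /andP[] := floor_itv (t.2 ord0 i) => z1 z2.
  apply/andP; split.
    rewrite /z lerBrDr -ltzD1 -(ltr_int R) (le_lt_trans _ z2)//.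
    by rewrite rmorphD rmorphN/= -!pmulrn -lerBrDr.
  rewrite /z lerBlDr -(ler_int R) (le_trans z1)// rmorphD/= -!pmulrn.
  by rewrite -lerBlDr.
pose o t (f : {ffun 'I_n.+1 -> 'I_H}) : {ffun 'I_n.+1 -> 'I_(m + m).+1} :=
  [ffun i => inord (absz (z t f i + m%:Z)%R)].
have oinj t f f' : `|t.2 - grid_pt f| <= rho -> `|t.2 - grid_pt f'| <= rho ->
    o t f = o t f' -> f = f'.
  move=> h h' /ffunP oo; apply/ffunP => i; apply: val_inj => /=.
  have := oo i; rewrite !ffunE => /(congr1 val)/=.
  have lt_absz (k : int) : - m%:Z <= k <= m%:Z -> (absz (k + m%:Z)%R < (m + m).+1)%N.
    by clear; lia.
  have a := zm t f i h; have a' := zm t f' i h'.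
  rewrite !inordK ?lt_absz//; move: a a'; rewrite /z.
  set F := Num.floor _; set x := nat_of_ord _; set y := nat_of_ord _; clear; lia.
have [f0 f0A|A0] := pickP A; last by rewrite (eq_card0 A0).
have [t0 _ _] := fS _ f0A.
have /choice[tf tfP] (f : {ffun 'I_n.+1 -> 'I_H}) : exists t, f \in A ->
    t \in S /\ `|t.2 - grid_pt f| <= rho.
  have [fd|fd] := boolP (f \in A); last by exists t0.
  by have [t tS tr] := fS _ fd; exists t.
pose g f := (tf f, o (tf f) f).
have ginj : {in enum A &, injective g}.
  move=> f f'; rewrite !mem_enum => fA f'A [tt' oo'].
  have [_ h] := tfP _ fA; have [_ h'] := tfP _ f'A.
  by move: h' oo'; rewrite -tt' => h'; exact: oinj.
rewrite cardE -(size_map g).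
apply: (@leq_trans (size [seq (t, p) | t <- S, p <- enum {ffun 'I_n.+1 -> 'I_(m + m).+1}])).
  apply: uniq_leq_size; first by rewrite map_inj_in_uniq// enum_uniq.
  move=> p /mapP[f fA ->]; rewrite mem_enum in fA; have [tS _] := tfP _ fA.
  by apply/allpairsP; exists (tf f, o (tf f) f); split => //; rewrite mem_enum.
rewrite size_allpairs -cardE card_ffun !card_ord; exact: leqnn.
Qed.

(** Near the ball [T] is the [N]-th image of a patch [S'], so its translate by [- (u *m L ^+ N)] is
    the image of [S'] translated by [- u]. The bad tiles are charged to their ancestors in [S'],
    whose total weight is a number of tiles in a slightly larger ball, hence of order
    [B ^+ n.+1]. *)
Lemma bad_tiles_bound u (beta : nat -> R) : primitive Phi ->
  (forall N, 0 <= beta N) ->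
  (forall N t P, covered_context Phi u t P ->
    (bad_count Phi N t P)%:R <= beta N * (weight Phi N t)%:R) ->
  exists2 c : R, 0 < c & forall N, exists B0 : R, forall (B : R) T (S : seq tile), B0 <= B ->
    tiling_space Phi T -> uniq S ->
    (forall t, t \in S -> [/\ T t, ~ T (t.1, t.2 + u *m L ^+ N) & `|t.2| <= B]) ->
    (size S)%:R <= c * beta N * B ^+ n.+1.
Proof.
move=> prim beta0 betaP.
have [D D0 DP] := diam_exists Phi.
have [c c0 cP] := patch_count Phi.
exists (c * 2 ^+ n.+1); first by rewrite mulr_gt0// exprn_gt0.
move=> N; have [cN cN0 cNP] := mulmx_bound (L ^+ N).
(* [E] bounds how far a supertile of level [N] with a tile in the ball extends beyond it. *)
pose E := D + D + cN * (D + D) + 1.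
have E0 : 0 < E by rewrite ltr_wpDl// addr_ge0 ?mulr_ge0 ?addr_ge0 ?(ltW cN0) ?(ltW D0).
exists (E + 1) => B T S EB TT uS SP; have [[pT sT] _] := TT.
have B1 : 1 <= B by rewrite (le_trans _ EB)// lerDr ltW.
pose v := u *m L ^+ N.
pose R1 := B + E + `|v|.
have [k [i [w [Nk kP]]]] := patch_cover prim R1 N TT.
set SS := translate w (supertile Phi k i) in kP.
pose S' := iter (k - N) phi [set (i, w *m L ^- k)].
have SSE : SS = iter N phi S'.
  by rewrite /SS translate_supertile -{1}(subnKC Nk) iter_subst_comp.
have pS' : is_patch C S' by apply: iter_subst_patch; exact: patch1.
have meetsT t x : supp t x -> `|x| < R1 -> (SS t <-> T t).
  by move=> tx xr; apply: kP; exists x.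
have DR1 : B + D < R1.
  rewrite /R1 -addrA ltrD2l /E ltr_wpDr// -!addrA ltrDl.
  by rewrite !addr_gt0// mulr_gt0// addr_gt0.
have near_meets t x : `|t.2| <= B -> supp t x -> `|x| < R1.
  move=> tB tx; rewrite -[x](subrK t.2) (le_lt_trans (ler_normD _ _))// addrC.
  by rewrite (le_lt_trans _ DR1)// lerD// DP.
have suppne t : exists x, supp t x.
  by have [x [/interior_subset]] := overlap_refl Phi t; exists x.
have /choice[anc ancP] t : exists s, t \in S -> S' s /\ iter N phi [set s] t.
  have [tS|] := boolP (t \in S); last by exists t.
  have [Tt _ tB] := SP _ tS; have [x tx] := suppne t.
  have : SS t by apply/(meetsT t x tx) => //; exact: near_meets tx.
  by rewrite SSE => /iter_substE[s S's st]; exists s.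
pose core := undup [seq anc t | t <- S].
have coreP s : s \in core -> S' s /\ exists2 t, t \in S & iter N phi [set s] t.
  rewrite mem_undup => /mapP[t tS ->]; have [? ?] := ancP _ tS; split => //.
  by exists t.
have supp_desc s t x y : iter N phi [set s] t -> supp t x -> supp s y ->
    `|x - y *m L ^+ N| <= cN * (D + D).
  move=> st tx sy; rewrite -[x](mulLXK Phi N) -mulmxBl (le_trans (cNP _))//.
  rewrite ler_wpM2l ?(ltW cN0)//.
  have sx : supp s (x *m L ^- N).
    rewrite -patch_supp1; apply/(@iter_subst_supp _ _ _ Phi N); rewrite mulLXK.
    by exists t.
  have -> : x *m L ^- N - y = (x *m L ^- N - s.2) - (y - s.2).
    by apply/rowP => j; rewrite !mxE; ring.
  by rewrite (le_trans (ler_normB _ _))// lerD ?DP.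
(* All tiles of [S'] lie in one supertile, so the overlaps with its translate by [- u] are base
   pairs. *)
have ctx s : s \in core -> covered_context Phi u s (translate (- u) S').
  move=> /coreP[S's [t tS st]]; have [Tt _ tB] := SP _ tS; split.
    move=> y sy; apply/patch_supp_translate; rewrite opprK.
    apply: (@iter_subst_supp _ _ _ Phi N S' (y + u)).1; rewrite -SSE.
    have [x tx] := suppne t.
    have yR1 : `|(y + u) *m L ^+ N| < R1.
      have := supp_desc _ _ _ _ st tx sy => xy.
      have xB : `|x| <= B + D.
        by rewrite -[x](subrK t.2) (le_trans (ler_normD _ _))// addrC lerD// DP.
      rewrite mulmxDl (le_lt_trans (ler_normD _ _))// /R1 ltrD2r.
      rewrite -[y *m _](subKr x) (le_lt_trans (ler_normB _ _))//.
      apply: (@le_lt_trans _ _ (B + D + cN * (D + D))); first exact: lerD.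
      rewrite -addrA ltrD2l /E -addrA -[X in _ < X]addrA ltrD2l.
      by rewrite ltr_wpDl ?(ltW D0)// ltrDl.
    have [s' Ts' s'y] : patch_supp C T ((y + u) *m L ^+ N) by rewrite sT.
    by exists s' => //; apply/(meetsT _ _ s'y).
  move=> t' /translateP; rewrite opprK => S't' ov; apply: Descendant0 => //.
  exists (k - N)%N, i, (s.2 - w *m L ^- k *m L ^+ (k - N)).
  move: S's S't'; rewrite /S' iter_subst1 => /translateP S's /translateP S't'.
  split => //; move: S't'; congr (supertile _ _ _ (_, _)) => /=.
  by apply/rowP => j; rewrite !mxE; set a := (\sum_j _); ring.
have usz : (size S <= \sum_(s <- core) bad_count Phi N s (translate (- u) S'))%N.
  rewrite /bad_count.
  rewrite (_ : (\sum_(s <- core) _)%N = size (flatten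
     [seq [seq t <- descendants Phi N s | ~~ `[< iter N phi (translate (- u) S') t >]] | s <- core])); last first.
    rewrite size_flatten /shape -map_comp sumnE big_map; apply: eq_bigr => s _ /=.
    by rewrite size_filter.
  apply: uniq_leq_size => // t tS; have [Tt nTt tB] := SP _ tS.
  have [S's st] := ancP _ tS.
  apply/flatten_mapP; exists (anc t); first by rewrite mem_undup map_f.
  rewrite mem_filter; apply/andP; split; last exact/mem_descendants.
  apply/asboolP; rewrite iter_subst_translate -SSE => /translateP.
  rewrite mulNmx opprK => SSt; apply: nTt.
  have [x tx] := suppne t.
  apply/(@meetsT _ (x + v)) => //; first by apply/supp_shift; rewrite addrK.
  have xB : `|x| <= B + D.
    by rewrite -[x](subrK t.2) (le_trans (ler_normD _ _))// addrC lerD// DP.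
  rewrite (le_lt_trans (ler_normD _ _))// /R1 ltrD2r (le_lt_trans xB)// ltrD2l /E.
  by rewrite -!addrA ltrDl addr_gt0// addr_gt0// mulr_gt0// addr_gt0.
have uflat : uniq (flatten [seq descendants Phi N s | s <- core]).
  apply: descendants_flatten_uniq pS' (undup_uniq _) _.
  by move=> s /coreP[].
apply: (@le_trans _ _ (\sum_(s <- core) beta N * (weight Phi N s)%:R)).
  apply: (@le_trans _ _ (\sum_(s <- core) bad_count Phi N s (translate (- u) S'))%:R).
    by rewrite ler_nat.
  rewrite natr_sum big_seq [leRHS]big_seq; apply: ler_sum => s sc.
  exact/betaP/ctx.
rewrite -mulr_sumr -natr_sum.
have -> : (\sum_(s <- core) weight Phi N s)%N = size (flatten [seq descendants Phi N s | s <- core]).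
  by rewrite size_flatten /shape -map_comp sumnE big_map.
have flatP t : t \in flatten [seq descendants Phi N s | s <- core] -> SS t /\ `|t.2| <= B + E.
  move=> /flatten_mapP[s /coreP[S's [t' t'S st']] /mem_descendants st]; split.
    by rewrite SSE; apply/iter_substE; exists s.
  have [x tx] := suppne t; have [x' tx'] := suppne t'.
  have [_ _ t'B] := SP _ t'S.
  have [y sy] : exists y, supp s y by exact: suppne.
  have h1 := supp_desc _ _ _ (x' *m L ^- N) st tx.
  have {}h1 : `|x - x'| <= cN * (D + D).
    rewrite -[x' in X in X <= _](mulLXK Phi N); apply: h1.
    rewrite -patch_supp1; apply/(@iter_subst_supp _ _ _ Phi N); rewrite mulLXK.
    by exists t'.
  have -> : t.2 = t'.2 - (x - t.2) + (x - x') + (x' - t'.2).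
    by apply/rowP => j; rewrite !mxE; ring.
  rewrite (le_trans (ler_normD _ _))//.
  apply: (@le_trans _ _ (B + D + cN * (D + D) + D)); last first.
    rewrite /E; lra.
  apply: lerD; last exact: DP.
  rewrite (le_trans (ler_normD _ _))// lerD//.
  by rewrite (le_trans (ler_normB _ _))// lerD// DP.
have BE1 : 1 <= B + E by rewrite (le_trans B1)// lerDl ltW.
have := cP (B + E) SS _ BE1 (@supertile_patch _ _ _ Phi k w i) uflat flatP => cB.
have {}cB : (size (flatten [seq descendants Phi N s | s <- core]))%:R <= c * 2 ^+ n.+1 * B ^+ n.+1.
  apply: (le_trans cB); rewrite -mulrA ler_wpM2l ?(ltW c0)// -exprMn.
  rewrite lerXn2r ?nnegrE//; first by rewrite (le_trans _ BE1).
    by rewrite mulr_ge0// (le_trans _ B1).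
  rewrite mulr_natl mulr2n lerD2l (le_trans _ EB)// lerDl//.
have := ler_wpM2l (beta0 N) cB.
by congr (_ <= _); ring.
Qed.

(** Every disagreement at a grid point lies within [rho] of a bad tile, and each tile serves a
    bounded number of grid points. *)
Lemma discrepancy_bound u (beta : nat -> R) r : primitive Phi ->
  (forall N, 0 <= beta N) -> 0 < r ->
  (forall N t P, covered_context Phi u t P ->
    (bad_count Phi N t P)%:R <= beta N * (weight Phi N t)%:R) ->
  exists2 c : R, 0 < c & forall N, discrepancy_le r (u *m L ^+ N) (c * beta N).
Proof.
move=> prim beta0 r0 betaP.
have [c c0 cP] := bad_tiles_bound prim beta0 betaP.
have [D D0 DP] := diam_exists Phi.
pose rho := r + D + (D + D).
have rho0 : 0 < rho by rewrite addr_gt0// addr_gt0.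
pose m := (Num.truncn rho).+1.
have rm : rho <= m%:R by apply/ltW/truncnS_gt.
exists (c * (2 ^+ n.+1) * (m + m).+1%:R ^+ n.+1).
  by rewrite mulr_gt0 ?exprn_gt0 ?ltr0n// mulr_gt0// exprn_gt0.
move=> N; have [B0 B0P] := cP N.
pose H0 := (maxn (Num.truncn `|B0|).+1 m).
exists H0 => H T; rewrite geq_max => /andP[HB0 Hm] TT; have [[pT sT] _] := TT.
pose B : R := H%:R + rho.
have [S0 S0E] := (finite_seqP _).1 (@local_finite _ _ _ Phi T B pT).
pose S := [seq t <- undup S0 | ~~ `[< T (t.1, t.2 + u *m L ^+ N) >]].
have SP t : t \in S -> [/\ T t, ~ T (t.1, t.2 + u *m L ^+ N) & `|t.2| <= B].
  rewrite mem_filter mem_undup => /andP[/asboolP nT tS0].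
  have : [set t | T t /\ `|t.2| <= B] t by rewrite S0E.
  by move=> [].
have gridH (f : {ffun 'I_n.+1 -> 'I_H}) : `|grid_pt f| <= H%:R.
  apply: norm_le_coord => // i; rewrite mxE ger0_norm// ler_nat.
  exact/ltnW/ltn_ord.
have card_le : (#|disagreements r (u *m L ^+ N) T H| <= size S * (m + m).+1 ^ n.+1)%N.
  apply: (disagreements_card rm) => f; rewrite inE => /asboolP/(disagreement_tile DP TT).
  move=> [t [Tt nTt tf]]; exists t => //.
  rewrite mem_filter mem_undup; apply/andP; split; first exact/asboolP.
  suff : [set t | T t /\ `|t.2| <= B] t by rewrite S0E.
  split => //; rewrite -[t.2](subrK (grid_pt f)) (le_trans (ler_normD _ _))// addrC.
  by rewrite lerD.
have B0B : B0 <= B.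
  rewrite (le_trans (ler_norm _))// (@le_trans _ _ H%:R)//; last by rewrite lerDl ltW.
  by rewrite (@le_trans _ _ (Num.truncn `|B0|).+1%:R) ?ler_nat//; exact/ltW/truncnS_gt.
have := B0P B T S B0B TT (filter_uniq _ (undup_uniq _)) SP => sz.
have {}card_le : (#|disagreements r (u *m L ^+ N) T H|)%:R <=
    (size S)%:R * (m + m).+1%:R ^+ n.+1 :> R.
  by rewrite -natrX -natrM ler_nat.
apply: (le_trans card_le).
apply: (@le_trans _ _ (c * beta N * B ^+ n.+1 * (m + m).+1%:R ^+ n.+1)).
  by rewrite ler_wpM2r// exprn_ge0.
have BH : B ^+ n.+1 <= 2 ^+ n.+1 * H%:R ^+ n.+1.
  rewrite -exprMn lerXn2r ?nnegrE ?mulr_ge0//; first by rewrite addr_ge0// ltW.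
  by rewrite mulr_natl mulr2n lerD2l (le_trans rm)// ler_nat.
have cb : 0 <= c * beta N * (m + m).+1%:R ^+ n.+1.
  by rewrite !mulr_ge0// ?(ltW c0)// exprn_ge0.
have := ler_wpM2l cb BH.
set x := _%:R ^+ _; set y := B ^+ _; set h := H%:R ^+ _; set p := 2 ^+ _.
by congr (_ <= _); ring.
Qed.

End Discrepancy.

(** * Integer expansions of vectors *)

Section ExpansionPowers.
Variables (R : realType) (n : nat) (L : 'M[R]_n.+1).
Local Notation K := R[i].
Local Notation toC := (real_complex R).

Lemma exists_pow_lt (a r e : R) : 0 <= a -> 1 < r -> 0 < e ->
  exists N0, forall N, (N0 <= N)%N -> a / r ^+ N < e.
Proof.
move=> a0 r1 e0; have r0 : 0 < r by rewrite (lt_trans ltr01).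
exists (Num.truncn (a / (e * (r - 1)))).+1 => N N0N.
rewrite ltr_pdivrMr ?exprn_gt0//.
have bern (k : nat) : 1 + k%:R * (r - 1) <= r ^+ k.
  elim: k => [|k IH]; first by rewrite expr0 mul0r addr0.
  rewrite exprS (@le_trans _ _ (r * (1 + k%:R * (r - 1))))//; last by rewrite ler_wpM2l ?(ltW r0).
  rewrite -natr1 -subr_ge0.
  have -> : r * (1 + k%:R * (r - 1)) - (1 + (k%:R + 1) * (r - 1)) = k%:R * (r - 1) ^+ 2 by ring.
  by rewrite mulr_ge0// sqr_ge0.
apply: (@lt_le_trans _ _ (e * (1 + N%:R * (r - 1)))); last by rewrite ler_wpM2l ?(ltW e0).
have er : 0 < e * (r - 1) by rewrite mulr_gt0// subr_gt0.
have h : a / (e * (r - 1)) < N%:R.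
  by rewrite (lt_le_trans (truncnS_gt _))// ler_nat.
rewrite ltr_pdivrMr// in h; rewrite mulrDr mulr1 mulrCA.
by rewrite ltr_wpDl// ltW.
Qed.

(** In a basis of complex eigenvectors the coordinates of [v *m L ^- N] are those of [v] divided by
    [N]-th powers of numbers of modulus above 1. *)
Lemma pow_inv_contracts : L \in unitmx -> diagonalizable (map_mx toC L) ->
  (forall z : K, eigenvalue (map_mx toC L) z -> 1 < `|z|) ->
  forall (v : 'rV[R]_n.+1) e, 0 < e -> exists N, `|v *m L ^- N| < e.
Proof.
move=> unitL [Q unitQ /(similar_diagLR unitQ)[D AE]] L1 v e e0.
rewrite conjumx ?unitmx_inv// invmxK in AE; set A := map_mx _ _ in AE L1.
have QA : Q *m A = diag_mx D *m Q by rewrite AE !mulmxA mulmxV// mul1mx.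
have D1 i : 1 < `|D ord0 i|.
  apply: L1; apply/eigenvalueP; exists (row i Q).
    by rewrite -row_mul QA; apply/rowP => j; rewrite mxE mul_diag_mx !mxE.
  apply/negP => /eqP Q0; have := mulmxV unitQ => /(congr1 (row i)).
  rewrite row_mul Q0 mul0mx => /rowP/(_ i); rewrite !mxE eqxx => /esym/eqP.
  by rewrite oner_eq0.
have QAX N : Q *m A ^+ N = diag_mx D ^+ N *m Q.
  elim: N => [|N IH]; first by rewrite !expr0 mulmx1 mul1mx.
  by rewrite exprSr -[_ * A]/(_ *m A) mulmxA IH -mulmxA QA mulmxA exprSr.
have DX N : diag_mx D ^+ N = diag_mx (\row_i D ord0 i ^+ N).
  elim: N => [|N IH].
    rewrite expr0; apply/matrixP => i j; rewrite !mxE expr0.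
    by case: eqP.
  rewrite exprS IH -[_ * _]/(_ *m _) mulmx_diag; congr diag_mx; apply/rowP => i.
  by rewrite !mxE exprS.
pose y N := map_mx toC (v *m L ^- N) *m invmx Q.
have yE N i : y N ord0 i * D ord0 i ^+ N = y 0%N ord0 i.
  have : y N *m diag_mx D ^+ N = y 0%N.
    rewrite /y expr0 invr1 mulmx1 -mulmxA.
    have -> : invmx Q *m diag_mx D ^+ N = A ^+ N *m invmx Q.
      apply: (can_inj (mulmxK unitQ)); rewrite -mulmxA -QAX !mulmxA mulVmx// mul1mx.
      by rewrite -mulmxA mulVmx// mulmx1.
    rewrite mulmxA -rmorphXn/= -map_mxM; congr (map_mx _ _ *m _).
    by rewrite -mulmxA mulVmx ?mulmx1//; exact: (unitrX N unitL).
  by rewrite DX => /rowP/(_ i); rewrite mul_mx_diag !mxE.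
pose r i := complex.Re `|D ord0 i|.
have rE i : `|D ord0 i| = (r i)%:C%C by rewrite /r normc_def.
have r1 i : 1 < r i by rewrite -ltcR -rE; exact: D1.
pose a i j := complex.Re `|y 0%N ord0 i * Q i j|.
have aE i j : `|y 0%N ord0 i * Q i j| = (a i j)%:C%C by rewrite /a normc_def.
have a0 i j : 0 <= a i j by rewrite -lecR -aE normr_ge0.
have en : 0 < e / n.+1%:R by rewrite divr_gt0.
have /choice[N0 N0P] (p : 'I_n.+1 * 'I_n.+1) :=
  exists_pow_lt (a0 p.1 p.2) (r1 p.1) en.
exists (\sum_p N0 p)%N; set N := (\sum_p N0 p)%N.
have entry j : `|(v *m L ^- N) ord0 j| < e.
  have : `|(v *m L ^- N) ord0 j| <= \sum_i a i j / r i ^+ N.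
    have E : ((v *m L ^- N) ord0 j)%:C%C = \sum_i y N ord0 i * Q i j.
      have : y N *m Q = map_mx toC (v *m L ^- N) by rewrite /y mulmxKV.
      by move=> /rowP/(_ j); rewrite !mxE.
    rewrite -lecR.
    have -> : (`|(v *m L ^- N) ord0 j|)%:C%C = `|((v *m L ^- N) ord0 j)%:C%C|.
      by rewrite normc_def/= expr0n addr0 sqrtr_sqr.
    rewrite E (le_trans (ler_norm_sum _ _ _))// rmorph_sum/=; apply: ler_sum => i _.
    have D0 : D ord0 i != 0 by rewrite -normr_gt0 (lt_trans ltr01).
    have -> : y N ord0 i = y 0%N ord0 i / D ord0 i ^+ N.
      by rewrite -(yE N i) mulfK// expf_neq0.
    by rewrite mulrAC normrM normfV normrX aE rE rmorphM/= fmorphV/= rmorphXn/=.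
  move=> /le_lt_trans; apply.
  apply: (@lt_le_trans _ _ (\sum_(i < n.+1) e / n.+1%:R)).
    apply: ltr_sum => [|i _]; first by apply/hasP; exists ord0; rewrite ?mem_index_enum.
    by apply: N0P (i, j) _ _; rewrite /N (bigD1 (i, j))//= leq_addr.
  by rewrite sumr_const card_ord -[X in X <= _]mulr_natr divfK.
have [x0|/mx_norm_neq0[[i j] /= h]] := eqVneq `|v *m L ^- N| 0; first by rewrite x0.
have -> : `|v *m L ^- N| = `|(v *m L ^- N) i j| := h.
by rewrite (ord1 i).
Qed.

End ExpansionPowers.

(** * Rounding in the dual basis of the powers of the expansion *)

Section LatticeRounding.
Variables (R : realType) (n : nat) (L U : 'M[R]_n.+1) (P : {poly int}) (b a : {poly R}).
Local Notation V := 'rV[R]_n.+1.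
Local Notation PR := (map_poly (intr : int -> R) P).
Local Notation d := (size P).-1.
Hypotheses (Pm : P \is monic) (PL : horner_mx L PR = 0) (unitU : U \in unitmx).
Hypothesis bezout : a * PR + b * PR^`() = 1.
Implicit Types (v : V) (k : nat) (i : 'I_n.+1).

(** Euler's dual basis, with [G k.+1] dual to the power [k]: [drop_poly k PR] is the quotient of
    [PR] by ['X^k], and by the Bezout identity the value of [b] at [L] inverts that of the
    derivative of [PR]. *)
Let G k : 'M[R]_n.+1 := horner_mx L (b * drop_poly k PR).

Definition coordinate k i v : R := (v *m G k *m invmx U) ord0 i.

Let sizePR : size PR = size P.
Proof. by rewrite size_map_poly_id0// (eqP Pm) oner_neq0. Qed.

Let dE : size P = d.+1.
Proof. by rewrite prednK// size_poly_gt0 monic_neq0. Qed.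

Lemma coordinate0 i v : coordinate 0 i v = 0.
Proof.
rewrite /coordinate /G drop_poly0l rmorphM/= PL mulr0 mulmx0 mul0mx mxE //.
Qed.

(** The expansion acts on the coordinates as a companion matrix, because the quotient by ['X^k] is
    ['X] times the next quotient plus the coefficient of index [k]. *)
Lemma coordinate_expansion k i v : (k < d)%N ->
  coordinate k.+1 i (v *m L) = coordinate k i v - (P`_k)%:~R * coordinate d i v.
Proof.
move=> kd; rewrite /coordinate.
have dropd : drop_poly d PR = 1.
  apply/polyP => j; rewrite coef_drop_poly coef1; case: j => [|j].
    rewrite add0n coef_map/=; move/monicP: Pm; rewrite /lead_coef => ->.
    by rewrite rmorph1.
  by rewrite nth_default// sizePR dE addSn ltnS leq_addl.
have dropk : drop_poly k PR = drop_poly k.+1 PR * 'X + ((P`_k)%:~R)%:P.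
  apply/polyP => j; rewrite coefD coefMX coefC !coef_drop_poly.
  by case: j => [|j] /=; rewrite ?add0r ?addr0 ?coef_map//= addSnnS.
have GE : L *m G k.+1 = G k - (P`_k)%:~R *: G d.
  have dropb : b * drop_poly k PR = 'X * (b * drop_poly k.+1 PR) + ((P`_k)%:~R)%:P * b.
    by rewrite dropk; ring.
  suff -> : G k = L *m G k.+1 + (P`_k)%:~R *: G d by rewrite addrK.
  rewrite /G dropd mulr1 dropb rmorphD; congr (_ + _).
    by rewrite rmorphM/= horner_mx_X.
  by rewrite mul_polyC; exact: horner_mxZ.
by rewrite -(mulmxA v L) GE mulmxBr mulmxBl -scalemxAr -scalemxAl !mxE.
Qed.

(** The derivative of [PR] is the sum of the [drop_poly k.+1 PR * 'X^k], so the matrices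
    [G k.+1 *m L ^+ k] add up to the value at [L] of [b] times this derivative, which is 1. *)
Lemma coordinate_sum v :
  v = \sum_(k < d) \sum_i coordinate k.+1 i v *: (row i U *m L ^+ k).
Proof.
have rowsum (y : V) : \sum_i (y *m invmx U) ord0 i *: row i U = y.
  by rewrite -mulmx_sum_row mulmxKV.
have -> : \sum_(k < d) \sum_i coordinate k.+1 i v *: (row i U *m L ^+ k) =
    \sum_(k < d) v *m (G k.+1 *m L ^+ k).
  apply: eq_bigr => k _; rewrite mulmxA -[in RHS](rowsum (v *m G k.+1)) mulmx_suml.
  by apply: eq_bigr => i _; rewrite scalemxAl.
rewrite -mulmx_sumr.
suff -> : \sum_(k < d) G k.+1 *m L ^+ k = 1%:M by rewrite mulmx1.
have -> : \sum_(k < d) G k.+1 *m L ^+ k = horner_mx L (b * PR^`()).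
  (* The coefficient of index [j.+1] of [PR] is contributed once by each [k <= j], as in the
     derivative. *)
  have -> : PR^`() = \sum_(k < d) drop_poly k.+1 PR * 'X^k.
    apply/polyP => j; rewrite coef_deriv coef_sum.
    under eq_bigr do rewrite coefMXn coef_drop_poly.
    have [jd|dj] := ltnP j d; last first.
      rewrite nth_default ?mul0rn; last by rewrite sizePR dE ltnS.
      rewrite big1// => k _; case: ifP => // _.
      rewrite nth_default// sizePR; have := ltn_ord k; lia.
    rewrite (bigID (fun k : 'I_d => (k <= j)%N))/= [X in _ + X]big1 ?addr0; last first.
      by move=> k; rewrite -ltnNge => ->.
    rewrite (eq_bigr (fun=> PR`_j.+1)); last first.
      by move=> k kj; rewrite ltnNge kj /=; congr (_`_ _); lia.
    rewrite sumr_const; congr (_ *+ _).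
    rewrite -[LHS](card_ord j.+1).
    rewrite -(card_imset (f := widen_ord jd)); last first.
      by move=> x y /(congr1 val)/= xy; apply: val_inj.
    apply: eq_card => k; rewrite unfold_in; apply/imsetP/idP => [[k' _ ->]|kj] /=.
      by have := ltn_ord k'; rewrite ltnS.
    by exists (Ordinal (kj : (k < j.+1)%N)) => //; apply: val_inj.
  rewrite mulr_sumr rmorph_sum/=; apply: eq_bigr => k _.
  by rewrite mulrA rmorphM/= rmorphXn/= horner_mx_X.
have := congr1 (horner_mx L) bezout.
by rewrite rmorphD/= rmorphM/= PL mulr0 add0r rmorph1.
Qed.

Lemma coordinate_bounded : exists2 c : R, 0 < c &
  forall k i v, (k <= d)%N -> `|coordinate k i v| <= c * `|v|.
Proof.
have /choice[c cP] (k : 'I_d.+1) : exists c : R, 0 < c /\ forall v, `|v *m (G k *m invmx U)| <= c * `|v|.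
  by have [c c0 cP] := mulmx_bound (G k *m invmx U); exists c.
exists (1 + \sum_k c k).
  by rewrite ltr_pwDl// sumr_ge0// => k _; exact/ltW/(cP k).1.
move=> k i v kd; pose k' := Ordinal (kd : (k < d.+1)%N).
rewrite (le_trans (coord_le_norm _ _))// -mulmxA (le_trans ((cP k').2 v))//.
rewrite ler_wpM2r// (bigD1 k')//= addrCA lerDl addr_ge0// sumr_ge0// => j _.
exact/ltW/(cP j).1.
Qed.

Definition round (x : R) : int := Num.floor (x + 2^-1).

Lemma round_dist x : `|(round x)%:~R - x| <= 2^-1.
Proof.
have /andP[] := floor_itv (x + 2^-1); rewrite -/(round x) intrD mulr1z.
set r := _%:~R => h1 h2; rewrite ler_norml; apply/andP; split; lra.
Qed.

Lemma round0 : round 0 = 0.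
Proof.
rewrite /round add0r; apply: floor_def; rewrite add0r.
by rewrite invr_ge0 ler0n/= invf_lt1 ?ltr1n.
Qed.

Definition lattice_point (z : 'I_d -> 'I_n.+1 -> int) : V :=
  \sum_(k < d) \sum_i (row i U *m L ^+ k) *~ z k i.

Definition rounded v : V := lattice_point (fun (k : 'I_d) i => round (coordinate k.+1 i v)).

Lemma rounded_dist : exists2 c : R, 0 < c & forall v (dl : R), 0 <= dl ->
  (forall (k : 'I_d) i, `|(round (coordinate k.+1 i v))%:~R - coordinate k.+1 i v| <= dl) ->
  `|v - rounded v| <= c * dl.
Proof.
exists (1 + \sum_(k < d) \sum_i `|row i U *m L ^+ k|).
  by rewrite ltr_pwDl// sumr_ge0// => k _; rewrite sumr_ge0.
move=> v dl dl0 h; rewrite {1}(coordinate_sum v) /rounded /lattice_point -sumrB.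
rewrite mulrDl mul1r mulr_suml (@le_trans _ _ (\sum_(k < d) (\sum_i `|row i U *m L ^+ k|) * dl))//; last first.
  by rewrite lerDr.
rewrite (le_trans (ler_norm_sum _ _ _))//; apply: ler_sum => k _.
rewrite -sumrB mulr_suml (le_trans (ler_norm_sum _ _ _))//; apply: ler_sum => i _.
by rewrite -scaler_int -scalerBl normrZ mulrC ler_wpM2l// distrC.
Qed.

(** The exact coordinates obey an integral linear recurrence, so the defect of the rounded ones is
    an integer combination of three rounding errors, each at most a half. Hence the digits are
    bounded independently of [v]. *)
Lemma rounded_expansion : exists m : nat, forall v, exists z : 'I_d -> 'I_n.+1 -> int,
  (forall (k : 'I_d) i, `|z k i| <= m%:Z) /\ rounded (v *m L) = rounded v *m L + lattice_point z.
Proof.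
pose S := (\sum_(k < d) absz (P`_k)%R)%N.
exists (1 + S)%N => v.
pose r k i v := round (coordinate k i v).
pose z (k : 'I_d) i := r k.+1 i (v *m L) - r k i v + P`_k * r d i v.
exists z; split => [k i|].
  rewrite -(ler_int R) intr_norm /z rmorphD rmorphB rmorphM/=.
  pose xi k i v : R := (r k i v)%:~R - coordinate k i v.
  have xiP k' i' v' : `|xi k' i' v'| <= 2^-1 by exact: round_dist.
  have -> : (r k.+1 i (v *m L))%:~R - (r k i v)%:~R + (P`_k)%:~R * (r d i v)%:~R =
      xi k.+1 i (v *m L) - xi k i v + (P`_k)%:~R * xi d i v.
    rewrite /xi coordinate_expansion//; ring.
  have Pk : `|(P`_k)%:~R : R| <= S%:R.
    by rewrite -intr_norm -abszE -pmulrn ler_nat /S (bigD1 k)//= leq_addr.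
  rewrite -[X in _ <= X]pmulrn natrD.
  have e1 : 1 = 2^-1 + 2^-1 :> R by field.
  rewrite (le_trans (ler_normD _ _))// lerD//.
    by rewrite (le_trans (ler_normB _ _))// e1 lerD.
  rewrite normrM (@le_trans _ _ (`|(P`_k)%:~R| * 1))//; last by rewrite mulr1.
  rewrite ler_wpM2l// (le_trans (xiP _ _ _))//.
  by rewrite {2}e1 lerDl invr_ge0.
have PLsum (x : V) : x *m L ^+ d = - \sum_(k < d) (x *m L ^+ k) *~ P`_k.
  have := congr1 (fun A => x *m A) PL; rewrite mulmx0 horner_mx_sum sizePR.
  have bigS (m : nat) (F : nat -> V) : size P = m.+1 ->
      \sum_(i < size P) F i = \sum_(i < m) F i + F m.
    by move=> ->; rewrite big_ord_recr.
  rewrite mulmx_sumr (bigS _ (fun j : nat => x *m (PR`_j *: L ^+ j)) dE) addrC => /eqP.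
  rewrite addr_eq0 coef_map/=.
  have -> : P`_d = 1 by move/monicP: Pm.
  rewrite rmorph1 scale1r => /eqP ->; congr (- _); apply: eq_bigr => k _.
  by rewrite coef_map/= -scalemxAr scaler_int.
have h : rounded v *m L = \sum_(k < d) \sum_i (row i U *m L ^+ k) *~ (r k i v - P`_k * r d i v).
  rewrite /rounded /lattice_point mulmx_suml.
  under eq_bigr do rewrite mulmx_suml.
  rewrite (eq_bigr (fun k : 'I_d => \sum_i (row i U *m L ^+ k.+1) *~ r k.+1 i v)); last first.
    move=> k _; apply: eq_bigr => i _.
    set z1 := round _; rewrite -(scaler_int z1) -scalemxAl -mulmxA.
    by rewrite -[L ^+ k *m L]/(L ^+ k * L) -exprSr scaler_int.
  (* Shifting the index by one leaves two boundary terms: that of index 0 vanishes, and that of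
     index [d] is reduced by [PLsum]. *)
  transitivity (\sum_i \sum_(k < d) ((row i U *m L ^+ k) *~ r k i v - (row i U *m L ^+ k) *~ (P`_k * r d i v))).
    rewrite exchange_big; apply: eq_bigr => i _.
    have tele (F : nat -> V) : \sum_(k < d) F k.+1 = \sum_(k < d) F k + F d - F 0%N.
      by rewrite -(big_ord_recr d F)/= big_ord_recl addrAC subrr add0r; apply: eq_bigr.
    rewrite (tele (fun k => (row i U *m L ^+ k) *~ r k i v)) sumrB.
    rewrite /r coordinate0 round0 mulr0z subr0; congr (_ + _).
    rewrite PLsum mulNrz; congr (- _); rewrite mulrz_suml; apply: eq_bigr => k _.
    by rewrite mulrzA.
  rewrite exchange_big; apply: eq_bigr => k _; apply: eq_bigr => i _.
  by rewrite mulrzBr.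
rewrite h /rounded /lattice_point -big_split/=; apply: eq_bigr => k _.
rewrite -big_split/=; apply: eq_bigr => i _; rewrite -mulrzDr /z -/(r k.+1 i (v *m L)).
by congr (_ *~ _); ring.
Qed.

End LatticeRounding.

(** * Discrepancy of rounded vectors *)

Section RoundedDiscrepancy.
Variables (R : realType) (n l : nat) (Phi : substitution R n.+1 l).
Local Notation V := 'rV[R]_n.+1.
Local Notation L := (expansion Phi).
Variables (U : 'M[R]_n.+1) (P : {poly int}) (b a : {poly R}).
Local Notation PR := (map_poly (intr : int -> R) P).
Local Notation d := (size P).-1.
Hypotheses (Pm : P \is monic) (PL : horner_mx L PR = 0) (unitU : U \in unitmx).
Hypothesis bezout : a * PR + b * PR^`() = 1.
Hypothesis diagonalizable_L : diagonalizable (map_mx (real_complex R) L).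
Implicit Types v : V.
Local Notation rounded := (rounded L U P b).

Lemma rounded_small : exists2 e : R, 0 < e & forall v, `|v| < e -> rounded v = 0.
Proof.
have [c c0 cP] := coordinate_bounded L U P b.
exists (2^-1 / c) => [|v ve]; first by rewrite divr_gt0// invr_gt0.
rewrite /rounded /lattice_point big1// => k _; rewrite big1// => i _.
suff -> : round (coordinate L U P b k.+1 i v) = 0 by rewrite mulr0z.
have := cP k.+1 i v (ltn_ord k) => /le_lt_trans xc.
have {xc} : `|coordinate L U P b k.+1 i v| < 2^-1.
  by apply: xc; rewrite mulrC -ltr_pdivlMr.
rewrite ltr_norml => /andP[x1 x2]; apply: floor_def; rewrite add0r mulr0z mulr1z.
by apply/andP; split; lra.
Qed.

(** For large [k] the vector [v *m L ^- k] rounds to 0. Going back up adds one vector of bounded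
    digits per level, at a cost that decays geometrically with the level, so the total does not
    depend on [k]. *)
Lemma rounded_discrepancy (r K e : R) : 1 < K -> 0 < e ->
  (forall i : 'I_n.+1, exists2 c : R, 0 < c & forall N,
    discrepancy_le Phi r (row i U *m L ^+ N) (c * (K * (1 - K^-1) ^+ N))) ->
  exists N, forall v, discrepancy_le Phi r (rounded v *m L ^+ N) e.
Proof.
move=> K1 e0 hU.
have K0 : 0 < K by rewrite (lt_trans ltr01).
pose rho := 1 - K^-1; pose beta N := K * rho ^+ N.
have rho0 : 0 < rho by rewrite subr_gt0 invf_lt1.
have rho1 : rho < 1 by rewrite ltrBlDr ltrDl invr_gt0.
have beta0 N : 0 <= beta N by rewrite mulr_ge0 ?exprn_ge0// ltW.
have betaS N k : beta (k + N)%N <= beta N.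
  rewrite /beta ler_wpM2l ?(ltW K0)//; apply: ler_wiXn2l; [exact: ltW|exact: ltW|].
  exact: leq_addl.
have {}hU (i : 'I_n.+1) : exists c : R, 0 < c /\ forall N,
    discrepancy_le Phi r (row i U *m L ^+ N) (c * beta N).
  by have [c c0 cP] := hU i; exists c.
have [c cP] := choice hU.
have [m mP] := @rounded_expansion _ _ L U P b Pm PL.
pose c' := \sum_(k < d) \sum_i m%:R * c i.
have c'0 : 0 <= c'.
  by rewrite sumr_ge0// => k _; rewrite sumr_ge0// => i _; rewrite mulr_ge0// ltW// (cP i).1.
have digit z N : (forall (k : 'I_d) i, `|z k i| <= m%:Z) ->
    discrepancy_le Phi r (lattice_point L U z *m L ^+ N) (c' * beta N).
  move=> zm; rewrite /lattice_point mulmx_suml /c' mulr_suml.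
  apply: discrepancy_le_sum => k; rewrite mulmx_suml mulr_suml.
  apply: discrepancy_le_sum => i.
  rewrite -scaler_int -scalemxAl -mulmxA -[_ *m L ^+ N]/(_ * _) -exprD scaler_int.
  apply: discrepancy_le_mono (discrepancy_le_mulz (z k i) ((cP i).2 (k + N)%N)).
  rewrite -mulrA; apply: ler_pM.
  - by rewrite ler0z.
  - by apply: mulr_ge0; [exact/ltW/(cP i).1|exact: beta0].
  - by have := zm k i; rewrite -(ler_int R) -pmulrn.
  - by rewrite ler_wpM2l ?(ltW (cP i).1).
(* Since [1 - rho] is [K^-1], the geometric series of the [beta] from level [N] on has sum
   [K * beta N]. *)
have step v k N : rounded v = 0 ->
    discrepancy_le Phi r (rounded (v *m L ^+ k) *m L ^+ N) (c' * K * beta N).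
  move=> v0; elim: k N => [|k IH] N.
    rewrite expr0 mulmx1 v0 mul0mx; apply: discrepancy_le_mono (discrepancy_le0 _ _).
    by apply: mulr_ge0 => //; apply: mulr_ge0 => //; exact: ltW.
  rewrite exprSr -[L ^+ k * L]/(L ^+ k *m L) mulmxA; have [z [zm ->]] := mP (v *m L ^+ k).
  rewrite mulmxDl -mulmxA -[L *m L ^+ N]/(L * L ^+ N) -exprS.
  apply: discrepancy_le_mono (discrepancy_leD (IH N.+1) (digit z N zm)).
  rewrite /beta exprS le_eqVlt; apply/orP; left; apply/eqP.
  have -> : rho = 1 - K^-1 by [].
  by field; rewrite gt_eqF.
have [e1 e10 e1P] := rounded_small.
have [N0 N0P] : exists N0, forall N, (N0 <= N)%N -> (c' * K * K) / rho^-1 ^+ N < e.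
  apply: exists_pow_lt => //; first by apply: mulr_ge0; [apply: mulr_ge0 => //|]; exact: ltW.
  by rewrite invf_gt1.
exists N0 => v.
have [k vk] := pow_inv_contracts (expansion_unit Phi) diagonalizable_L (@expansion_gt1 _ _ _ Phi) v e10.
rewrite -[v](mulLXK Phi k).
apply: discrepancy_le_mono (step _ k N0 (e1P _ vk)).
by apply: ltW; have := N0P N0 (leqnn _); rewrite exprVn invrK /beta !mulrA.
Qed.

End RoundedDiscrepancy.

(** * Almost periods on Bohr sets *)

Section AlmostPeriods.
Variables (R : realType) (n l : nat) (Phi : substitution R n.+1 l).
Local Notation V := 'rV[R]_n.+1.
Local Notation L := (expansion Phi).

Definition bohr (bs : seq V) (dl : R) (v : V) : Prop :=
  forall b, b \in bs -> `|(round (dotv b v))%:~R - dotv b v| <= dl.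

(** The vectors of [cs] represent the linear forms given by [L ^- N] followed by a coordinate. If
    their values at [w] are nearly integers, then [w *m L ^- N] is near its rounding. The
    frequencies depend on [r] and [e] only; a smaller [eta] affects only [dl]. *)
Lemma almost_periods T0 Q (bs : n.+1.-tuple V) v :
  primitive Phi -> FLC Phi -> tiling_space Phi T0 ->
  (exists m d, pisot_family_type L m d) ->
  is_tiling (proto Phi) (periodic_extension bs Q) ->
  completely_rationally_independent bs v ->
  densely_eventually_coincident Phi
     (periodic_extension bs Q) (translate (- v) (periodic_extension bs Q)) ->
  forall r e : R, 0 < r -> 0 < e -> exists cs : seq V, forall eta : R, 0 < eta ->
    exists2 dl : R, 0 < dl & forall w, bohr cs dl w ->
      exists2 g, discrepancy_le Phi r g e & `|w - g| <= eta.
Proof.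
move=> prim flc TT0 [m [d pis]] tQ indep dec r e r0 e0.
have diagL := let: And5 h _ _ _ _ := pis in h.
have [P [Pm PL cop Proot]] := pisot_family_poly (@expansion_gt1 _ _ _ Phi) pis.
have [[a b] bez] := Bezout_eq1_coprimepP _ _ cop.
have [U unitU UP] := good_vectors_exist prim flc TT0 tQ indep dec.
have /choice[k0 k0P] i := coincidence_level prim flc TT0 Pm PL Proot (UP i).
have [|K K0 KP] := @finite_bound R 'I_n.+1 (fun i K => 1 < K /\ forall N t P',
    covered_context Phi (row i U) t P' ->
    (bad_count Phi N t P')%:R <= K * (1 - K^-1) ^+ N * (weight Phi N t)%:R).
  move=> i; have [||K K1 KP] := @bad_count_exponential _ _ _ Phi (row i U) (k0 i).+1 prim.
  - by move=> t t'; exact: (k0P i (k0 i).+1 t t' (leqnSn _)).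
  - by [].
  exists K; first by rewrite (lt_trans ltr01).
  by move=> K' KK'; split; [exact: lt_le_trans KK'|exact: KP].
have K1 : 1 < K := (KP ord0 K (lexx _)).1.
pose beta N := K * (1 - K^-1) ^+ N.
have beta0 N : 0 <= beta N.
  by rewrite mulr_ge0 ?exprn_ge0 ?(ltW K0)// subr_ge0 invf_le1 ?(ltW K1).
have [|N NP] := @rounded_discrepancy _ _ _ Phi U P b Pm PL diagL r K e K1 e0.
  by move=> i; exact: (discrepancy_bound prim beta0 r0 (KP i K (lexx _)).2).
pose M k : 'M[R]_n.+1 := L ^- N *m horner_mx L (b * drop_poly k.+1 (map_poly intr P)) *m invmx U.
have ME k i (w : V) : dotv (\row_j M k j i) w = coordinate L U P b k.+1 i (w *m L ^- N).
  rewrite /coordinate -2!mulmxA mxE /dotv; apply: eq_bigr => j _.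
  by rewrite mxE mulrC /M -mulmxA.
exists [seq \row_j M k j i | k <- iota 0 (size P).-1, i <- enum 'I_n.+1] => eta eta0.
have [c c0 cP] := rounded_dist Pm PL unitU bez.
have [cN cN0 cNP] := mulmx_bound (L ^+ N).
exists (eta / (cN * c)); first by rewrite divr_gt0// mulr_gt0.
move=> w bw; exists (rounded L U P b (w *m L ^- N) *m L ^+ N); first exact: NP.
rewrite -{1}[w](mulLXK Phi N) -mulmxBl (le_trans (cNP _))//.
rewrite mulrC -ler_pdivlMr// (le_trans (cP _ (eta / (cN * c)) _ _))//.
- by rewrite divr_ge0 ?mulr_ge0 ?ltW.
- move=> k i; rewrite -ME; apply: bw; apply/allpairsP; exists (nat_of_ord k, i).
  by rewrite mem_iota ltn_ord mem_enum.
- by rewrite invfM mulrCA [cN^-1 * _]mulrC mulVKf ?gt_eqF.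
Qed.

End AlmostPeriods.

(** * Bohr sets and spectral synthesis *)

Local Notation normc := ComplexField.Normc.normc.

Section Characters.
Variables (R : realType) (n : nat).
Local Notation V := 'rV[R]_n.+1.
Implicit Types (u v w b : V) (al be : seq (R * V)).

Lemma bohr_cat (bs cs : seq V) (dl dl' : R) v :
  bohr (bs ++ cs) (Num.min dl dl') v -> bohr bs dl v /\ bohr cs dl' v.
Proof.
move=> h; split=> b bin; (rewrite (le_trans (h b _)) ?mem_cat ?bin ?orbT//);
  by rewrite ge_min lexx ?orbT.
Qed.

Lemma dotvC u v : dotv u v = dotv v u.
Proof. by apply: eq_bigr => i _; rewrite mulrC. Qed.

Lemma dotvDr u v w : dotv u (v + w) = dotv u v + dotv u w.
Proof. by rewrite -big_split; apply: eq_bigr => i _; rewrite mxE mulrDr. Qed.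

Lemma dotvDl u v w : dotv (u + v) w = dotv u w + dotv v w.
Proof. by rewrite dotvC dotvDr !(dotvC w). Qed.

Lemma dotvNr u v : dotv u (- v) = - dotv u v.
Proof. by rewrite -sumrN; apply: eq_bigr => i _; rewrite mxE mulrN. Qed.

Lemma dotvNl u v : dotv (- u) v = - dotv u v.
Proof. by rewrite dotvC dotvNr dotvC. Qed.

Lemma dotv0r u : dotv u 0 = 0.
Proof. by rewrite -[in LHS](subrr 0) dotvDr dotvNr subrr. Qed.

Lemma dotv0l u : dotv 0 u = 0.
Proof. by rewrite dotvC dotv0r. Qed.

Lemma dotvMnl u v k : dotv (u *+ k) v = dotv u v *+ k.
Proof. by elim: k => [|k IH]; rewrite ?mulr0n ?dotv0l// !mulrS dotvDl IH. Qed.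

Lemma expi2piD (s t : R) : expi2pi (s + t) = expi2pi s * expi2pi t.
Proof.
by apply/eqP; rewrite eq_complex /= mulrDr cosD sinD addrC [_ + cos _ * sin _]addrC !eqxx.
Qed.

Lemma expi2pi0 : expi2pi (0 : R) = 1.
Proof. by rewrite /expi2pi mulr0 cos0 sin0. Qed.

Lemma expi2piMn (s : R) k : expi2pi (s *+ k) = expi2pi s ^+ k.
Proof. by elim: k => [|k IH]; rewrite ?mulr0n ?expi2pi0// mulrS expi2piD IH exprS. Qed.

Lemma expi2piN (s : R) : expi2pi (- s) = (expi2pi s)^*%C.
Proof. by rewrite /expi2pi mulrN cosN sinN. Qed.

Lemma normc_expi2pi (s : R) : normc (expi2pi s) = 1.
Proof. by rewrite /normc/= cos2Dsin2 sqrtr1. Qed.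

(** Finitely supported probability measures are lists of pairs of a mass and a point, with
    repetitions allowed; [charv] is the Fourier transform of such a measure. *)
Definition probv al := all (fun x => 0 <= x.1) al && (\sum_(x <- al) x.1 == 1).

Definition convv al be := [seq (x.1 * y.1, x.2 + y.2) | x <- al, y <- be].

Definition oppv al := [seq (x.1, - x.2) | x <- al].

Definition charv al b : R[i] := \sum_(x <- al) x.1%:C%C * expi2pi (dotv x.2 b).

Lemma probv_conv al be : probv al -> probv be -> probv (convv al be).
Proof.
move=> /andP[/allP a0 /eqP a1] /andP[/allP b0 /eqP b1]; apply/andP; split.
  by apply/allP => _ /allpairsP[[x y] [xa yb ->]]; exact: mulr_ge0 (a0 x xa) (b0 y yb).
rewrite big_allpairs_dep/= -a1; apply/eqP; apply: eq_bigr => x _.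
by rewrite -mulr_sumr b1 mulr1.
Qed.

Lemma probv_opp al : probv al -> probv (oppv al).
Proof.
move=> /andP[/allP a0 a1]; apply/andP; split; last by rewrite big_map.
by apply/allP => _ /mapP[x xa ->]; exact: a0 x xa.
Qed.

Lemma charv_conv al be b : charv (convv al be) b = charv al b * charv be b.
Proof.
rewrite /charv big_allpairs_dep mulr_suml; apply: eq_bigr => x _.
rewrite mulr_sumr; apply: eq_bigr => y _.
by rewrite /= dotvDl expi2piD rmorphM/= mulrACA.
Qed.

Lemma charv_opp al b : charv (oppv al) b = (charv al b)^*%C.
Proof.
rewrite /charv big_map rmorph_sum; apply: eq_bigr => x _.
by rewrite rmorphM/= dotvNl expi2piN oppr0.
Qed.

Lemma charv_sqr al b : charv (convv al (oppv al)) b = (normc (charv al b) ^+ 2)%:C%C.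
Proof.
rewrite charv_conv charv_opp; case: (charv al b) => x y.
rewrite /normc sqr_sqrtr ?addr_ge0 ?sqr_ge0//.
by apply/eqP; rewrite eq_complex /= mulrN opprK mulrN -!expr2 [y * x]mulrC addNr !eqxx.
Qed.

(** The exponential is symmetric in point and frequency, so the two measures can exchange roles. *)
Lemma sum_charvC al be :
  \sum_(x <- al) x.1%:C%C * charv be x.2 = \sum_(y <- be) y.1%:C%C * charv al y.2.
Proof.
rewrite /charv; under eq_bigr do rewrite mulr_sumr; rewrite exchange_big/=.
apply: eq_bigr => y _; rewrite mulr_sumr; apply: eq_bigr => x _.
by rewrite mulrCA dotvC.
Qed.

(** Cauchy-Schwarz, from the squared deviations of the masses from the uniform mass. *)
Lemma sum_sqr_probv al : probv al -> (size al)%:R^-1 <= \sum_(x <- al) x.1 ^+ 2.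
Proof.
move=> /andP[_ /eqP a1]; set N : R := (size al)%:R.
have N0 : N != 0.
  by rewrite pnatr_eq0 size_eq0; case: eqP a1 => // ->; rewrite big_nil => /esym/eqP; rewrite oner_eq0.
have : 0 <= \sum_(x <- al) (x.1 - N^-1) ^+ 2 by rewrite sumr_ge0// => x _; exact: sqr_ge0.
under eq_bigr do rewrite sqrrB -mulr_natl mulrA.
rewrite big_split sumrB /= -mulr_suml -mulr_sumr a1 mulr1.
rewrite big_const_seq iter_addr_0 count_predT -[X in _ + X]mulr_natl -/N expr2 mulVKf//; lra.
Qed.

(* By symmetry the left-hand average of |charv al|^2 is the average of |charv be|^2 over the differences
   of frequencies of al; only the zero differences are kept. *)
Lemma charv_sqr_mean al be : probv al -> probv be ->
  (size al)%:R^-1 <= \sum_(y <- convv be (oppv be)) y.1 * normc (charv al y.2) ^+ 2.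
Proof.
move=> pal pbe; rewrite (le_trans (sum_sqr_probv pal))//.
have al0 x : x \in al -> 0 <= x.1 by case/andP: pal => /allP h _ /h.
suff -> : \sum_(y <- convv be (oppv be)) y.1 * normc (charv al y.2) ^+ 2 =
    \sum_(x <- convv al (oppv al)) x.1 * normc (charv be x.2) ^+ 2.
  rewrite /oppv /convv allpairs_mapr big_allpairs_dep/=.
  rewrite big_seq [leRHS]big_seq; apply: ler_sum => x xal.
  rewrite (big_rem x xal)/= subrr.
  have -> : charv be 0 = 1.
    rewrite /charv; under eq_bigr do rewrite dotv0r expi2pi0 mulr1.
    by rewrite -rmorph_sum /=; case/andP: pbe => _ /eqP ->.
  rewrite Normc.normc1 expr1n mulr1 expr2 lerDl big_seq sumr_ge0// => y /mem_rem yal.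
  by rewrite mulr_ge0 ?sqr_ge0// mulr_ge0 ?al0.
apply: (@complexI R); rewrite !rmorph_sum/=.
have e ga de : \sum_(x <- convv ga (oppv ga)) (x.1 * normc (charv de x.2) ^+ 2)%:C%C =
    \sum_(x <- convv ga (oppv ga)) x.1%:C%C * charv (convv de (oppv de)) x.2.
  by apply: eq_bigr => x _; rewrite charv_sqr rmorphM.
by rewrite !e sum_charvC.
Qed.

Lemma normcX (z : R[i]) k : normc (z ^+ k) = normc z ^+ k.
Proof. by elim: k => [|k IH]; rewrite ?Normc.normc1// !exprS Normc.normcM IH. Qed.

(** The [k]-th convolution power of the measure with mass one half at 0 and at [b]. *)
Definition halfv k b : seq (R * V) := [seq ('C(k, i)%:R / 2 ^+ k, b *+ i) | i <- iota 0 k.+1].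

Lemma charv_half k b v : charv (halfv k b) v = ((1 + expi2pi (dotv b v)) / 2) ^+ k.
Proof.
rewrite /charv big_map -/(index_iota 0 k.+1) big_mkord expr_div_n [in RHS]exprDn mulr_suml.
apply: eq_bigr => i _; rewrite expr1n mul1r dotvMnl expi2piMn rmorphM fmorphV rmorphXn/= !rmorph_nat.
by rewrite mulrAC [_%:R * _]mulrC mulr_natr.
Qed.

Lemma probv_half k b : probv (halfv k b).
Proof.
apply/andP; split; first by apply/allP => _ /mapP[i _ ->]; rewrite divr_ge0 ?exprn_ge0.
apply/eqP/(@complexI R); rewrite rmorph_sum/=; transitivity (charv (halfv k b) 0).
  by apply: eq_bigr => x _; rewrite dotv0r expi2pi0 mulr1.
by rewrite charv_half dotv0r expi2pi0 divff ?expr1n// pnatr_eq0.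
Qed.

(** The squared modulus of its transform is the product over [bs] of the powers
    [cos (pi * dotv b v) ^+ (2 * k)], close to 1 only where all the [dotv b v] are nearly
    integers. *)
Definition bohr_kernel k bs := foldr (fun b => convv (halfv k b)) [:: (1, 0 : V)] bs.

Lemma probv_kernel k bs : probv (bohr_kernel k bs).
Proof.
elim: bs => [|b bs IH] /=; last exact: probv_conv (probv_half _ _) IH.
by rewrite /probv /= ler01 big_seq1 eqxx.
Qed.

Lemma size_kernel k bs : size (bohr_kernel k bs) = (k.+1 ^ size bs)%N.
Proof.
by elim: bs => //= b bs IH; rewrite size_allpairs IH size_map size_iota expnS.
Qed.

Lemma charv_kernel k bs v :
  charv (bohr_kernel k bs) v = \prod_(b <- bs) ((1 + expi2pi (dotv b v)) / 2) ^+ k.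
Proof.
elim: bs => [|b bs IH] /=; last by rewrite charv_conv IH charv_half big_cons.
by rewrite /charv big_seq1 big_nil dotv0l expi2pi0 mulr1.
Qed.

Lemma normc_half (s : R) : normc ((1 + expi2pi s) / 2) ^+ 2 = (1 + cos (2 * pi * s)) / 2.
Proof.
rewrite (_ : _ / 2 = ((1 + cos (2 * pi * s)) / 2 +i* (sin (2 * pi * s) / 2))%C); last first.
  apply: (mulIf (_ : 2 != 0)); first by rewrite pnatr_eq0.
  rewrite divfK ?pnatr_eq0//; apply/eqP; rewrite eq_complex /=.
  by apply/andP; split; apply/eqP; field.
rewrite /normc sqr_sqrtr ?addr_ge0 ?sqr_ge0//.
have := cos2Dsin2 (2 * pi * s); lra.
Qed.

Lemma cos_round (s : R) : cos (2 * pi * s) = cos (2 * pi * `|(round s)%:~R - s|).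
Proof.
have cosz (z : int) x : cos (x + 2 * pi * z%:~R) = cos x :> R.
  elim/int_ind: z => [|k IH|k IH]; first by rewrite mulr0 addr0.
    by rewrite -[in RHS]IH -[RHS]cosD2pi; congr cos; rewrite -pmulrn -natr1; ring.
  by rewrite -[LHS]cosD2pi -[in RHS]IH; congr cos; rewrite !intrN -!pmulrn -natr1; ring.
rewrite -[in LHS](cosz (- round s)) intrN mulrN -mulrBr.
by rewrite distrC; case: (ger0P (s - _)) => _ //; rewrite mulrN cosN.
Qed.

(** One factor is small because the cosine decreases on [[0, pi]], an interval containing the angles
    since [dl] is at most a half; the other factors are at most 1. *)
Lemma bohr_kernel_off k bs (dl : R) v : 0 <= dl -> dl <= 2^-1 -> ~ bohr bs dl v ->
  normc (charv (bohr_kernel k bs) v) ^+ 2 <= ((1 + cos (2 * pi * dl)) / 2) ^+ k.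
Proof.
move=> dl0 dl1 nb; rewrite charv_kernel.
have half01 (s : R) : 0 <= (1 + cos (2 * pi * s)) / 2 <= 1.
  by have := cos_geN1 (2 * pi * s); have := cos_le1 (2 * pi * s); move=> *; apply/andP; split; lra.
suff H : \prod_(b <- bs) ((1 + cos (2 * pi * dotv b v)) / 2) <= (1 + cos (2 * pi * dl)) / 2.
  have -> : normc (\prod_(b <- bs) ((1 + expi2pi (dotv b v)) / 2) ^+ k) ^+ 2 =
      (\prod_(b <- bs) ((1 + cos (2 * pi * dotv b v)) / 2)) ^+ k.
    rewrite (big_morph (@normc R) (@Normc.normcM R) (Normc.normc1 R)) -!prodrXl.
    by apply: eq_bigr => b _; rewrite normcX exprAC normc_half.
  by apply: lerXn2r => //; rewrite nnegrE ?prodr_ge0//; case/andP: (half01 dl).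
have [b bbs bdl] : exists2 b, b \in bs & dl < `|(round (dotv b v))%:~R - dotv b v|.
  apply: contrapT => h; apply: nb => b bbs; rewrite leNgt; apply/negP => ?; apply: h; by exists b.
rewrite (big_rem b bbs)/= (@le_trans _ _ ((1 + cos (2 * pi * dotv b v)) / 2))//.
  apply: ler_piMr; first by case/andP: (half01 (dotv b v)).
  elim: (rem b bs) => [|c cs IH]; rewrite ?big_nil// big_cons.
  have /andP[c0 c1] := half01 (dotv c v).
  rewrite mulr_ile1 ?prodr_ge0// => c' _; by case/andP: (half01 (dotv c' v)).
rewrite ler_pM2r ?invr_gt0// lerD2l cos_round.
have pi0 := pi_gt0 R; have b1 := round_dist (dotv b v).
have range (x : R) : 0 <= x -> x <= 2^-1 -> 2 * pi * x \in `[0, pi].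
  move=> x0 x1; rewrite in_itv/= !mulr_ge0 ?(ltW pi0)//=.
  by have := ler_wpM2l (ltW pi0) x1; lra.
by rewrite ltW// ltr_cos ?range// ltr_pM2l// mulr_gt0.
Qed.

(** With [rho <= sg ^+ s.+1] the decay splits into [s] factors [sg ^+ k], each absorbing one factor
    [k.+1], and a last one that tends to 0. *)
Lemma poly_geometric_small s (rho e : R) : 0 < rho < 1 -> 0 < e ->
  exists k, k.+1%:R ^+ s * rho ^+ k < e.
Proof.
move=> /andP[rho0 rho1] e0; pose sg := 1 - (1 - rho) / s.+1%:R.
have h0 : 0 < (1 - rho) / s.+1%:R by rewrite divr_gt0 ?subr_gt0.
have h1 : (1 - rho) / s.+1%:R <= 1.
  rewrite ler_pdivrMr// mul1r -natr1; have : 0 <= s%:R :> R by []; move=> ?; lra.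
have sg0 : 0 <= sg by rewrite subr_ge0.
have sg1 : sg < 1 by rewrite ltrBlDr ltrDl.
have rsg : rho <= sg ^+ s.+1.
  have bern m : 1 - m%:R * ((1 - rho) / s.+1%:R) <= sg ^+ m.
    elim: m => [|m IH]; first by rewrite mul0r subr0.
    rewrite exprS (le_trans _ (ler_wpM2l sg0 IH))// /sg -natr1; set x := _ / _.
    rewrite (_ : (1 - x) * _ = 1 - (m%:R + 1) * x + m%:R * x ^+ 2); last by ring.
    by rewrite lerDl mulr_ge0 ?sqr_ge0.
  by rewrite (le_trans _ (bern s.+1))// mulrC divfK ?pnatr_eq0// opprB addrC subrK.
have {}sg0 : 0 < sg.
  by rewrite lt_def sg0 andbT; apply: contraTneq rsg => ->; rewrite exprS mul0r -ltNge.
have sgk k : k.+1%:R * sg ^+ k <= (1 - sg)^-1.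
  rewrite -[leRHS]mul1r ler_pdivlMr ?subr_gt0//.
  suff : k.+1%:R * sg ^+ k * (1 - sg) <= 1 - sg ^+ k.+1.
    by move=> h; apply: le_trans h _; rewrite lerBlDr lerDl exprn_ge0 ?ltW.
  elim: k => [|k IH]; first by rewrite expr0 expr1 !mul1r.
  rewrite (_ : _ * _ = sg * (k.+1%:R * sg ^+ k * (1 - sg)) + sg ^+ k.+1 * (1 - sg)); last first.
    by rewrite -[k.+2%:R]natr1 [sg ^+ k.+1]exprS; ring.
  have := ler_wpM2l (ltW sg0) IH.
  have : sg ^+ k.+1 * (1 - sg) <= 1 - sg.
    by rewrite ler_piMl ?subr_ge0 ?exprn_ile1// ltW.
  by rewrite [sg ^+ k.+2]exprS; lra.
have [|||k kP] := @exists_pow_lt R ((1 - sg) ^- s) sg^-1 e.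
- by rewrite invr_ge0 exprn_ge0// subr_ge0 ltW.
- by rewrite invf_gt1.
- by [].
exists k; apply: le_lt_trans (kP k (leqnn _)).
rewrite exprVn invrK -exprVn.
have e1 : rho ^+ k <= (sg ^+ k) ^+ s * sg ^+ k.
  rewrite -exprSr exprAC; apply: lerXn2r rsg; rewrite nnegrE ?exprn_ge0//; exact: ltW.
apply: le_trans (ler_wpM2l _ e1) _; first by rewrite exprn_ge0.
rewrite mulrA -exprMn ler_wpM2r ?exprn_ge0 ?(ltW sg0)// lerXn2r ?nnegrE ?mulr_ge0 ?exprn_ge0 ?(ltW sg0)//.
by rewrite invr_ge0 subr_ge0 ltW.
Qed.

(* By charv_sqr_mean the mean of |charv ga|^2 is at least 1 / size ga, whence the bound relative to size ga. *)
Lemma kernel_exists bs (dl e : R) : 0 < dl -> 0 < e -> exists2 ga, probv ga &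
  forall v, ~ bohr bs dl v -> normc (charv ga v) ^+ 2 <= e / (size ga)%:R.
Proof.
(* Up to a quarter the angle stays in the first quadrant, so that [rho] is positive. *)
move=> dl0 e0; pose d1 := Num.min dl 4^-1.
have d10 : 0 < d1 by rewrite lt_min dl0 invr_gt0 ltr0n.
have d12 : d1 <= 2^-1 by rewrite ge_min orbC; apply/orP; left; lra.
have pi0 := pi_gt0 R.
pose rho := (1 + cos (2 * pi * d1)) / 2.
have rho01 : 0 < rho < 1.
  have x0 : 0 < 2 * pi * d1 by rewrite !mulr_gt0.
  have d14 : 2 * pi * d1 <= pi / 2.
    have : d1 <= 4^-1 by rewrite ge_min lexx orbT.
    move=> /(ler_wpM2l (ltW pi0)); lra.
  have c0 : 0 <= cos (2 * pi * d1) by apply: cos_ge0_pihalf; apply/andP; split; lra.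
  have c1 : cos (2 * pi * d1) < 1.
    have xpi : 2 * pi * d1 \in `[0, pi] by rewrite in_itv/=; apply/andP; split; lra.
  by rewrite -[ltRHS](cos0 R) ltr_cos// in_itv/= lexx ltW.
  by apply/andP; split; rewrite /rho; lra.
have [k kP] := poly_geometric_small (size bs) rho01 e0.
exists (bohr_kernel k bs); first exact: probv_kernel.
move=> v nb; rewrite (le_trans (bohr_kernel_off k (ltW d10) d12 _))//.
  by move=> h; apply: nb => b bbs; rewrite (le_trans (h b bbs))// ge_min lexx.
rewrite -/rho size_kernel natrX ler_pdivlMr ?exprn_gt0// mulrC; exact: ltW.
Qed.

End Characters.


(** * Isometric actions on a complete seminormed space *)

Section SpectralSynthesis.
Variables (R : realType) (n : nat) (E : lmodType R[i]).
Local Notation V := 'rV[R]_n.+1.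
Variables (D : set E) (p : E -> R) (U : V -> E -> E).
Hypothesis D0 : D 0.
Hypothesis DD : forall f g, D f -> D g -> D (f + g).
Hypothesis DZ : forall c f, D f -> D (c *: f).
Hypothesis p_ge0 : forall f, 0 <= p f.
Hypothesis pD : forall f g, D f -> D g -> p (f + g) <= p f + p g.
Hypothesis pZ : forall c f, D f -> p (c *: f) = normc c * p f.
Hypothesis parallelogram : forall f g, D f -> D g ->
  p (f + g) ^+ 2 + p (f - g) ^+ 2 = 2 * p f ^+ 2 + 2 * p g ^+ 2.
Hypothesis complete : forall u : nat -> E, (forall k, D (u k)) ->
  (forall k, p (u k.+1 - u k) <= 2^-1 ^+ k) ->
  exists2 g, D g & forall e, 0 < e -> exists k0, forall k, (k0 <= k)%N -> p (u k - g) < e.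
Hypothesis UL : forall v c f g, U v (c *: f + g) = c *: U v f + U v g.
Hypothesis UU : forall v w f, U v (U w f) = U (v + w) f.
Hypothesis UD : forall v f, D f -> D (U v f).
Hypothesis pU : forall v f, D f -> p (U v f) = p f.
Implicit Types (f g h : E) (v w b : V) (al be : seq (R * V)).

Let p0 : p 0 = 0.
Proof. by rewrite -(scale0r (0 : E)) pZ// Normc.normc0 mul0r. Qed.

Let DN f : D f -> D (- f).
Proof. by rewrite -scaleN1r; exact: DZ. Qed.

Let DB f g : D f -> D g -> D (f - g).
Proof. by move=> Df Dg; apply: DD => //; exact: DN. Qed.

Let pN f : D f -> p (- f) = p f.
Proof. by move=> Df; rewrite -scaleN1r pZ// (normcN (1 : R[i])) Normc.normc1 mul1r. Qed.

Let pBC f g : D f -> D g -> p (f - g) = p (g - f).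
Proof. by move=> Df Dg; rewrite -opprB pN//; exact: DB. Qed.

Let pB f g h : D f -> D g -> D h -> p (f - h) <= p (f - g) + p (g - h).
Proof. by move=> Df Dg Dh; rewrite -[f in leLHS](subrK g) -addrA; apply: pD; exact: DB. Qed.

Let DS (I : Type) (s : seq I) (F : I -> E) : (forall i, D (F i)) -> D (\sum_(i <- s) F i).
Proof. by move=> DF; elim/big_ind: _. Qed.

Let pS (I : Type) (s : seq I) (F : I -> E) : (forall i, D (F i)) ->
  p (\sum_(i <- s) F i) <= \sum_(i <- s) p (F i).
Proof.
move=> DF; elim: s => [|x s IH]; first by rewrite !big_nil p0.
by rewrite !big_cons (le_trans (pD _ _))// ?lerD2l//; exact: DS.
Qed.

Let UD2 v f g : U v (f + g) = U v f + U v g.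
Proof. by rewrite -[f in LHS]scale1r UL scale1r. Qed.

Let U0 v : U v 0 = 0.
Proof. by apply: (addrI (U v 0)); rewrite -UD2 !addr0. Qed.

Let UZ v c f : U v (c *: f) = c *: U v f.
Proof. by rewrite -[c *: f]addr0 UL U0 addr0. Qed.

Let US (I : Type) (s : seq I) (F : I -> E) v : U v (\sum_(i <- s) F i) = \sum_(i <- s) U v (F i).
Proof. by elim: s => [|x s IH]; rewrite ?big_nil ?U0// !big_cons UD2 IH. Qed.

Definition twist b v f := expi2pi (- dotv b v) *: U v f.

(** Fixed vectors of the twisted action are the eigenvectors of frequency [b]. As [p] is only a
    seminorm, being fixed is expressed by differences of seminorm 0. *)
Definition twisted_mean al b f := \sum_(x <- al) x.1%:C%C *: twist b x.2 f.

Let twistD b v f g : twist b v (f + g) = twist b v f + twist b v g.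
Proof. by rewrite /twist UD2 scalerDr. Qed.

Let twistZ b v c f : twist b v (c *: f) = c *: twist b v f.
Proof. by rewrite /twist UZ !scalerA mulrC. Qed.

Let twist_comp b v w f : twist b v (twist b w f) = twist b (v + w) f.
Proof. by rewrite /twist UZ scalerA -expi2piD UU dotvDr opprD. Qed.

Let D_twist b v f : D f -> D (twist b v f).
Proof. by move=> Df; exact/DZ/UD. Qed.

Let p_twist b v f : D f -> p (twist b v f) = p f.
Proof. by move=> Df; rewrite pZ ?normc_expi2pi ?mul1r ?pU//; exact: UD. Qed.

Let D_mean al b f : D f -> D (twisted_mean al b f).
Proof. by move=> Df; apply: DS => x; apply/DZ/D_twist. Qed.

Let mean_comp al be b f :
  twisted_mean al b (twisted_mean be b f) = twisted_mean (convv al be) b f.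
Proof.
rewrite /twisted_mean big_allpairs_dep; apply: eq_bigr => x _.
rewrite [twist b x.2 _](_ : _ = \sum_(y <- be) y.1%:C%C *: twist b (x.2 + y.2) f).
  by rewrite scaler_sumr; apply: eq_bigr => y _; rewrite scalerA -rmorphM.
rewrite /twist US scaler_sumr; apply: eq_bigr => y _.
by rewrite -/(twist b x.2 _) twistZ -/(twist b y.2 f) twist_comp.
Qed.

Let meanC al be b f :
  twisted_mean al b (twisted_mean be b f) = twisted_mean be b (twisted_mean al b f).
Proof.
rewrite !mean_comp /twisted_mean !big_allpairs_dep exchange_big/=.
by apply: eq_bigr => y _; apply: eq_bigr => x _; rewrite mulrC addrC.
Qed.

Let meanB al b f g : twisted_mean al b (f - g) = twisted_mean al b f - twisted_mean al b g.
Proof.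
rewrite -sumrB; apply: eq_bigr => x _.
by rewrite twistD -scaleN1r twistZ scaleN1r scalerBr.
Qed.

Let normcR (x : R) : 0 <= x -> normc x%:C%C = x.
Proof. by move=> x0; rewrite /normc /= expr0n addr0 sqrtr_sqr ger0_norm. Qed.

Let p_mean_le al b f (c : R) : probv al -> D f ->
  (forall x, x \in al -> p (twist b x.2 f) <= c) -> p (twisted_mean al b f) <= c.
Proof.
move=> /andP[/allP a0 /eqP a1] Df h.
rewrite (le_trans (pS _ _))// => [x|]; first exact/DZ/D_twist.
rewrite -[leRHS]mul1r -a1 mulr_suml big_seq [leRHS]big_seq; apply: ler_sum => x xal.
rewrite pZ; last exact: D_twist.
by rewrite normcR ?ler_wpM2l ?h//; exact: a0 x xal.
Qed.

Let p_mean al b f : probv al -> D f -> p (twisted_mean al b f) <= p f.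
Proof. by move=> pal Df; apply: p_mean_le => // x _; rewrite p_twist. Qed.

Let mean_fixed al b g : probv al -> D g -> (forall v, p (twist b v g - g) = 0) ->
  p (twisted_mean al b g - g) = 0.
Proof.
move=> pal Dg fix_g; apply/eqP; rewrite eq_le p_ge0 andbT.
have [/allP a0 /eqP a1] := andP pal.
rewrite -[g in _ - g]scale1r -(rmorph1 (real_complex R)) -a1 rmorph_sum scaler_suml -sumrB.
rewrite (le_trans (pS _ _))// => [x|]; first by apply: DB; apply: DZ => //; exact: D_twist.
rewrite big1_seq// => x _; rewrite -scalerBr pZ ?fix_g ?mulr0//.
by apply: DB => //; exact: D_twist.
Qed.

(* The element of least norm in the closed convex hull of the twisted orbit. *)
Lemma mean_ergodic b f : D f -> exists g, [/\ D g, forall v, p (twist b v g - g) = 0 &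
  forall e, 0 < e -> exists2 al, probv al & p (twisted_mean al b f - g) < e].
Proof.
move=> Df.
pose A := [set r | exists2 al, probv al & r = p (twisted_mean al b f) ^+ 2].
have A0 : A !=set0.
  exists (p (twisted_mean [:: (1, 0)] b f) ^+ 2); exists [:: (1, 0)] => //.
  by rewrite /probv/= ler01 big_seq1 eqxx.
have lbA : lbound A 0 by move=> _ [al _ ->]; exact: sqr_ge0.
have infA : has_inf A by split => //; exists 0.
pose d := inf A.
have dP al : probv al -> d <= p (twisted_mean al b f) ^+ 2.
  by move=> pal; apply: inf_lbound; [exists 0|exists al].
(* With [close] below, this excess bounds consecutive squared distances by half of [4^-1 ^+ k],
   within what [complete] requires. *)
have step k : exists al, probv al /\ p (twisted_mean al b f) ^+ 2 < d + 8^-1 * (4^-1 ^+ k).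
  have e0 : 0 < 8^-1 * 4^-1 ^+ k :> R by rewrite mulr_gt0 ?exprn_gt0 ?invr_gt0 ?ltr0n.
  by have [_ [al pal ->] h] := inf_adherent e0 infA; exists al.
have [al alP] := choice step.
pose u k := twisted_mean (al k) b f.
have Du k : D (u k) by exact: D_mean.
(* The midpoint of two averages is an average, so its squared norm is at least [d]; the
   parallelogram law then bounds their distance. *)
have close be ga e : probv be -> probv ga ->
    p (twisted_mean be b f) ^+ 2 < d + e -> p (twisted_mean ga b f) ^+ 2 < d + e ->
    p (twisted_mean be b f - twisted_mean ga b f) ^+ 2 <= 4 * e.
  move=> pbe pga hbe hga.
  pose x := twisted_mean be b f; pose y := twisted_mean ga b f.
  have Dx : D x by exact: D_mean.
  have Dy : D y by exact: D_mean.
  pose half de : seq (R * V) := [seq (2^-1 * x.1, x.2) | x <- de].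
  have halfE de : twisted_mean (half de) b f = 2^-1%:C%C *: twisted_mean de b f.
    rewrite /twisted_mean big_map scaler_sumr; apply: eq_bigr => z _.
    by rewrite rmorphM -scalerA.
  have pm : probv (half be ++ half ga).
    have [/allP b0 /eqP b1] := andP pbe; have [/allP g0 /eqP g1] := andP pga.
    apply/andP; split.
      rewrite all_cat; apply/andP; split; apply/allP => _ /mapP[z zin ->];
        apply: mulr_ge0; rewrite ?invr_ge0//; [exact: b0 z zin|exact: g0 z zin].
    by rewrite big_cat !big_map -!mulr_sumr /= b1 g1; apply/eqP; field.
  have := dP _ pm; rewrite {1}/twisted_mean big_cat -/(twisted_mean _ b f) -/(twisted_mean _ b f).
  rewrite /= !halfE -scalerDr pZ; last exact: DD.
  rewrite normcR ?invr_ge0// -/x -/y exprMn => hd.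
  have := parallelogram Dx Dy; lra.
have uc k : p (u k.+1 - u k) <= 2^-1 ^+ k.
  have : p (u k.+1 - u k) ^+ 2 <= 4 * (8^-1 * 4^-1 ^+ k).
    apply: close; rewrite ?(alP _).1//; last exact: (alP k).2.
    apply: lt_trans (alP k.+1).2 _; rewrite ltrD2l ltr_pM2l ?invr_gt0 ?ltr0n//.
    have : 0 < 4^-1 ^+ k :> R by rewrite exprn_gt0 ?invr_gt0.
    by rewrite exprS; lra.
  move=> h; rewrite -(@ler_pXn2r _ 2)// ?nnegrE ?exprn_ge0 ?invr_ge0//.
  apply: le_trans h _; rewrite -exprM mulnC exprM (_ : 2^-1 ^+ 2 = 4^-1 :> R); last by field.
  by rewrite mulrA ler_piMl ?exprn_ge0 ?invr_ge0//; lra.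
have [g Dg gP] := complete Du uc; exists g; split => // [v|e e0]; last first.
  by have [k kP] := gP e e0; exists (al k); rewrite ?(alP k).1//; exact: kP.
apply/eqP; rewrite eq_le p_ge0 andbT; apply/ler_addgt0Pr => e e0; rewrite add0r.
have e40 : 0 < e / 4 by rewrite divr_gt0// ltr0n.
have [k0 k0P] := gP _ e40.
have [k1 k1P] : exists k1, forall N, (k1 <= N)%N -> (1 / 2 ^+ N : R) < e / 4.
  by apply: exists_pow_lt => //; rewrite ltr1n.
pose k := maxn k0 k1.
have uk := k0P k (leq_maxl _ _).
(* A twist of an average is again an average of the same norm, hence close to it by [close]. *)
have tw : p (twist b v (u k) - u k) <= e / 4.
  have tE : twisted_mean (convv [:: (1, v)] (al k)) b f = twist b v (u k).
    by rewrite -mean_comp /twisted_mean big_seq1 scale1r.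
  have p1 : probv [:: (1 : R, v)] by rewrite /probv/= ler01 big_seq1 eqxx.
  have := close _ _ _ (probv_conv p1 (alP k).1) (alP k).1 _ (alP k).2.
  rewrite tE p_twist; last exact: D_mean.
  move=> /(_ (alP k).2) h; apply: le_trans (ltW (k1P k (leq_maxr _ _))).
  rewrite -(@ler_pXn2r _ 2)// ?nnegrE ?divr_ge0 ?exprn_ge0//; apply: le_trans h _.
  rewrite div1r -exprVn -exprM mulnC exprM (_ : 2^-1 ^+ 2 = 4^-1 :> R); last by field.
  by rewrite mulrA ler_piMl ?exprn_ge0 ?invr_ge0//; lra.
rewrite (le_trans (pB (D_twist b v Dg) (D_twist b v (Du k)) Dg))//.
rewrite (le_trans (lerD (lexx _) (pB (D_twist b v (Du k)) (Du k) Dg)))//.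
have -> : p (twist b v g - twist b v (u k)) = p (u k - g).
  rewrite pBC; [|exact: D_twist..].
  by rewrite -(p_twist b v (DB (Du k) Dg)) twistD -[- g]scaleN1r twistZ scaleN1r.
by move: uk tw; lra.
Qed.

(** Averages for the same frequency commute, and they do not increase the distance to a fixed
    vector. Convolving measures adapted to different frequencies therefore keeps what each achieves,
    also under further averaging by [be]. *)
Lemma mean_ergodic_seq (bs : seq V) f : D f -> exists g : V -> E,
  (forall b, b \in bs -> D (g b) /\ forall v, p (twist b v (g b) - g b) = 0) /\
  forall e, 0 < e -> exists2 al, probv al &
    forall b be, b \in bs -> probv be -> p (twisted_mean (convv be al) b f - g b) < e.
Proof.
move=> Df; have /choice[g gP] b := mean_ergodic b Df.
exists g; split => [b _|e e0]; first by have [Dg fg _] := gP b.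
suff [al pal alP] : exists2 al, probv al &
    forall b, b \in bs -> p (twisted_mean al b f - g b) < e.
  exists al => // b be bbs pbe; rewrite -mean_comp; have [Dg fg _] := gP b.
  have Da : D (twisted_mean al b f) by exact: D_mean.
  have Db : D (twisted_mean be b (g b)) by exact: D_mean.
  apply: le_lt_trans (alP b bbs).
  rewrite (le_trans (pB _ Db _))//; first exact: D_mean.
  rewrite (mean_fixed pbe Dg fg) addr0 -meanB; apply: p_mean => //; exact: DB.
elim: bs => [|b bs [al pal alP]].
  by exists [:: (1, 0)] => //; rewrite /probv/= ler01 big_seq1 eqxx.
have [Dg fg /(_ e e0)[be pbe beP]] := gP b.
have stab ga de c : probv ga -> p (twisted_mean de c f - g c) < e ->
    p (twisted_mean (convv ga de) c f - g c) < e.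
  move=> pga h; have [Dgc fgc _] := gP c; apply: le_lt_trans h.
  rewrite -mean_comp (le_trans (pB _ (D_mean ga c Dgc) _))//; first exact/D_mean/D_mean.
  rewrite (mean_fixed pga Dgc fgc) addr0 -meanB; apply: p_mean => //.
  by apply: DB => //; exact: D_mean.
exists (convv al be); first exact: probv_conv.
move=> c; rewrite inE => /orP[/eqP ->|cbs]; first exact: stab.
by rewrite -mean_comp meanC mean_comp; apply: stab => //; exact: alP.
Qed.

Definition bohr_periodic f := forall e, 0 < e -> exists bs, exists2 dl, 0 < dl &
  forall v, bohr bs dl v -> p (U v f - f) < e.

Lemma bohr_periodicD f g : D f -> D g -> bohr_periodic f -> bohr_periodic g ->
  bohr_periodic (f + g).
Proof.
move=> Df Dg pf pg e e0; have e20 : 0 < e / 2 by rewrite divr_gt0.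
have [bs [dl dl0 h]] := pf _ e20; have [cs [dl' dl'0 h']] := pg _ e20.
exists (bs ++ cs), (Num.min dl dl'); first by rewrite lt_min dl0.
move=> v /bohr_cat[/h hf /h' hg]; rewrite UD2 opprD addrACA.
apply: le_lt_trans (pD (DB (UD v Df) Df) (DB (UD v Dg) Dg)) _.
by move: hf hg; lra.
Qed.

Lemma bohr_periodicZ c f : D f -> bohr_periodic f -> bohr_periodic (c *: f).
Proof.
move=> Df pf e e0; have c0 : 0 < 1 + normc c by rewrite ltr_pwDl//; case: (c) => a b; exact: sqrtr_ge0.
have [bs [dl dl0 h]] := pf _ (divr_gt0 e0 c0); exists bs, dl => // v /h hv.
rewrite UZ -scalerBr pZ; last exact: DB (UD v Df) Df.
apply: le_lt_trans (_ : (1 + normc c) * p (U v f - f) < e); first by rewrite ler_wpM2r// lerDr.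
by rewrite mulrC -ltr_pdivlMr.
Qed.

Lemma bohr_periodic_closed f : D f ->
  (forall e, 0 < e -> exists g, [/\ D g, bohr_periodic g & p (f - g) < e]) -> bohr_periodic f.
Proof.
move=> Df h e e0; have e30 : 0 < e / 3 by rewrite divr_gt0.
have [g [Dg pg fg]] := h _ e30; have [bs [dl dl0 hg]] := pg _ e30.
exists bs, dl => // v /hg hv.
apply: le_lt_trans (pB (UD v Df) (UD v Dg) Df) _.
apply: le_lt_trans (lerD (lexx _) (pB (UD v Dg) Dg Df)) _.
have -> : p (U v f - U v g) = p (f - g).
  by rewrite -(pU v (DB Df Dg)) UD2 -[- g]scaleN1r UZ scaleN1r.
by rewrite [p (g - f)]pBC//; move: hv fg; lra.
Qed.

(** [F] averages the translates of [f] with the weights [k], and [M] is the total weight. [F] is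
    close to [M] times [f], because on the Bohr set the translates are close to [f] and off it [k]
    is small compared with [M]. As [k] is also the transform of [kap], [F] is a combination of
    twisted means. All errors are measured against the lower bound [N^-1] of [M]. *)
Lemma bohr_periodic_span f (e : R) : D f -> bohr_periodic f -> 0 < e ->
  exists (s : seq (R * V)) (g : V -> E),
    (forall x, x \in s -> D (g x.2) /\
       forall v, p (U v (g x.2) - expi2pi (dotv x.2 v) *: g x.2) = 0) /\
    p (f - \sum_(x <- s) x.1%:C%C *: g x.2) < e.
Proof.
move=> Df ap e0.
have e40 : 0 < e / 4 by rewrite divr_gt0// ltr0n.
have [bs [dl dl0 close]] := ap _ e40.
have pf0 : 0 < 8 * (1 + p f) by rewrite mulr_gt0// ltr_wpDr ?ltr0n.
have [ga pga off] := kernel_exists bs dl0 (divr_gt0 e0 pf0).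
pose kap := convv ga (oppv ga); have pkap : probv kap by exact/probv_conv/probv_opp.
pose N : R := (size ga)%:R.
have N0 : 0 < N.
  rewrite ltr0n lt0n size_eq0; apply: contraTneq pga => ->.
  by rewrite /probv big_nil eq_sym oner_eq0 andbF.
(* The twist carries the conjugate exponential, hence the sign of the frequencies. *)
have [g [gP gal]] := mean_ergodic_seq [seq - z.2 | z <- kap] Df.
have [al0 pal0 al0P] := gal _ (divr_gt0 e40 N0).
(* Symmetrised so that [charv_sqr_mean] bounds [M] from below; [al0P] tolerates this further
   averaging. *)
pose al := convv (oppv al0) al0.
have pal : probv al by apply: probv_conv => //; exact: probv_opp.
pose k v := normc (charv ga v) ^+ 2.
have k0 v : 0 <= k v by exact: sqr_ge0.
pose M := \sum_(y <- al) y.1 * k y.2.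
have NM : N^-1 <= M.
  have := charv_sqr_mean pga (probv_opp pal0).
  suff -> : oppv (oppv al0) = al0 by [].
  rewrite /oppv -map_comp -[RHS]map_id; apply: eq_map => -[x v] /=; by rewrite opprK.
have M0 : 0 < M by apply: lt_le_trans NM; rewrite invr_gt0.
have al_ge0 y : y \in al -> 0 <= y.1 by case/andP: pal => /allP h _ /h.
have kap_ge0 z : z \in kap -> 0 <= z.1 by case/andP: pkap => /allP h _ /h.
have Dg z : z \in kap -> D (g (- z.2)) by move=> zk; apply: (gP _ _).1; exact: map_f.
pose F := \sum_(y <- al) (y.1 * k y.2)%:C%C *: U y.2 f.
have FE : F = \sum_(z <- kap) z.1%:C%C *: twisted_mean al (- z.2) f.
  rewrite /twisted_mean; under [RHS]eq_bigr do rewrite scaler_sumr.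
  rewrite exchange_big; apply: eq_bigr => y _.
  have -> : (y.1 * k y.2)%:C%C = y.1%:C%C * charv kap y.2 by rewrite charv_sqr rmorphM.
  rewrite /charv mulr_sumr scaler_suml; apply: eq_bigr => z _.
  by rewrite /twist !scalerA dotvNl opprK mulrCA mulrA.
have DF : D F by apply: DS => y; exact/DZ/UD.
have fF : p (M%:C%C *: f - F) <= M * (e / 2).
  rewrite rmorph_sum scaler_suml -sumrB (le_trans (pS _ _))// => [y|].
    by apply: DB; apply: DZ => //; exact: UD.
  apply: (@le_trans _ _ (\sum_(y <- al) (y.1 * k y.2 * (e / 4) + y.1 * (M * (e / 4))))).
    rewrite big_seq [leRHS]big_seq; apply: ler_sum => y yal.
    have y0 := al_ge0 _ yal.
    rewrite -scalerBr pZ; last by apply: DB => //; exact: UD.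
    rewrite (normcR (mulr_ge0 y0 (k0 _))) -2!mulrA -mulrDr ler_wpM2l// pBC//; last exact: UD.
    have [yb|nyb] := pselect (bohr bs dl y.2).
      apply: ler_wpDr (mulr_ge0 (ltW M0) (ltW e40)) _.
      by rewrite ler_wpM2l// ltW// close.
    apply: ler_wpDl (mulr_ge0 (k0 _) (ltW e40)) _.
    have pd : p (U y.2 f - f) <= 2 * (1 + p f).
      rewrite (le_trans (pD (UD _ Df) (DN Df)))// pN// pU//.
      by have := p_ge0 f; lra.
    apply: le_trans (ler_pM (k0 _) (p_ge0 _) (off _ nyb) pd) _.
    rewrite -/N (_ : _ * _ = N^-1 * (e / 4)); last first.
      by field; rewrite !gt_eqF//; have := p_ge0 f; lra.
    by rewrite ler_wpM2r// ltW.
  rewrite big_split -!mulr_suml /= -/M; case/andP: pal => _ /eqP ->; lra.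
pose G := \sum_(z <- kap) z.1%:C%C *: g (- z.2).
have FG : p (F - G) <= M * (e / 4).
  rewrite FE -sumrB big_seq (big_mkcond (fun z => z \in kap)).
  rewrite (le_trans (pS _ _))// => [z|].
    case: ifP => // zk; apply: DB; apply: DZ; [exact: D_mean|exact: Dg].
  apply: (@le_trans _ _ (\sum_(z <- kap) z.1 * (M * (e / 4)))); last first.
    by rewrite -mulr_suml; case/andP: pkap => _ /eqP ->; rewrite mul1r.
  rewrite big_seq [leRHS]big_seq; apply: ler_sum => z zk; rewrite zk -scalerBr.
  rewrite pZ; last by apply: DB; [exact: D_mean|exact: Dg].
  rewrite normcR ?kap_ge0// ler_wpM2l ?kap_ge0//.
  apply: le_trans (ltW (al0P _ _ (map_f _ zk) (probv_opp pal0))) _.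
  by rewrite mulrC ler_wpM2r// ltW.
have DG : D G.
  by rewrite /G big_seq; elim/big_ind: _ => // z zk; exact/DZ/Dg.
exists [seq (z.1 / M, - z.2) | z <- kap], g; split.
  move=> _ /mapP[z zk ->] /=; have [Dgz fg] := gP _ (map_f (fun z => - z.2) zk); split => // v.
  have := fg v; set b := - z.2 => h.
  have -> : U v (g b) - expi2pi (dotv b v) *: g b = expi2pi (dotv b v) *: (twist b v (g b) - g b).
    by rewrite scalerBr /twist scalerA -expi2piD subrr expi2pi0 scale1r.
  by rewrite pZ ?h ?mulr0//; apply: DB => //; exact: D_twist.
rewrite big_map (_ : \sum_(z <- kap) _ = M^-1%:C%C *: G); last first.
  by rewrite scaler_sumr; apply: eq_bigr => z _; rewrite scalerA -rmorphM mulrC.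
have -> : f - M^-1%:C%C *: G = M^-1%:C%C *: ((M%:C%C *: f - F) + (F - G)).
  by rewrite addrA subrK scalerBr scalerA -rmorphM mulVf ?gt_eqF// scale1r.
have DMF : D (M%:C%C *: f - F) by apply: DB => //; exact: DZ.
rewrite pZ; last by apply: DD => //; exact: DB.
rewrite normcR ?invr_ge0 ?(ltW M0)// mulrC ltr_pdivrMr//.
apply: le_lt_trans (pD DMF (DB DF DG)) _.
rewrite (le_lt_trans (lerD fF FG))// -mulrDr mulrC ltr_pM2r//; lra.
Qed.

End SpectralSynthesis.

(** * Square integrable functions *)

Section SquareIntegrable.
Variables (R : realType) (d : measure_display) (X : measurableType d).
Variable mu : probability X R.
Local Notation E := (X -> R[i]^o).
Implicit Types (f g : E) (c : R[i]).

Definition energy f : \bar R := (\int[mu]_x (normc (f x) ^+ 2)%:E)%E.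

Definition square_integrable : set E := [set f |
  [/\ measurable_fun setT (fun x => complex.Re (f x)),
      measurable_fun setT (fun x => complex.Im (f x)) & (energy f < +oo)%E]].

Definition l2norm f : R := Num.sqrt (fine (energy f)).

Lemma normc2E c : normc c ^+ 2 = complex.Re c ^+ 2 + complex.Im c ^+ 2.
Proof. by case: c => x y; rewrite /normc /= sqr_sqrtr// addr_ge0 ?sqr_ge0. Qed.

Lemma measurable_normc2 f : measurable_fun setT (fun x => complex.Re (f x)) ->
  measurable_fun setT (fun x => complex.Im (f x)) ->
  measurable_fun setT (fun x => (normc (f x) ^+ 2)%:E).
Proof.
move=> mr mi; apply/measurable_EFinP; under eq_fun do rewrite normc2E.
by apply: measurable_funD; exact: measurable_funX.
Qed.

Lemma energy_ge0 f : (0 <= energy f)%E.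
Proof. by apply: integral_ge0 => x _; rewrite lee_fin sqr_ge0. Qed.

Lemma energy_fin f : square_integrable f -> (energy f \is a fin_num).
Proof. by case=> _ _ h; rewrite ge0_fin_numE ?energy_ge0. Qed.

Lemma l2norm_ge0 f : 0 <= l2norm f.
Proof. exact: sqrtr_ge0. Qed.

Lemma l2norm_sqr f : square_integrable f -> ((l2norm f) ^+ 2)%:E = energy f.
Proof.
move=> Df; rewrite /l2norm sqr_sqrtr ?fineK ?energy_fin//.
by rewrite fine_ge0 ?energy_ge0.
Qed.

Lemma energy_le_l2norm f (e : R) : 0 <= e -> square_integrable f ->
  (energy f <= (e ^+ 2)%:E)%E -> l2norm f <= e.
Proof.
move=> e0 Df; rewrite -l2norm_sqr// lee_fin.
by rewrite ler_pXn2r// nnegrE l2norm_ge0.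
Qed.

Lemma square_integrableZ c f : square_integrable f ->
  square_integrable (c *: f) /\ energy (c *: f) = ((normc c ^+ 2)%:E * energy f)%E.
Proof.
move=> [mr mi ef].
have eE : energy (c *: f) = ((normc c ^+ 2)%:E * energy f)%E.
  rewrite -ge0_integralZl ?lee_fin ?sqr_ge0//; last 2 first.
  - exact: measurable_normc2.
  - by move=> x _; rewrite lee_fin sqr_ge0.
  by apply: eq_integral => x _; rewrite -EFinM -exprMn -Normc.normcM.
split=> //; split; last by rewrite eE lte_mul_pinfty ?lee_fin ?sqr_ge0.
  rewrite (_ : (fun _ => _) = (fun x => complex.Re c * complex.Re (f x) - complex.Im c * complex.Im (f x))).
    by apply: measurable_funB; apply: measurable_funM => //; exact: measurable_cst.
  by apply/funext => x; rewrite /GRing.scale/=; case: (c) (f x) => [a b] [a' b'].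
rewrite (_ : (fun _ => _) = (fun x => complex.Re c * complex.Im (f x) + complex.Im c * complex.Re (f x))).
  by apply: measurable_funD; apply: measurable_funM => //; exact: measurable_cst.
by apply/funext => x; rewrite /GRing.scale/=; case: (c) (f x) => [a b] [a' b'].
Qed.

Lemma measurable_complexD f g : 
  measurable_fun setT (fun x => complex.Re (f x)) -> measurable_fun setT (fun x => complex.Re (g x)) ->
  measurable_fun setT (fun x => complex.Im (f x)) -> measurable_fun setT (fun x => complex.Im (g x)) ->
  measurable_fun setT (fun x => complex.Re ((f + g) x)) /\ measurable_fun setT (fun x => complex.Im ((f + g) x)).
Proof.
move=> mrf mrg mif mig; split.
  rewrite (_ : (fun _ => _) = (fun x => complex.Re (f x) + complex.Re (g x))).
    exact: measurable_funD.
  by apply/funext => x; rewrite -raddfD.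
rewrite (_ : (fun _ => _) = (fun x => complex.Im (f x) + complex.Im (g x))).
  exact: measurable_funD.
by apply/funext => x; rewrite -raddfD.
Qed.

(** Stated in the extended reals, before the sum is known to have finite energy; that finiteness is
    then a consequence. *)
Lemma energy_parallelogram f g : square_integrable f -> square_integrable g ->
  (energy (f + g)%R + energy (f - g)%R = 2%:E * energy f + 2%:E * energy g)%E.
Proof.
move=> Df Dg; have [_ _ _] := Df; have [[mr' mi' _] _] := square_integrableZ (-1) Dg.
case: Df Dg => [mrf mif _] [mrg mig _].
have [a1 a2] := measurable_complexD mrf mrg mif mig.
rewrite scaleN1r in mr' mi'; have [b1 b2] := measurable_complexD mrf mr' mif mi'.
have ge0 (h : E) x : setT x -> (0 <= (normc (h x) ^+ 2)%:E)%E by rewrite lee_fin sqr_ge0.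
rewrite -!ge0_integralZl ?lee_fin//; try exact: measurable_normc2; try exact: ge0.
have ge2 (h : E) x : setT x -> (0 <= 2%:E * (normc (h x) ^+ 2)%:E)%E.
  by move=> _; rewrite -EFinM lee_fin mulr_ge0 ?sqr_ge0.
rewrite -!ge0_integralD//; try exact: measurable_normc2; try exact: ge0; try exact: ge2;
  try (apply: measurable_funeM; exact: measurable_normc2).
apply: eq_integral => x _; rewrite -!EFinM -!EFinD; congr EFin.
rewrite -[(f + g) x]/(f x + g x) -[(f - g) x]/(f x - g x) !normc2E.
by case: (f x) (g x) => [a b] [a' b'] /=; ring.
Qed.

Lemma square_integrableD f g : square_integrable f -> square_integrable g ->
  square_integrable (f + g).
Proof.
move=> Df Dg; have e2 := energy_parallelogram Df Dg.
case: (Df) (Dg) => [mrf mif ef] [mrg mig eg].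
have [a1 a2] := measurable_complexD mrf mrg mif mig; split => //.
apply: le_lt_trans (_ : (energy (f + g)%R + energy (f - g)%R < +oo)%E).
  by rewrite leeDl ?energy_ge0.
by rewrite e2 lte_add_pinfty// lte_mul_pinfty// lee_fin.
Qed.

Lemma square_integrable0 : square_integrable 0.
Proof.
split; [exact: measurable_cst|exact: measurable_cst|].
by rewrite /energy; under eq_integral do rewrite Normc.normc0 expr0n/=; rewrite integral0.
Qed.

Lemma l2normZ c f : square_integrable f -> l2norm (c *: f) = normc c * l2norm f.
Proof.
move=> Df; have [Dcf ecf] := square_integrableZ c Df.
apply/eqP; rewrite -(@eqrXn2 _ 2)// ?mulr_ge0 ?l2norm_ge0 ?sqrtr_ge0//; last first.
  by case: (c) => a b; exact: sqrtr_ge0.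
by move: ecf; rewrite -!l2norm_sqr// -EFinM => -[->]; rewrite exprMn.
Qed.

Lemma l2norm_parallelogram f g : square_integrable f -> square_integrable g ->
  l2norm (f + g) ^+ 2 + l2norm (f - g) ^+ 2 = 2 * l2norm f ^+ 2 + 2 * l2norm g ^+ 2.
Proof.
move=> Df Dg; have DNg : square_integrable (- g).
  by rewrite -scaleN1r; have [] := square_integrableZ (-1) Dg.
have := energy_parallelogram Df Dg; rewrite -!l2norm_sqr//; try exact: square_integrableD.
by rewrite -!EFinM -!EFinD => -[].
Qed.

(** Integration of the pointwise Young inequality with parameter [t], the ratio of the two norms;
    adding [e / 2] to both norms avoids division by 0. *)
Lemma l2normD f g : square_integrable f -> square_integrable g ->
  l2norm (f + g) <= l2norm f + l2norm g.
Proof.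
move=> Df Dg; have Dfg := square_integrableD Df Dg.
apply/ler_addgt0Pr => e e0; set a := l2norm f; set b := l2norm g.
have a0 : 0 <= a by exact: l2norm_ge0.
have b0 : 0 <= b by exact: l2norm_ge0.
pose a' := a + e / 2; pose b' := b + e / 2.
have a'0 : 0 < a' by rewrite ltr_wpDl// divr_gt0.
have b'0 : 0 < b' by rewrite ltr_wpDl// divr_gt0.
pose t := b' / a'; have t0 : 0 < t by exact: divr_gt0.
apply: energy_le_l2norm => //; first by rewrite !addr_ge0// ltW.
case: (Df) (Dg) (Dfg) => [mrf mif ef] [mrg mig eg] [mrh mih _].
have ge0 (c : R) (h : E) x : 0 <= c -> setT x -> (0 <= c%:E * (normc (h x) ^+ 2)%:E)%E.
  by move=> c0 _; rewrite -EFinM lee_fin mulr_ge0 ?sqr_ge0.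
have mZ (c : R) (h : E) : measurable_fun setT (fun x => (normc (h x) ^+ 2)%:E) ->
    measurable_fun setT (fun x => c%:E * (normc (h x) ^+ 2)%:E)%E.
  exact: measurable_funeM.
have mf := measurable_normc2 mrf mif; have mg := measurable_normc2 mrg mig.
have t10 : 0 <= 1 + t by rewrite addr_ge0// ltW.
have t20 : 0 <= 1 + t^-1 by rewrite addr_ge0// invr_ge0 ltW.
apply: (@le_trans _ _ ((1 + t)%:E * energy f + (1 + t^-1)%:E * energy g)%E).
  rewrite -!ge0_integralZl ?lee_fin//; try by move=> x _; rewrite lee_fin sqr_ge0.
  rewrite -ge0_integralD//; try by move=> x; exact: ge0.
  - apply: ge0_le_integral => //; first by move=> x _; rewrite lee_fin sqr_ge0.
    + exact: measurable_normc2.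
    + by apply: emeasurable_funD; exact: mZ.
    move=> x _; rewrite -!EFinM -EFinD lee_fin !normc2E -[(f + g) x]/(f x + g x).
    case: (f x) (g x) => [p q] [p' q'] /=.
    have young (y z : R) : (y + z) ^+ 2 <= (1 + t) * y ^+ 2 + (1 + t^-1) * z ^+ 2.
      rewrite -subr_ge0 (_ : _ - _ = t^-1 * (t * y - z) ^+ 2); last by field; rewrite gt_eqF.
      by rewrite mulr_ge0 ?sqr_ge0// invr_ge0 ltW.
    by have := lerD (young p p') (young q q'); rewrite !mulrDr; lra.
  - exact: mZ.
  - exact: mZ.
rewrite -!l2norm_sqr// -!EFinM -EFinD lee_fin -/a -/b.
have aa : a ^+ 2 <= a' ^+ 2 by rewrite ler_pXn2r ?nnegrE ?(ltW a'0)// lerDl divr_ge0// ltW.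
have bb : b ^+ 2 <= b' ^+ 2 by rewrite ler_pXn2r ?nnegrE ?(ltW b'0)// lerDl divr_ge0// ltW.
apply: le_trans (lerD (ler_wpM2l t10 aa) (ler_wpM2l t20 bb)) _.
rewrite (_ : a + b + e = a' + b'); last by rewrite /a' /b'; field.
by rewrite le_eqVlt; apply/orP; left; apply/eqP; rewrite /t; field; rewrite !gt_eqF.
Qed.

Lemma l2norm_eq0 f : square_integrable f -> l2norm f = 0 -> {ae mu, forall x, f x = 0}.
Proof.
move=> Df f0; have := l2norm_sqr Df; rewrite f0 expr0n /= => /esym e0.
have [mr mi _] := Df; have mn := measurable_normc2 mr mi.
have : (\int[mu]_(x in setT) `|(normc (f x) ^+ 2)%:E| = 0)%E.
  rewrite -[RHS]e0; apply: eq_integral => x _; by rewrite gee0_abs// lee_fin sqr_ge0.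
move=> /(ae_eq_integral_abs mu measurableT mn); apply: filterS => x /(_ I) [].
by move/eqP; rewrite sqrf_eq0 => /eqP/Normc.eq0_normc.
Qed.

Lemma geometric_cauchy (u : nat -> R) (B q : R) : 0 <= B -> 0 < q < 1 ->
  (forall k, `|u k.+1 - u k| <= B * q ^+ k) ->
  u k @[k --> \oo] --> limn u /\ forall k, `|u k - limn u| <= B / (1 - q) * q ^+ k.
Proof.
move=> B0 /andP[q0 q1] h.
have tail k m : `|u (k + m)%N - u k| <= B / (1 - q) * q ^+ k * (1 - q ^+ m).
  elim: m => [|m IH]; first by rewrite addn0 subrr normr0 expr0 subrr mulr0.
  rewrite addnS -[X in `|X|](subrKA (u (k + m)%N)) (le_trans (ler_normD _ _))//.
  rewrite (le_trans (lerD (h _) IH))// exprD exprS le_eqVlt; apply/orP; left; apply/eqP.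
  by field; rewrite subr_eq0 eq_sym lt_eqF.
have c0 k : 0 <= B / (1 - q) * q ^+ k.
  by rewrite mulr_ge0 ?exprn_ge0 ?(ltW q0)// divr_ge0// subr_ge0 ltW.
have tail' k m : (k <= m)%N -> `|u m - u k| <= B / (1 - q) * q ^+ k.
  move=> km; rewrite -(subnKC km) (le_trans (tail _ _))// ler_piMr//.
  by rewrite lerBlDr lerDl exprn_ge0 ?ltW.
have cu : cvgn u.
  have uE : u = (fun n => u 0%N + series (telescope u) n) by apply/funext => n; exact: eq_sum_telescope.
  rewrite uE; apply: is_cvgD; first exact: is_cvg_cst.
  apply: normed_cvg; apply: (@series_le_cvg _ _ (geometric B q)) => [n|n|n|].
  - exact: normr_ge0.
  - by rewrite /geometric/= mulr_ge0// exprn_ge0// ltW.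
  - exact: h.
  - by apply: is_cvg_geometric_series; rewrite ger0_norm// ltW.
split => // k; apply/ler_addgt0Pr => e e0.
have /cvgrPdist_lt/(_ e e0)[N _ NP] := cu.
have := NP (maxn N k) (leq_maxl _ _); have := tail' k (maxn N k) (leq_maxr _ _).
set y := limn u; set x := u (maxn N k) => h1 h2.
rewrite -[X in `|X|](subrKA x) (le_trans (ler_normD _ _))// lerD//; first by rewrite distrC.
by rewrite distrC ltW.
Qed.

(* The weights (9/4)^k are chosen between the growth needed for convergence of the sums of |u_{k+1} - u_k|
   and the decay 4^-k of the energies. *)
Lemma riesz_fischer (u : nat -> E) : (forall k, square_integrable (u k)) ->
  (forall k, l2norm (u k.+1 - u k) <= 2^-1 ^+ k) ->
  exists2 g, square_integrable g &
    forall e, 0 < e -> exists k0, forall k, (k0 <= k)%N -> l2norm (u k - g) < e.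
Proof.
move=> Du uc.
pose w k x : \bar R := (((9 / 4) ^+ k)%:E * (normc ((u k.+1 - u k) x) ^+ 2)%:E)%E.
have DB f g : square_integrable f -> square_integrable g -> square_integrable (f - g).
  move=> Df Dg; apply: square_integrableD => //.
  by rewrite -scaleN1r; have [] := square_integrableZ (-1) Dg.
have q0 k : 0 <= (9 / 4) ^+ k :> R by rewrite exprn_ge0.
have md k : measurable_fun setT (fun x => (normc ((u k.+1 - u k) x) ^+ 2)%:E).
  by have [mr mi _] := DB _ _ (Du k.+1) (Du k); exact: measurable_normc2.
have mw k : measurable_fun setT (w k) by exact: measurable_funeM.
have w0 k x : setT x -> (0 <= w k x)%E by move=> _; rewrite mule_ge0 ?lee_fin ?sqr_ge0.
pose H x := (\sum_(0 <= k <oo) w k x)%E.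
have H0 x : (0 <= H x)%E by apply: nneseries_ge0 => k _ _; exact: w0.
have mH : measurable_fun setT H.
  by apply: ge0_emeasurable_sum => // k x _ _; exact: w0.
have intw k : (\int[mu]_x w k x <= ((9 / 16) ^+ k)%:E)%E.
  rewrite ge0_integralZl ?lee_fin//; last by move=> x _; rewrite lee_fin sqr_ge0.
  rewrite -[(\int[mu]_x _)%E]/(energy (u k.+1 - u k)) -l2norm_sqr; last exact: DB.
  rewrite -EFinM lee_fin (_ : 9 / 16 = 9 / 4 * 2^-1 ^+ 2); last by field.
  by rewrite [leRHS]exprMn ler_wpM2l// [leRHS]exprAC ler_pXn2r ?nnegrE ?l2norm_ge0 ?exprn_ge0 ?invr_ge0.
have intH : (\int[mu]_x H x < +oo)%E.
  (* The powers of [9 / 16] sum to [16 / 7], which is below 3. *)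
  rewrite integral_nneseries//; apply: (@le_lt_trans _ _ 3%:E); last exact: ltry.
  apply: lime_le; first by apply: is_cvg_nneseries => k _ _; apply: integral_ge0 => x; exact: w0.
  apply: nearW => m; apply: (@le_trans _ _ (16 / 7 * (1 - (9 / 16) ^+ m))%:E).
    elim: m => [|m IH]; first by rewrite big_geq// lee_fin expr0 subrr mulr0.
    rewrite big_nat_recr//=; apply: le_trans (leeD IH (intw m)) _.
    by rewrite -EFinD lee_fin exprS; lra.
  have : 0 <= (9 / 16) ^+ m :> R by rewrite exprn_ge0.
  by rewrite lee_fin; lra.
have finH x : (H x < +oo)%E -> H x \is a fin_num by rewrite ge0_fin_numE.
have aeH : {ae mu, forall x, (H x < +oo)%E}.
  have /integrable_ae : mu.-integrable setT H.
    apply/integrableP; split => //; under eq_integral do rewrite gee0_abs//.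
    exact: intH.
  move=> /(_ measurableT); apply: filterS => x /(_ I); by rewrite ge0_fin_numE.
pose B x := Num.sqrt (fine (H x)).
have B2 x : B x ^+ 2 = fine (H x) by rewrite sqr_sqrtr// fine_ge0.
have pt x k : (H x < +oo)%E -> normc ((u k.+1 - u k) x) <= B x * (2 / 3) ^+ k.
  move=> Hx; rewrite -(@ler_pXn2r _ 2)// ?nnegrE ?mulr_ge0 ?exprn_ge0 ?sqrtr_ge0//; last first.
    by case: ((u k.+1 - u k) x) => a b; exact: sqrtr_ge0.
  have : (w k x <= H x)%E.
    apply: le_trans (nneseries_lim_ge k.+1 _) => [|i _ _]; last exact: w0.
    by rewrite big_nat_recr//= leeDr// sume_ge0// => i _; exact: w0.
  rewrite -(fineK (finH x Hx)) /w -EFinM lee_fin -B2 -ler_pdivlMl ?exprn_gt0//.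
  have -> // : (B x * (2 / 3) ^+ k) ^+ 2 = (9 / 4) ^- k * B x ^+ 2.
  rewrite [LHS]exprMn mulrC; congr (_ * _).
  by rewrite exprAC (_ : (2 / 3) ^+ 2 = (9 / 4)^-1) ?exprVn//; field.
(* Setting the sequence to 0 where [H] is infinite makes it converge everywhere, so that its limit
   is measurable. *)
pose v k x : R[i] := if (H x < +oo)%E then u k x else 0.
have vc x : exists2 c, 0 <= c & ((H x < +oo)%E -> c = B x) /\
    forall k, normc (v k.+1 x - v k x) <= c * (2 / 3) ^+ k.
  rewrite /v; have [Hx|nHx] := boolP (H x < +oo)%E.
    by exists (B x); [exact: sqrtr_ge0|split=> // k; exact: pt].
  by exists 0 => //; split=> // k; rewrite subrr Normc.normc0 mul0r.
have q23 : (0 < (2 / 3 : R)) && ((2 / 3 : R) < 1).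
  by apply/andP; split; lra.
have reim (z : R[i]) : `|complex.Re z| <= normc z /\ `|complex.Im z| <= normc z.
  by case: z => a b; rewrite /normc/= -!sqrtr_sqr; split; apply: ler_wsqrtr; rewrite ?lerDl ?lerDr sqr_ge0.
have vre x : (fun k => complex.Re (v k x)) @ \oo --> limn (fun k => complex.Re (v k x)) /\
    forall k, (H x < +oo)%E ->
      `|complex.Re (v k x) - limn (fun k => complex.Re (v k x))| <= B x / (1 - 2 / 3) * (2 / 3) ^+ k.
  have [c c0 [cB cP]] := vc x.
  have [k|h1 h2] := @geometric_cauchy (fun k => complex.Re (v k x)) c (2 / 3) c0 q23.
    by rewrite -raddfB; exact: le_trans (reim _).1 (cP k).
  by split=> // k Hx; rewrite -(cB Hx).
have vim x : (fun k => complex.Im (v k x)) @ \oo --> limn (fun k => complex.Im (v k x)) /\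
    forall k, (H x < +oo)%E ->
      `|complex.Im (v k x) - limn (fun k => complex.Im (v k x))| <= B x / (1 - 2 / 3) * (2 / 3) ^+ k.
  have [c c0 [cB cP]] := vc x.
  have [k|h1 h2] := @geometric_cauchy (fun k => complex.Im (v k x)) c (2 / 3) c0 q23.
    by rewrite -raddfB; exact: le_trans (reim _).2 (cP k).
  by split=> // k Hx; rewrite -(cB Hx).
pose g : E := fun x => (limn (fun k => complex.Re (v k x)) +i* limn (fun k => complex.Im (v k x)))%C.
have mA : measurable_fun setT (fun x => (H x < +oo)%E).
  by apply: measurable_fun_lte => //; exact: measurable_cst.
have mgr : measurable_fun setT (fun x => complex.Re (g x)).
  apply: (@measurable_fun_cvg _ _ _ _ (fun k x => complex.Re (v k x))) => [k|x _]; last exact: (vre x).1.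
  rewrite (_ : (fun x => _) = fun x => if (H x < +oo)%E then complex.Re (u k x) else 0).
    by apply: measurable_fun_ifT => //; have [] := Du k.
  by apply/funext => x; rewrite /v; case: ifP.
have mgi : measurable_fun setT (fun x => complex.Im (g x)).
  apply: (@measurable_fun_cvg _ _ _ _ (fun k x => complex.Im (v k x))) => [k|x _]; last exact: (vim x).1.
  rewrite (_ : (fun x => _) = fun x => if (H x < +oo)%E then complex.Im (u k x) else 0).
    by apply: measurable_fun_ifT => //; have [] := Du k.
  by apply/funext => x; rewrite /v; case: ifP.
have mug k : measurable_fun setT (fun x => complex.Re ((u k - g) x)) /\
    measurable_fun setT (fun x => complex.Im ((u k - g) x)).
  have [mr mi _] := Du k; apply: measurable_complexD => //.
    rewrite (_ : (fun x => _) = \- (fun x => complex.Re (g x))); first exact: measurable_funN.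
    by apply/funext.
  rewrite (_ : (fun x => _) = \- (fun x => complex.Im (g x))); first exact: measurable_funN.
  by apply/funext.
have I0 : (0 <= \int[mu]_x H x)%E by exact: integral_ge0.
pose J := fine (\int[mu]_x H x).
have IJ : (\int[mu]_x H x = J%:E)%E by rewrite fineK// ge0_fin_numE.
(* The real and the imaginary part each contribute the square of [(1 - 2 / 3)^-1], that is 9. *)
have eug k : (energy (u k - g)%R <= (18 * J / (9 / 4) ^+ k)%:E)%E.
  have [m1 m2] := mug k.
  apply: (@le_trans _ _ (\int[mu]_x ((18 / (9 / 4) ^+ k)%:E * H x))%E); last first.
    by rewrite ge0_integralZl ?lee_fin ?divr_ge0// IJ -EFinM lee_fin mulrAC.
  apply: ae_ge0_le_integral => //.
  - by move=> x _; rewrite lee_fin sqr_ge0.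
  - exact: measurable_normc2.
  - by move=> x _; rewrite mule_ge0// lee_fin divr_ge0.
  - exact: measurable_funeM.
  apply: filterS aeH => x Hx _; rewrite -(fineK (finH x Hx)) -EFinM lee_fin -B2 normc2E.
  have vk : v k x = u k x by rewrite /v Hx.
  have := (vre x).2 k Hx; have := (vim x).2 k Hx; rewrite vk.
  have -> : (u k - g) x = u k x - g x by [].
  have b0 : 0 <= B x / (1 - 2 / 3) * (2 / 3) ^+ k.
    by rewrite mulr_ge0 ?exprn_ge0// divr_ge0 ?sqrtr_ge0//; lra.
  rewrite !raddfB /=; set y := limn _; set z := limn _ => h1 h2.
  have h3 (a c : R) : 0 <= c -> `|a| <= c -> a ^+ 2 <= c ^+ 2.
    by move=> c0 ac; rewrite -[a ^+ 2]real_normK ?num_real// ler_pXn2r ?nnegrE.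
  apply: le_trans (lerD (h3 _ _ b0 h2) (h3 _ _ b0 h1)) _.
  rewrite le_eqVlt; apply/orP; left; apply/eqP.
  have -> : (B x / (1 - 2 / 3) * (2 / 3) ^+ k) ^+ 2 = 9 * (B x ^+ 2 / (9 / 4) ^+ k).
    have -> : (9 / 4) ^- k = ((2 / 3) ^+ k) ^+ 2 :> R.
      by rewrite exprAC (_ : (2 / 3) ^+ 2 = (9 / 4)^-1) ?exprVn//; field.
    by field.
  by rewrite -mulrDl [18 / _ * _]mulrAC -mulrA -natrD.
have Dug k : square_integrable (u k - g).
  by have [m1 m2] := mug k; split => //; apply: le_lt_trans (eug k) _; exact: ltry.
exists g; first by rewrite (_ : g = u 0%N - (u 0%N - g)); [exact: DB|rewrite subKr].
move=> e e0; have [|||k0 k0P] := @exists_pow_lt R (18 * J) (9 / 4) ((e / 2) ^+ 2).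
- by rewrite mulr_ge0// fine_ge0.
- by rewrite ltr_pdivlMr// mul1r ltr_nat.
- by rewrite exprn_gt0// divr_gt0.
exists k0 => k kk0; apply: (@le_lt_trans _ _ (e / 2)); last by rewrite ltr_pdivrMr// mulr_natr mulr2n ltrDl.
apply: energy_le_l2norm => //; first by rewrite divr_ge0// ltW.
by apply: le_trans (eug k) _; rewrite lee_fin ltW// k0P.
Qed.

End SquareIntegrable.

(** * Almost invariance *)

Section AlmostInvariantSets.
Variables (R : realType) (n : nat) (d : measure_display) (X : measurableType d).
Local Notation V := 'rV[R]_n.+1.
Variables (mu : probability X R) (S : V -> X -> X).
Hypothesis mS : forall v, measurable_fun setT (S v).
Hypothesis invS : forall v A, measurable A -> mu (S v @^-1` A) = mu A.
Implicit Types (A B : set X) (v : V).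

(** The one-sided difference suffices: for measurable sets the other one has the same measure by
    invariance. *)
Definition almost_invariant A := forall e : R, 0 < e -> exists bs, exists2 dl : R, 0 < dl &
  forall v, bohr bs dl v -> (mu (A `\` S v @^-1` A) < e%:E)%E.

Lemma measurable_preimage v A : measurable A -> measurable (S v @^-1` A).
Proof. by move=> mA; rewrite -[_ @^-1` _]setTI; exact: mS. Qed.

Lemma measure_preimageD v A : measurable A ->
  mu (S v @^-1` A `\` A) = mu (A `\` S v @^-1` A).
Proof.
move=> mA; have mSA := measurable_preimage v mA.
rewrite !measureD// ?(le_lt_trans (probability_le1 _ _)) ?ltry//.
by congr (_ - _)%E; [exact: invS|rewrite setIC].
Qed.

Lemma almost_invariant_setC A : measurable A -> almost_invariant A -> almost_invariant (~` A).
Proof.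
move=> mA aA e e0; have [bs [dl dl0 h]] := aA e e0; exists bs, dl => // v /h.
by rewrite -measure_preimageD//; congr (mu _ < _)%E; rewrite preimage_setC !setDE setCK setIC.
Qed.

(** Finitely many of the sets cover the union up to [e / 2], and finitely many Bohr conditions
    combine into one. *)
Lemma almost_invariant_bigcup (F : nat -> set X) : (forall i, measurable (F i)) ->
  (forall i, almost_invariant (F i)) -> almost_invariant (\bigcup_i F i).
Proof.
move=> mF aF e e0; set A := \bigcup_i F i.
have mA : measurable A by exact: bigcupT_measurable.
pose B m := \bigcup_(i in `I_m) F i.
have mB m : measurable (B m) by apply: bigcup_measurable => i _.
have e20 : 0 < e / 2 by rewrite divr_gt0.
have [m mP] : exists m, (mu (A `\` B m) < (e / 2)%:E)%E.
  have cvgB : mu (A `\` B m) @[m --> \oo] --> mu (\bigcap_m (A `\` B m)).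
    apply: nonincreasing_cvg_mu.
    - by rewrite (le_lt_trans (probability_le1 _ _)) ?ltry//; exact: measurableD.
    - by move=> m; exact: measurableD.
    - by apply: bigcapT_measurable => m; exact: measurableD.
    - move=> m k mk; apply/subsetPset => x [Ax nBx]; split => // -[i im Fx]; apply: nBx.
      by exists i => //; exact: leq_trans im mk.
  have I0 : \bigcap_m (A `\` B m) = set0.
    apply/seteqP; split => // x h; have [[i _ Fx] _] := h 0%N I.
    by have [_ []] := h i.+1 I; exists i => /=.
  have {}cvgB : fine (mu (A `\` B m)) @[m --> \oo] --> (0 : R).
    by rewrite -[0]/(fine 0%E) -(measure0 mu) -I0; apply: fine_cvg; rewrite fineK// fin_num_measure// I0.
  have /cvgrPdist_lt/(_ _ e20)[m _ /(_ m (leqnn _))] := cvgB.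
  rewrite sub0r normrN => h; exists m.
  rewrite -(@fineK _ (mu _)); last by apply: fin_num_measure; exact: measurableD.
  by rewrite lte_fin; exact: le_lt_trans (ler_norm _) h.
have [bs [dl dl0 h]] : exists bs, exists2 dl : R, 0 < dl & forall v, bohr bs dl v ->
    (mu (\bigcup_(i in `I_m) (F i `\` S v @^-1` F i)) < (e / 2)%:E)%E.
  elim: (m) (e / 2) e20 => [|k IH] e' e'0.
    by exists [::], 1 => // v _; rewrite II0 bigcup_set0 measure0.
  have e'20 : 0 < e' / 2 by rewrite divr_gt0.
  have [bs [dl dl0 h]] := IH _ e'20; have [cs [dl' dl'0 h']] := aF k _ e'20.
  exists (bs ++ cs), (Num.min dl dl'); first by rewrite lt_min dl0.
  move=> v /bohr_cat[/h h1 /h' h2]; rewrite IIS bigcup_setU bigcup_set1.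
  rewrite [in e'%:E](splitr e') EFinD; apply: le_lt_trans (lteD h1 h2).
  have mD i : measurable (F i `\` S v @^-1` F i).
    by apply: measurableD => //; exact: measurable_preimage.
  by apply: measureU2 => //; apply: bigcup_measurable.
exists bs, dl => // v /h hv.
rewrite [in e%:E](splitr e) EFinD; apply: le_lt_trans (lteD mP hv).
have mD i : measurable (F i `\` S v @^-1` F i).
  by apply: measurableD => //; exact: measurable_preimage.
apply: le_trans (_ : (mu ((A `\` B m) `|` \bigcup_(i in `I_m) (F i `\` S v @^-1` F i)) <= _)%E); last first.
  by apply: measureU2; [exact: measurableD|exact: bigcup_measurable].
apply: le_measure; rewrite ?inE.
- by apply: measurableD => //; exact: measurable_preimage.
- by apply: measurableU; [exact: measurableD|exact: bigcup_measurable].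
move=> x [Ax nSA]; have [Bx|] := pselect (B m x); last by left.
by right; case: Bx => i im Fx; exists i => //; split => // SFx; apply: nSA; exists i.
Qed.

(** The almost invariant measurable sets form a sigma-algebra. *)
Lemma almost_invariant_measurable (G : set (set X)) : @measurable d X = <<s G>> ->
  (forall A, G A -> almost_invariant A) -> forall A, measurable A -> almost_invariant A.
Proof.
move=> mG aG A mA.
suff sG : <<s G>> `<=` [set B | measurable B /\ almost_invariant B].
  by have [] : [set B | measurable B /\ almost_invariant B] A by apply: sG; rewrite -mG.
apply: smallest_sub => [|B GB].
  split.
  - split; first exact: measurable0.
    by move=> e e0; exists [::], 1 => // v _; rewrite set0D measure0.
  - move=> B [mB aB]; rewrite setTD; split; first exact: measurableC.
    exact: almost_invariant_setC.
  - move=> F FP; split; first by apply: bigcupT_measurable => i; case: (FP i).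
    by apply: almost_invariant_bigcup => i; case: (FP i).
split; last exact: aG.
by rewrite mG; exact: sub_sigma_algebra.
Qed.

End AlmostInvariantSets.

Import HBNNSimple.

(** * Koopman operators and almost periodic functions *)

Section KoopmanOperators.
Variables (R : realType) (n : nat) (d : measure_display) (X : measurableType d).
Local Notation V := 'rV[R]_n.+1.
Variables (mu : probability X R) (S : V -> X -> X).
Hypothesis mS : forall v, measurable_fun setT (S v).
Hypothesis invS : forall v A, measurable A -> mu (S v @^-1` A) = mu A.
Hypothesis SS : forall v w x, S w (S v x) = S (v + w) x.
Hypothesis aS : forall A, measurable A -> almost_invariant mu S A.
Local Notation E := (X -> R[i]^o).
Local Notation D := (square_integrable mu).
Local Notation p := (l2norm mu).
Implicit Types (f g : E) (v : V) (h : X -> R).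

Definition koopman v f : E := fun x => f (S v x).

Let UL v (c : R[i]) f g : koopman v (c *: f + g) = c *: koopman v f + koopman v g.
Proof. by []. Qed.

Let UU v w f : koopman v (koopman w f) = koopman (v + w) f.
Proof. by apply/funext => x; rewrite /koopman SS. Qed.

Let energy_koopman v f : D f -> energy mu (koopman v f) = energy mu f.
Proof.
move=> [mr mi _]; rewrite /energy.
rewrite -[LHS](@ge0_integral_pushforward _ _ _ _ _ _ (mS v) mu setT (fun x => (normc (f x) ^+ 2)%:E)) //.
- apply: eq_measure_integral => A mA _; exact: invS.
- exact: measurable_normc2.
- by move=> x _; rewrite lee_fin sqr_ge0.
Qed.

Let UD v f : D f -> D (koopman v f).
Proof.
move=> Df; have [mr mi ef] := Df; split; last by rewrite energy_koopman.
- exact: (measurableT_comp mr (mS v)).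
- exact: (measurableT_comp mi (mS v)).
Qed.

Let pU v f : D f -> p (koopman v f) = p f.
Proof. by move=> Df; rewrite /l2norm energy_koopman. Qed.

Let DZ (c : R[i]) f : D f -> D (c *: f).
Proof. by move=> /(square_integrableZ c)[]. Qed.

Let DD := @square_integrableD _ _ _ mu.
Let pD := @l2normD _ _ _ mu.
Let pZ := @l2normZ _ _ _ mu.

Definition bohr_l2 f := D f /\ bohr_periodic p koopman f.

Let bohr_l2D f g : bohr_l2 f -> bohr_l2 g -> bohr_l2 (f + g).
Proof.
move=> [Df pf] [Dg pg]; split; first exact: DD.
exact: bohr_periodicD DD DZ pD UL UD _ _ Df Dg pf pg.
Qed.

Let bohr_l2Z (c : R[i]) f : bohr_l2 f -> bohr_l2 (c *: f).
Proof.
move=> [Df pf]; split; first exact: DZ.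
exact: bohr_periodicZ DD DZ (@l2norm_ge0 _ _ _ mu) pZ UL UD _ _ Df pf.
Qed.

Let bohr_l2_closed f : D f -> (forall e, 0 < e -> exists2 g, bohr_l2 g & p (f - g) < e) -> bohr_l2 f.
Proof.
move=> Df h; split => //; apply: (bohr_periodic_closed DD DZ pD pZ UL UD pU Df) => e /h[g [Dg pg] fg].
by exists g.
Qed.

Let rc h : E := fun x => (h x)%:C%C.

Let energy_rc h : energy mu (rc h) = (\int[mu]_x (h x ^+ 2)%:E)%E.
Proof. by apply: eq_integral => x _; rewrite normc2E /= expr0n addr0. Qed.

Let D_rc h : measurable_fun setT h -> (\int[mu]_x (h x ^+ 2)%:E < +oo)%E -> D (rc h).
Proof. by move=> mh eh; split; [exact: mh|exact: measurable_cst|rewrite energy_rc]. Qed.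

Let D_indic A : measurable A -> D (rc \1_A).
Proof.
move=> mA; apply: D_rc; first exact: measurable_indic.
rewrite (eq_integral (fun x => (\1_A x)%:E)) => [|x _]; last by rewrite indicE; case: (_ \in _); rewrite ?expr0n ?expr1n.
by rewrite integral_indic// setIT (le_lt_trans (probability_le1 _ _)) ?ltry.
Qed.

(** The energy of the difference of an indicator and its translate is the measure of the symmetric
    difference of the two sets. *)
Let bohr_indic A : measurable A -> bohr_l2 (rc \1_A).
Proof.
move=> mA; have DA := D_indic mA; split => // e e0.
have e20 : 0 < (e / 2) ^+ 2 / 2 by rewrite divr_gt0 ?exprn_gt0 ?divr_gt0.
have [bs [dl dl0 h]] := aS mA e20; exists bs, dl => // v /h hv.
have mSA := measurable_preimage mS v mA.
apply: (@le_lt_trans _ _ (e / 2)); last by rewrite ltr_pdivrMr// mulr_natr mulr2n ltrDl.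
apply: energy_le_l2norm; first by rewrite divr_ge0// ltW.
  by apply: DD; [exact: UD|rewrite -scaleN1r; exact: DZ].
have -> : energy mu (koopman v (rc \1_A) - rc \1_A) =
    (mu (A `\` S v @^-1` A) + mu (S v @^-1` A `\` A))%E.
  rewrite -[A `\` _]setIT -[_ `\` A]setIT -!integral_indic//; try exact: measurableD.
  rewrite -ge0_integralD//; try by move=> x _; rewrite lee_fin.
  - apply: eq_integral => x _; rewrite normc2E -EFinD; congr EFin.
    rewrite -[_ x]/(((\1_A (S v x))%:C - (\1_A x)%:C)%C) /= oppr0 addr0 expr0n addr0 !indicE.
    rewrite !in_setD -[x \in S v @^-1` A]/(S v x \in A).
    by case: (x \in A); case: (S v x \in A); rewrite /= ?subrr ?subr0 ?sub0r ?sqrrN ?expr1n ?expr0n ?addr0 ?add0r.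
  - by apply/measurable_EFinP/measurable_indic/measurableD.
  - by apply/measurable_EFinP/measurable_indic/measurableD.
rewrite measure_preimageD// (_ : (e / 2) ^+ 2 = (e / 2) ^+ 2 / 2 + (e / 2) ^+ 2 / 2); last by rewrite -splitr.
by rewrite EFinD leeD// ltW.
Qed.

Let bohr_nnsfun (s : {nnsfun X >-> R}) : bohr_l2 (rc (s : X -> R)).
Proof.
have -> : rc s = \sum_(y <- finmap.enum_fset (fset_set (range s))) y%:C%C *: rc \1_(s @^-1` [set y]).
  apply/funext => x; rewrite fct_sumE /rc fimfunE fsbig_finite//= rmorph_sum.
  by apply: eq_bigr => y _; rewrite rmorphM.
elim/big_ind: _ => //.
  by rewrite -(scale0r (rc \1_set0)); exact/bohr_l2Z/bohr_indic.
by move=> y _; exact/bohr_l2Z/bohr_indic/measurable_sfunP.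
Qed.

(** Simple functions below [h] converge to it in norm by dominated convergence, with [h ^+ 2] as the
    bound. *)
Let bohr_nonneg h : (forall x, 0 <= h x) -> measurable_fun setT h ->
  (\int[mu]_x (h x ^+ 2)%:E < +oo)%E -> bohr_l2 (rc h).
Proof.
move=> h0 mh eh; apply: bohr_l2_closed; first exact: D_rc.
move=> e e0; have mEh : measurable_fun setT (EFin \o h) by exact/measurable_EFinP.
have Eh0 x : setT x -> (0 <= (EFin \o h) x)%E by move=> _; rewrite lee_fin.
pose s := nnsfun_approx measurableT mEh.
have s0 k x : 0 <= s k x by [].
have sh k x : s k x <= h x.
  by rewrite /s nnsfun_approxE -lee_fin; exact: le_approx.
have sc x : s k x @[k --> \oo] --> h x.
  have /fine_cvgP[_] := cvg_nnsfun_approx measurableT mEh Eh0 (I : setT x).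
  by [].
have mhs k : measurable_fun setT (fun x => ((h x - s k x) ^+ 2)%:E).
  by apply/measurable_EFinP; apply: measurable_funX; apply: measurable_funB.
have ig : mu.-integrable setT (fun x => (h x ^+ 2)%:E).
  apply/integrableP; split; first by apply/measurable_EFinP; exact: measurable_funX.
  by under eq_integral do rewrite gee0_abs ?lee_fin ?sqr_ge0//.
have [||_ _] := @dominated_convergence _ _ _ mu setT measurableT
  (fun k x => ((h x - s k x) ^+ 2)%:E) (cst 0%E) _ mhs (measurable_cst _) _ ig.
- apply: nearW => x _; apply: cvg_EFin; first by apply: nearW.
  rewrite [X in _ --> X](_ : _ = (h x - h x) ^+ 2); last by rewrite subrr expr0n.
  have hc : (h x - s k x) @[k --> \oo] --> h x - h x by apply: cvgB; [exact: cvg_cst|exact: sc].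
  exact: (cvgM hc hc).
- apply: nearW => x k _; rewrite gee0_abs ?lee_fin ?sqr_ge0//.
  by rewrite ler_pXn2r ?nnegrE ?subr_ge0// gerBl.
rewrite integral0 => cvg0.
have e20 : 0 < (e / 2) ^+ 2 by rewrite exprn_gt0 ?divr_gt0.
have [k kP] : exists k, (\int[mu]_x ((h x - s k x) ^+ 2)%:E < ((e / 2) ^+ 2)%:E)%E.
  have /fine_cvgP[[N1 _ fin1] /cvgrPdist_lt/(_ _ e20)[N2 _ near2]] := cvg0.
  exists (maxn N1 N2); have fk := fin1 (maxn N1 N2) (leq_maxl _ _).
  have := near2 (maxn N1 N2) (leq_maxr _ _); rewrite /= sub0r normrN.
  rewrite -[X in (X < _)%E]fineK// lte_fin; exact: le_lt_trans (ler_norm _).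
exists (rc (s k)); first exact: bohr_nnsfun.
apply: (@le_lt_trans _ _ (e / 2)); last by rewrite ltr_pdivrMr// mulr_natr mulr2n ltrDl.
have rB : rc h - rc (s k) = rc (fun x => h x - s k x).
  by apply/funext => x; rewrite /rc rmorphB.
rewrite rB; apply: energy_le_l2norm; rewrite ?energy_rc ?divr_ge0 ?(ltW e0) ?(ltW kP)//.
apply: D_rc; first exact: measurable_funB.
by apply: lt_trans kP _; exact: ltry.
Qed.

Let bohr_real h : measurable_fun setT h -> (\int[mu]_x (h x ^+ 2)%:E < +oo)%E -> bohr_l2 (rc h).
Proof.
move=> mh eh.
have part (h' : X -> R) : (forall x, 0 <= h' x) -> measurable_fun setT h' ->
    (forall x, h' x ^+ 2 <= h x ^+ 2) -> bohr_l2 (rc h').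
  move=> h'0 mh' le_h; apply: bohr_nonneg => //; apply: le_lt_trans eh.
  apply: ge0_le_integral => //.
  - by move=> x _; rewrite lee_fin sqr_ge0.
  - by apply/measurable_EFinP; exact: measurable_funX.
  - by apply/measurable_EFinP; exact: measurable_funX.
  - by move=> x _; rewrite lee_fin.
have -> : rc h = rc h^\+ + (-1) *: rc h^\-.
  apply/funext => x; rewrite -[RHS]/(rc h^\+ x + -1 * rc h^\- x) /rc mulN1r -rmorphB.
  by congr (_%:C)%C; rewrite -[in LHS](funrposBneg h).
apply: bohr_l2D; last apply: bohr_l2Z; apply: part => //.
- exact: measurable_funrpos.
- by move=> x; rewrite /funrpos; case: (leP (h x) 0); rewrite ?expr0n ?sqr_ge0.
- exact: measurable_funrneg.
- by move=> x; rewrite /funrneg; case: (leP (- h x) 0); rewrite ?expr0n ?sqr_ge0 ?sqrrN.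
Qed.

Lemma bohr_square_integrable f : D f -> bohr_periodic p koopman f.
Proof.
move=> [mr mi ef]; suff [] : bohr_l2 f by [].
have part h : measurable_fun setT h -> (forall x, h x ^+ 2 <= normc (f x) ^+ 2) -> bohr_l2 (rc h).
  move=> mh le_f; apply: bohr_real => //; apply: le_lt_trans ef.
  apply: ge0_le_integral => //.
  - by move=> x _; rewrite lee_fin sqr_ge0.
  - by apply/measurable_EFinP; exact: measurable_funX.
  - exact: measurable_normc2.
  - by move=> x _; rewrite lee_fin.
have -> : f = rc (fun x => complex.Re (f x)) + 'i%C *: rc (fun x => complex.Im (f x)).
  by apply/funext => x; rewrite {1}[f x]complexE.
by apply: bohr_l2D; last apply: bohr_l2Z; apply: part => // x; rewrite normc2E ?lerDl ?lerDr sqr_ge0.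
Qed.

Lemma eigenfunction_span f (e : R) : D f -> 0 < e ->
  exists (s : seq (R * V)) (g : V -> E),
    let h := f - \sum_(x <- s) x.1%:C%C *: g x.2 in
    [/\ forall x, x \in s -> D (g x.2) /\
          forall v, {ae mu, forall y, g x.2 (S v y) = expi2pi (dotv x.2 v) * g x.2 y},
        D h & p h < e].
Proof.
move=> Df e0.
have [s [g [gP fg]]] := bohr_periodic_span (square_integrable0 mu) DD DZ (@l2norm_ge0 _ _ _ mu) pD pZ
  (@l2norm_parallelogram _ _ _ mu) (@riesz_fischer _ _ _ mu) UL UU UD pU Df
  (bohr_square_integrable Df) e0.
have DB (f1 f2 : E) : D f1 -> D f2 -> D (f1 - f2).
  by move=> D1 D2; apply: DD => //; rewrite -scaleN1r; exact: DZ.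
exists s, g; split => // [x /gP[Dg eig]|].
  split => // v; have /l2norm_eq0 := eig v.
  move=> /(_ (DB _ _ (UD v Dg) (DZ _ Dg))); apply: filterS => y /eqP.
  by rewrite subr_eq0 => /eqP.
apply: DB => //; rewrite big_seq; elim/big_ind: _ => [|//|x /gP[Dg _]]; last exact: DZ.
exact: square_integrable0.
Qed.

End KoopmanOperators.

(** * The tiling space *)

Section TilingSystem.
Variables (R : realType) (n l : nat) (Phi : substitution R n.+1 l).
Local Notation V := 'rV[R]_n.+1.
Local Notation N := (n.+1%:R : R).
Implicit Types (P : set (tile R n.+1 l)) (v w x : V) (T : tilings Phi).

(** The factor [n.+1%:R] passes from the sup norm, used for translations, to the Euclidean norm of
    the ball patches. *)
Lemma ball_patch_translate (r s : R) v P P' : 0 < r -> N * (r + `|v|) <= s ->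
  ball_patch (proto Phi) s P = ball_patch (proto Phi) s P' ->
  ball_patch (proto Phi) r (translate (- v) P) = ball_patch (proto Phi) r (translate (- v) P').
Proof.
move=> r0 rs.
suff H A B : ball_patch (proto Phi) s A = ball_patch (proto Phi) s B ->
    ball_patch (proto Phi) r (translate (- v) A) `<=` ball_patch (proto Phi) r (translate (- v) B).
  by move=> e; apply/seteqP; split; apply: H.
move=> e _ [[t At <-]]; rewrite /ball_patch/= gt_eqF// => -[x [tx xr]].
have s0 : 0 < s by apply: lt_le_trans rs; rewrite mulr_gt0// ltr_pwDl.
suff [Bt _] : ball_patch (proto Phi) s B t.
  by split; [exists t|exists x].
rewrite -e; split => //; rewrite gt_eqF//; exists (x + v); split => /=.
  by have /tile_supp_translate := tx; rewrite opprK.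
apply: lt_le_trans rs; apply: le_lt_trans (enorm_le_norm _) _.
rewrite ltr_pM2l// (le_lt_trans (ler_normD _ _))// ltrD2r.
exact: le_lt_trans (norm_le_enorm _) xr.
Qed.

Lemma agree_ball_patch (r : R) P P' : 0 < r -> agree Phi r P P' ->
  ball_patch (proto Phi) r P = ball_patch (proto Phi) r P'.
Proof.
move=> r0 a; apply/seteqP; split => t [Pt]; rewrite /ball_patch/= gt_eqF// => -[x [tx xr]];
  (split; last by exists x); apply/(a t) => //; exists x => //; exact: le_lt_trans (norm_le_enorm _) xr.
Qed.

Lemma radius_exists (e K : R) : 0 < e -> 0 <= K -> exists2 dl, 0 < dl & 
  [/\ dl <= e, N * (dl + dl) <= e & N * (e^-1 + K) <= dl^-1].
Proof.
move=> e0 K0; pose a := N * (e^-1 + K); have a0 : 0 < a by rewrite mulr_gt0// ltr_pwDl ?invr_gt0.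
pose b := e / (N * 2); have b0 : 0 < b by rewrite divr_gt0 ?mulr_gt0.
exists (Num.min a^-1 b); first by rewrite lt_min invr_gt0 a0.
have be : N * (b + b) = e by rewrite /b; field; rewrite nat1r pnatr_eq0.
have mb : Num.min a^-1 b <= b by rewrite ge_min lexx orbT.
have N1 : 1 <= N by rewrite ler1n.
split.
- apply: le_trans mb _; rewrite -be; have := ler_wpM2r (ltW b0) N1; nra.
- by rewrite -be ler_wpM2l// lerD.
- rewrite -/a -[leLHS]invrK lef_pV2 ?posrE ?lt_min ?invr_gt0 ?a0//.
  by rewrite ge_min lexx.
Qed.

(** A substitute for the triangle inequality, uniform in the tilings: the two small shifts are
    added, at the price of a smaller patch. *)
Lemma tiling_nbhd_trans (e : R) : 0 < e -> exists2 dl, 0 < dl & forall T T' T'',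
  tiling_nbhd T dl T' -> tiling_nbhd T' dl T'' -> tiling_nbhd T e T''.
Proof.
move=> e0; have [dl dl0 [dle dl2 dlr]] := radius_exists e0 (ltW e0).
exists dl => // T T' T'' [v ve h] [w we h'].
have ei0 : 0 < e^-1 by rewrite invr_gt0.
exists (v + w).
  apply: le_lt_trans (enorm_le_norm _) _; apply: lt_le_trans dl2.
  rewrite ltr_pM2l// (le_lt_trans (ler_normD _ _))// ltrD//.
    exact: le_lt_trans (norm_le_enorm _) ve.
  exact: le_lt_trans (norm_le_enorm _) we.
have er : e^-1 <= dl^-1 by rewrite lef_pV2.
rewrite (ball_patch_sub ei0 er h') opprD -translateD.
apply: ball_patch_translate h => //; apply: le_trans dlr.
rewrite ler_wpM2l// lerD2l (le_trans (norm_le_enorm _))// ltW//.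
exact: lt_le_trans we dle.
Qed.

Lemma tiling_nbhd_refl T (e : R) : 0 < e -> tiling_nbhd T e T.
Proof.
move=> e0; exists 0; last by rewrite oppr0 translate0.
by rewrite /enorm dotv0r sqrtr0.
Qed.

Lemma shift_open v (U : set (tilings Phi)) : tilings_open U -> tilings_open (Defs.shift v @^-1` U).
Proof.
move=> oU T /oU[e e0 eU]; have [dl dl0 [dle _ dlr]] := radius_exists e0 (normr_ge0 v).
exists dl => // T' [w we h]; apply: eU; exists w; first exact: lt_le_trans we dle.
rewrite /= translateD addrC -translateD.
by apply: ball_patch_translate h; rewrite ?invr_gt0.
Qed.

(* The points whose neighbourhood of fixed size e lies in U, up to a small perturbation; the perturbation makes
   the set open. *)
Definition deep (U : set (tilings Phi)) (e : R) : set (tilings Phi) :=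
  [set T | exists2 dl, 0 < dl & forall T', tiling_nbhd T dl T' -> tiling_nbhd T' e `<=` U].

Lemma deep_open U e : tilings_open (deep U e).
Proof.
move=> T [dl dl0 h]; have [dl' dl'0 h'] := tiling_nbhd_trans dl0.
by exists dl' => // T' TT'; exists dl' => // T'' T'T''; apply: h; exact: h' TT' T'T''.
Qed.

Lemma deep_sub U e T : 0 < e -> deep U e T -> tiling_nbhd T e `<=` U.
Proof. by move=> e0 [dl dl0]; apply; exact: tiling_nbhd_refl. Qed.

Lemma deep_mono U e e' : 0 < e' -> e' <= e -> deep U e `<=` deep U e'.
Proof.
move=> e'0 ee T [dl dl0 h]; exists dl => // T' /h; apply: subset_trans.
exact: tiling_nbhd_sub.
Qed.

Lemma deep_exhausts U : tilings_open U -> U = \bigcup_k deep U k.+1%:R^-1.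
Proof.
move=> oU; apply/seteqP; split => [T /oU[e e0 eU]|T [k _ h]]; last first.
  have k0 : 0 < k.+1%:R^-1 :> R by rewrite invr_gt0.
  by apply: (deep_sub k0 h); exact: tiling_nbhd_refl.
have [dl dl0 h] := tiling_nbhd_trans e0.
exists (Num.truncn dl^-1) => //; exists dl => // T' TT' T'' T'T''; apply/eU/(h _ _ _ TT').
apply: tiling_nbhd_sub T'T''; rewrite ?invr_gt0//.
rewrite -[leRHS]invrK lef_pV2 ?posrE ?invr_gt0//.
by rewrite ltW// truncnS_gt.
Qed.

End TilingSystem.

(** * Almost invariance of open sets of tilings *)

Section TilingMeasure.
Variables (R : realType) (n l : nat) (Phi : substitution R n.+1 l) (T0 : tilings Phi).
Local Notation V := 'rV[R]_n.+1.
Local Notation X := (borel_tilings T0).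
Variable mu : probability X R.
Hypothesis inv : translation_invariant mu.
Local Notation S := (@Defs.shift R n.+1 l Phi : V -> X -> X).

Lemma measurable_open (U : set X) : tilings_open (U : set (tilings Phi)) -> measurable U.
Proof. by move=> oU; apply: sub_sigma_algebra. Qed.

Lemma measurable_shift v : measurable_fun setT (S v).
Proof.
apply: (@measurability _ _ X X setT (S v) (@open (pointed_tilings T0)) erefl).
by move=> _ [U oU <-]; rewrite setTI; apply: measurable_open; exact: shift_open.
Qed.

Lemma shiftD v w (T : X) : S w (S v T) = S (v + w) T.
Proof. by apply: val_inj; rewrite /= translateD opprD. Qed.

(** By invariance the measure of [A] is the mean over the grid of the measures of its preimages,
    that is, the integral of a frequency bounded by [e]. *)
Lemma measure_le_frequency (A : set X) (e : R) H : (0 < H)%N -> measurable A ->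
  (forall T : X, #|[pred f : {ffun 'I_n.+1 -> 'I_H} | S (grid_pt R f) T \in A]|%:R <= e * H%:R ^+ n.+1) ->
  (mu A <= e%:E)%E.
Proof.
move=> H0 mA h; pose F := {ffun 'I_n.+1 -> 'I_H}.
have mSA (f : F) : measurable (S (grid_pt R f) @^-1` A).
  exact: measurable_preimage measurable_shift _ _ mA.
have m1 (f : F) : measurable_fun setT (fun T : X => (\1_(S (grid_pt R f) @^-1` A) T : R)%:E).
  by apply/measurable_EFinP/measurable_indic.
have sumE : (\int[mu]_T \sum_(f : F) (\1_(S (grid_pt R f) @^-1` A) T : R)%:E = #|F|%:R%:E * mu A)%E.
  rewrite ge0_integral_sum//.
  under eq_bigr do rewrite integral_indic// setIT.
  rewrite (eq_bigr (fun=> mu A)) => [|f _]; last exact: inv.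
  rewrite -[mu A]fineK ?fin_num_measure// sumEFin -EFinM sumr_const mulr_natl.
  by congr EFin; congr (_ *+ _); apply: eq_card => f; rewrite inE.
have : (\int[mu]_T \sum_(f : F) (\1_(S (grid_pt R f) @^-1` A) T : R)%:E <=
    \int[mu]_T (cst (e * H%:R ^+ n.+1)%:E T))%E.
  apply: ge0_le_integral => //.
  - by move=> T _; apply: sume_ge0 => f _; rewrite lee_fin.
  - exact: emeasurable_sum.
  move=> T _; rewrite sumEFin lee_fin; apply: le_trans (h T).
  rewrite -sum1_card natr_sum [leRHS]big_mkcond /=; apply: ler_sum => f _.
  by rewrite indicE inE -[T \in _]/(S (grid_pt R f) T \in A); case: (_ \in A).
rewrite sumE integral_cst// -[mu A]fineK ?fin_num_measure//.
rewrite [X in (_ <= _ * X)%E -> _](_ : _ = 1%E); last exact: probability_setT.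
rewrite mule1.
rewrite -EFinM !lee_fin card_ffun !card_ord natrX mulrC ler_pM2r//.
by rewrite exprn_gt0// ltr0n.
Qed.

Hypothesis almost_periods : forall r e : R, 0 < r -> 0 < e -> exists cs : seq V,
  forall eta : R, 0 < eta -> exists2 dl : R, 0 < dl & forall w, bohr cs dl w ->
    exists2 g, discrepancy_le Phi r g e & `|w - g| <= eta.

(** Up to measure [e / 2] a tiling of [U] lies in [U] together with its neighbourhood of a fixed
    size. Such a tiling leaves [U] under the shift by [v] only if it disagrees with its translate by
    [- g] within a fixed radius, and the frequency of this bounds the measure. *)
Lemma almost_invariant_open (U : set X) : tilings_open (U : set (tilings Phi)) ->
  almost_invariant mu S U.
Proof.
move=> oU e e0; have e20 : 0 < e / 2 by rewrite divr_gt0.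
have mU := measurable_open oU.
have mW k : measurable (deep U k.+1%:R^-1 : set X) by apply: measurable_open; exact: deep_open.
have [k kP] : exists k, (mu (U `\` deep U k.+1%:R^-1) < (e / 2)%:E)%E.
  have cvgB : mu (U `\` deep U k.+1%:R^-1) @[k --> \oo] --> mu (\bigcap_k (U `\` deep U k.+1%:R^-1)).
    apply: nonincreasing_cvg_mu.
    - by rewrite (le_lt_trans (probability_le1 _ _)) ?ltry//; exact: measurableD.
    - by move=> k; exact: measurableD.
    - by apply: bigcapT_measurable => k; exact: measurableD.
    - move=> k m km; apply/subsetPset => T [UT nW]; split => // W; apply: nW.
      by apply: deep_mono W; rewrite ?invr_gt0// lef_pV2 ?posrE// ler_nat.
  have I0 : \bigcap_k (U `\` deep U k.+1%:R^-1) = set0.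
    apply/seteqP; split => // T h; have [UT _] := h 0%N I.
    by move: UT; rewrite {1}(deep_exhausts oU) => -[k _ W]; have [_] := h k I.
  have {}cvgB : fine (mu (U `\` deep U k.+1%:R^-1)) @[k --> \oo] --> (0 : R).
    by rewrite -[0]/(fine 0%E) -(measure0 mu) -I0; apply: fine_cvg; rewrite fineK// fin_num_measure// I0.
  have /cvgrPdist_lt/(_ _ e20)[k _ /(_ k (leqnn _))] := cvgB.
  rewrite sub0r normrN => h; exists k.
  rewrite -(@fineK _ (mu _)); last by apply: fin_num_measure; exact: measurableD.
  by rewrite lte_fin; exact: le_lt_trans (ler_norm _) h.
have N0 : 0 < n.+1%:R :> R by [].
(* Large enough for agreement within [r] to survive a further shift by [v - g], of norm at most 1,
   on the Euclidean ball of radius [k.+1%:R]. *)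
pose r : R := n.+1%:R * (k.+1%:R + 1).
have r0 : 0 < r by rewrite mulr_gt0// addr_gt0.
have [cs csP] := almost_periods r0 (divr_gt0 e20 (ltr0n R 2) : 0 < e / 2 / 2).
(* The Euclidean length of [v - g] is then at most [k.+2%:R^-1], below the size [k.+1%:R^-1] of the
   neighbourhood. *)
pose eta : R := (n.+1%:R * k.+2%:R)^-1.
have eta0 : 0 < eta by rewrite invr_gt0 mulr_gt0.
have [dl dl0 dlP] := csP _ eta0; exists cs, dl => // v /dlP[g [H0 gP] vg].
have mSU := measurable_preimage measurable_shift v mU.
pose A := deep U k.+1%:R^-1 `\` S v @^-1` U.
have mA : measurable (A : set X) by exact: measurableD.
have AP (T : X) : A T -> ~ agree Phi r (\val T) (translate (- g) (\val T)).
  move=> [WT nU] ag; apply: nU.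
  have k0 : 0 < k.+1%:R^-1 :> R by rewrite invr_gt0.
  apply: (deep_sub k0 WT); exists (v - g).
    apply: le_lt_trans (enorm_le_norm _) _; apply: le_lt_trans (ler_wpM2l (ltW N0) vg) _.
    rewrite /eta invfM mulrA divff ?mul1r ?gt_eqF// ltf_pV2 ?posrE// ltr_nat//.
  rewrite invrK /= -[in translate (- v) _](subrK g v) addrC opprD -translateD.
  apply/esym/ball_patch_translate; last exact: agree_ball_patch ag.
    by [].
  rewrite /r ler_pM2l// lerD2l (le_trans vg)// invf_le1 ?mulr_gt0//.
  by rewrite -natrM ler1n.
have muA : (mu A <= (e / 2 / 2)%:E)%E.
  apply: (@measure_le_frequency _ _ (maxn H0 1)) => // [|T]; first by rewrite leq_max orbT.
  apply: le_trans (gP (maxn H0 1) (\val T) (leq_maxl _ _) (set_mem (valP T))).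
  rewrite ler_nat; apply/subset_leq_card/fintype.subsetP => f; rewrite !inE => /AP.
  by rewrite /= translateD -opprD => /asboolPn.
apply: (@le_lt_trans _ _ (mu (U `\` deep U k.+1%:R^-1) + mu A)%E); last first.
  rewrite [in e%:E](splitr e) EFinD; apply: lte_leD => //; first exact: fin_num_measure.
  apply: le_trans muA _; rewrite lee_fin; lra.
apply: le_trans (measureU2 _ _ _); [|exact: measurableD|exact: mA].
apply: le_measure; rewrite ?inE.
- exact: measurableD.
- by apply: measurableU => //; exact: measurableD.
move=> T [UT nSU]; have [WT|nWT] := pselect (deep U k.+1%:R^-1 T); first by right.
by left.
Qed.

End TilingMeasure.

(** * Comparison of the two norms and pure discrete spectrum *)

Section PureDiscreteSpectrum.
Variables (R : realType) (n l : nat) (Phi : substitution R n l) (T0 : tilings Phi).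
Local Notation X := (borel_tilings T0).
Variable mu : probability X R.
Implicit Types f g : X -> R[i].

Lemma L2norm_energy f : L2norm mu f = (energy mu f `^ 2^-1)%E.
Proof.
rewrite /L2norm unlock /=; congr (_ `^ _)%E; apply: eq_integral => T _.
rewrite /= ger0_norm ?powR_mulrn//; by case: (f T) => a b; exact: sqrtr_ge0.
Qed.

Lemma L2norm_l2norm f : square_integrable mu f -> L2norm mu f = (l2norm mu f)%:E.
Proof.
move=> Df; rewrite L2norm_energy -l2norm_sqr// poweR_EFin; congr EFin.
by rewrite -powR_mulrn ?l2norm_ge0// -powRrM divff ?pnatr_eq0// powRr1 ?l2norm_ge0.
Qed.

Lemma inL2_square_integrable f : inL2 mu f <-> square_integrable mu f.
Proof.
split=> [[mr mi h]|Df]; last first.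
  by have [mr mi _] := Df; split => //; rewrite L2norm_l2norm// ltry.
split => //; rewrite ltey; apply: contraTneq h => e.
by rewrite L2norm_energy e poweRyr ?ltxx// invr_eq0 pnatr_eq0.
Qed.

End PureDiscreteSpectrum.

Theorem theorem3p1 (R : realType) (n l : nat) (Phi : substitution R n l)
  (primitive_Phi : primitive Phi)
  (aperiodic_Phi : aperiodic Phi)
  (FLC_Phi : FLC Phi)
  (pisot_Phi : exists m d : nat, pisot_family_type (expansion Phi) m d)
  (Q : set (tile R n l))
  (finite_Q : finite_set Q)
  (patch_Q : is_patch (proto Phi) Q)
  (b : n.-tuple 'rV[R]_n)
  (basis_b : basis_of fullv b)
  (tiling_Q : is_tiling (proto Phi) (periodic_extension b Q))
  (v : 'rV[R]_n)
  (independent_v : completely_rationally_independent b v)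
  (coincident_Q : densely_eventually_coincident Phi
     (periodic_extension b Q) (translate (- v) (periodic_extension b Q)))
  (T0 : tilings Phi)
  (mu : probability (borel_tilings T0) R)
  (invariant_mu : translation_invariant mu) :
  pure_discrete_spectrum mu.
Proof.
move=> f L2f e e0; have Df := (inL2_square_integrable mu f).1 L2f.
(* In dimension 0 every translation is trivial, so [f] itself is an eigenfunction of eigenvalue
   0. *)
case: n => [|n] in Phi primitive_Phi aperiodic_Phi FLC_Phi pisot_Phi Q finite_Q patch_Q b basis_b
  tiling_Q v independent_v coincident_Q T0 mu invariant_mu f L2f Df *.
  exists 1%N, (fun=> 1), (fun=> f), (fun=> 0); split => [_|].
    split => // w; apply: nearW => T; rewrite /dotv big_ord0 expi2pi0 mul1r; congr f.
    by apply: val_inj; rewrite /= thinmx0 translate0.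
  rewrite (_ : (fun _ => _) = (0 : borel_tilings T0 -> R[i]^o)).
    have D0 := square_integrable0 mu; rewrite L2norm_l2norm// lte_fin.
    by rewrite -(scale0r 0) l2normZ// Normc.normc0 mul0r.
  by apply/funext => T; rewrite big_ord1 mul1r subrr.
have TT0 := set_mem (valP T0).
(* The sigma-algebra of [borel_tilings] is by definition generated by the open sets, hence
   [erefl]. *)
have aS := almost_invariant_measurable (@measurable_shift _ _ _ _ T0) invariant_mu erefl
  (@almost_invariant_open _ _ _ _ T0 mu invariant_mu
    (almost_periods primitive_Phi FLC_Phi TT0 pisot_Phi tiling_Q independent_v coincident_Q)).
have [s [g [gP Dfg fg]]] := eigenfunction_span (@measurable_shift _ _ _ _ T0) invariant_mu
  (@shiftD _ _ _ _ T0) aS Df e0.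
pose x0 : R * 'rV[R]_n.+1 := (0, 0).
exists (size s), (fun j => (nth x0 s j).1%:C%C), (fun j => g (nth x0 s j).2), (fun j => (nth x0 s j).2).
split => [j|].
  have [Dg eig] := gP _ (mem_nth x0 (ltn_ord j)); split; first exact/inL2_square_integrable.
  exact: eig.
rewrite (_ : (fun _ => _) = f - \sum_(x <- s) x.1%:C%C *: (g x.2 : borel_tilings T0 -> R[i]^o)).
  by rewrite L2norm_l2norm ?lte_fin.
apply/funext => T; rewrite -[RHS]/(f T - _ T) fct_sumE (big_nth x0) big_mkord.
by [].
Qed.
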